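(* Let $X(K,U)$ be an Oeljeklaus-Toma manifold of type $(s,t)$ and complex dimension $n=s+t\ge 4$. Fix an arbitrary integer $k$ with $2\le k\le n-2$. Then there is no Hermitian metric on $X(K,U)$ whose associated $(1,1)$-form $\omega$ satisfies $\partial\overline\partial\omega^k=0$.
   Context: Oeljeklaus-Toma manifolds: let $s,t\ge 1$ be integers and $K$ a number field with exactly $s$ real embeddings $\sigma_1,\dots,\sigma_s$ and $2t$ non-real complex embeddings $\sigma_{s+1},\dots,\sigma_{s+2t}$, labelled so that $\sigma_{s+t+j}=\overline{\sigma_{s+j}}$ for $1\le j\le t$. Let $\mathcal O_K$ be the ring of integers and $\mathcal O_K^{*,+}$ the group of totally positive units (units $u$ with $\sigma_j(u)>0$ for $1\le j\le s$). Let $\mathbb H\subset\mathbb C$ be the upper half-plane. On $\mathbb H^s\times\mathbb C^t$, $a\in\mathcal O_K$ acts by translation by $(\sigma_1(a),\dots,\sigma_{s+t}(a))$ and $u\in\mathcal O_K^{*,+}$ acts by multiplying the $j$-th coordinate by $\sigma_j(u)$. A subgroup $U\subset\mathcal O_K^{*,+}$ of rank $s$ is admissible if the resulting fixed-point-free action of $\mathcal O_K\rtimes U$ on $\mathbb H^s\times\mathbb C^t$ is properly discontinuous and co-compact (by construction $\{(\log\sigma_1(u),\dots,\log\sigma_s(u)):u\in U\}$ is a lattice of rank $s$ in $\mathbb R^s$). For admissible $U$, the Oeljeklaus-Toma manifold of type $(s,t)$ is the compact complex manifold $X(K,U)=(\mathbb H^s\times\mathbb C^t)/(\mathcal O_K\rtimes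 U)$, of complex dimension $n=s+t$. The $(1,1)$-form associated with a Hermitian metric $g$ is $\omega=g(J\cdot,\cdot)$, where $J$ is the complex structure; $\omega^k$ is its $k$-th wedge power. *)

(* Defs.v *)
(* MathComp world: MathComp-Analysis for calculus over an arbitrary
   R : realType, real-closed for the complex numbers R[i].                    *)
From HB Require Import structures.
From mathcomp Require Export all_boot all_order all_algebra all_field.
From mathcomp Require Export all_classical all_reals all_analysis.
From mathcomp Require Export complex.
Export numFieldNormedType.Exports.

Set Implicit Arguments.
Unset Strict Implicit.
Unset Printing Implicit Defensive.

Import Order.TTheory GRing.Theory Num.Theory.
Local Open Scope complex_scope.
Local Open Scope classical_set_scope.
Local Open Scope ring_scope.

(******************************************************************************)
(*  Calculus on C^n, seen as a real normed space                              *)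
(******************************************************************************)

(* The pair (x, y) stands for x + i y. Since C^n is an affine space, the same
   type serves for points and for real tangent vectors.                       *)
Notation Cn R n := ('rV[R]_n * 'rV[R]_n)%type.

Section ComplexSpace.
Context {R : realType} {n : nat}.

Definition zcoord (p : Cn R n) (j : 'I_n) : R[i] := p.1 0 j +i* p.2 0 j.

Definition of_coords (z : 'I_n -> R[i]) : Cn R n :=
  (\row_j complex.Re (z j), \row_j complex.Im (z j)).

Definition cplxJ (v : Cn R n) : Cn R n := of_coords (fun j => 'i * zcoord v j).

Definition evec (j : 'I_n) : Cn R n := of_coords (fun l => (l == j)%:R).

(* All iterated directional derivatives of order <= m exist and are continuous
   at every point of A (only used for A open).                                *)
Fixpoint diff_class (m : nat) (A : set (Cn R n)) (f : Cn R n -> R) : Prop :=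
  (forall p, A p -> {for p, continuous f}) /\
  (if m is m'.+1 then
     forall v : Cn R n,
       (forall p, A p -> derivable f p v) /\ diff_class m' A ('D_v f)
   else True).

Definition smooth_on (A : set (Cn R n)) (f : Cn R n -> R) : Prop :=
  forall m, diff_class m A f.

Definition cderive (v : Cn R n) (f : Cn R n -> R[i]) (p : Cn R n) : R[i] :=
  'D_v (fun q => complex.Re (f q)) p +i* 'D_v (fun q => complex.Im (f q)) p.

(* The complexified tangent space has the frame (E_a) indexed by 'I_(n + n):
   E_(lshift n j) = d/dz_j    = (d/dx_j - i d/dy_j) / 2,
   E_(rshift n j) = d/dzbar_j = (d/dx_j + i d/dy_j) / 2,
   and E_a = frame_re a + i frame_im a with real vectors frame_re, frame_im.  *)
Definition frame_re (a : 'I_(n + n)) : Cn R n :=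
  match fintype.split a with
  | inl j => 2^-1 *: evec j
  | inr j => 2^-1 *: evec j
  end.

Definition frame_im (a : 'I_(n + n)) : Cn R n :=
  match fintype.split a with
  | inl j => - (2^-1 *: cplxJ (evec j))
  | inr j => 2^-1 *: cplxJ (evec j)
  end.

Definition frame_derive (a : 'I_(n + n)) (f : Cn R n -> R[i]) (p : Cn R n) :
    R[i] :=
  cderive (frame_re a) f p + 'i * cderive (frame_im a) f p.

(******************************************************************************)
(*  Complex differential forms on open subsets of C^n                         *)
(******************************************************************************)

(* Let (theta_a) be the coframe dual to (E_a): theta_(lshift n j) = dz_j and
   theta_(rshift n j) = dzbar_j. A form alpha is given by its coefficients:
   alpha = \sum_S alpha S * theta_S, with theta_S the wedge product of the
   theta_a for a in S, in increasing order.                                   *)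
Definition dform : Type := {set 'I_(n + n)} -> Cn R n -> R[i].

(* theta_S /\ theta_T = shuffle_sign S T * theta_(S :|: T) for disjoint S, T  *)
Definition shuffle_sign (S T : {set 'I_(n + n)}) : R[i] :=
  \prod_(a in S) \prod_(b in T | (b < a)%N) (-1).

Definition dform1 : dform := fun S _ => (#|S| == 0)%:R.

Definition wedge (alpha beta : dform) : dform := fun S p =>
  \sum_(T : {set 'I_(n + n)} | T \subset S)
     shuffle_sign T (S :\: T) * (alpha T p * beta (S :\: T) p).

Definition wedge_pow (k : nat) (alpha : dform) : dform :=
  iter k (wedge alpha) dform1.

(* \sum_a theta_a /\ E_a(alpha), over the indices a satisfying P              *)
Definition partial_d (P : pred 'I_(n + n)) (alpha : dform) : dform :=
  fun S p =>
  \sum_(a in S | P a)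
     (\prod_(b in S | (b < a)%N) (-1)) * frame_derive a (alpha (S :\ a)) p.

Definition del (alpha : dform) : dform := partial_d (fun a => (a < n)%N) alpha.
Definition delbar (alpha : dform) : dform :=
  partial_d (fun a => (n <= a)%N) alpha.

(* Value on (E_a, E_c) of the complex bilinear extension of b                 *)
Definition frame_val (b : Cn R n -> Cn R n -> R) (a c : 'I_(n + n)) : R[i] :=
  (b (frame_re a) (frame_re c) - b (frame_im a) (frame_im c))
  +i* (b (frame_re a) (frame_im c) + b (frame_im a) (frame_re c)).

(* The real 2-form p |-> b p, for b p alternating, as an element of dform     *)
Definition two_form (b : Cn R n -> Cn R n -> Cn R n -> R) : dform := fun S p =>
  \sum_(a in S) \sum_(c in S | (#|S| == 2)%N && (a < c)%N) frame_val (b p) a c.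

(* J-invariant inner products on the real vector space C^n                    *)
Record hermitian_product (b : Cn R n -> Cn R n -> R) : Prop := {
  herm_sym : forall v w, b v w = b w v;
  herm_linear : forall (c : R) (v v' w : Cn R n),
    b (c *: v + v') w = c * b v w + b v' w;
  herm_pos : forall v : Cn R n, v != 0 -> 0 < b v v;
  herm_J : forall v w, b (cplxJ v) (cplxJ w) = b v w
}.

(* omega = g(J . , . )                                                        *)
Definition fundamental_form (g : Cn R n -> Cn R n -> Cn R n -> R) : dform :=
  two_form (fun p v w => g p (cplxJ v) w).

End ComplexSpace.
Arguments dform R n : clear implicits.

(******************************************************************************)
(*  Number fields                                                             *)
(******************************************************************************)

Section NumberField.
Context {R : realType} {s t : nat} {K : fieldExtType rat}.

Definition alg_integer (x : K) : Prop := integralOver (intr : int -> K) x.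

(* sigma lists the embeddings of K, each of them once: s real ones, then t
   pairwise non-conjugate non-real ones, then their conjugates.               *)
Record labelled_embeddings (sigma : 'I_(s + t + t) -> {rmorphism K -> R[i]}) :
    Prop := {
  emb_inj : forall i j, sigma i =1 sigma j -> i = j;
  emb_all : forall tau : {rmorphism K -> R[i]}, exists i, tau =1 sigma i;
  emb_real : forall (j : 'I_s) x,
    complex.Im (sigma (lshift t (lshift t j)) x) = 0;
  emb_nonreal : forall i : 'I_(s + t + t), (s <= i)%N ->
    exists x, complex.Im (sigma i x) != 0;
  emb_conj : forall (j : 'I_t) x,
    sigma (rshift (s + t) j) x = (sigma (lshift t (rshift s j)) x)^*%C
}.

Variable sigma : 'I_(s + t + t) -> {rmorphism K -> R[i]}.

Definition totally_positive_unit (u : K) : Prop :=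
  [/\ u != 0, alg_integer u, alg_integer u^-1 &
      forall j : 'I_s, 0 < sigma (lshift t (lshift t j)) u].

Definition mult_independent (r : nat) (e : 'I_r -> K) : Prop :=
  forall m : 'I_r -> int, \prod_i e i ^ m i = 1 -> forall i, m i = 0.

Definition has_rank (U : set K) (r : nat) : Prop :=
  (exists e : 'I_r -> K, (forall i, U (e i)) /\ mult_independent e) /\
  ~ (exists e : 'I_r.+1 -> K, (forall i, U (e i)) /\ mult_independent e).

(******************************************************************************)
(*  The action on H^s x C^t, and its quotient X(K, U)                         *)
(******************************************************************************)

Definition emb (j : 'I_(s + t)) (x : K) : R[i] := sigma (lshift t j) x.

Definition HsCt : set (Cn R (s + t)) :=
  [set p | forall j : 'I_s, 0 < complex.Im (zcoord p (lshift t j))].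

(* The action of (a, u) in the semidirect product O_K x| U, and its (constant)
   differential.                                                              *)
Definition act (g : K * K) (p : Cn R (s + t)) : Cn R (s + t) :=
  of_coords (fun j => emb j g.2 * zcoord p j + emb j g.1).

Definition dact (g : K * K) (v : Cn R (s + t)) : Cn R (s + t) :=
  of_coords (fun j => emb j g.2 * zcoord v j).

Variable U : set K.

Definition OT_group : set (K * K) := [set g | alg_integer g.1 /\ U g.2].

Definition properly_discontinuous : Prop :=
  forall C : set (Cn R (s + t)), compact C -> C `<=` HsCt ->
    finite_set [set g | OT_group g /\ exists2 p, C p & C (act g p)].

Definition cocompact : Prop :=
  exists2 C : set (Cn R (s + t)), compact C &
    C `<=` HsCt /\
    forall p, HsCt p -> exists2 g, OT_group g & C (act g p).

Record admissible : Prop := {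
  adm_unit : forall u, U u -> totally_positive_unit u;
  adm_one : U 1;
  adm_mul : forall u v, U u -> U v -> U (u * v);
  adm_inv : forall u, U u -> U u^-1;
  adm_rank : has_rank U s;
  adm_discontinuous : properly_discontinuous;
  adm_cocompact : cocompact
}.

(* A point of X(K, U) is an orbit.                                            *)
Definition OT_proj (p : Cn R (s + t)) : set (Cn R (s + t)) :=
  [set act g p | g in OT_group].

(* The holomorphic atlas of X(K, U): its charts are the inverses of the
   restrictions of OT_proj to the open sets A on which OT_proj is injective; A
   is then the image of the chart in C^(s + t). The transition map from A to B
   coincides, near a point p of A with act g p in B, with act g.              *)
Definition OT_chart (A : set (Cn R (s + t))) : Prop :=
  [/\ open A, A `<=` HsCt &
      forall p q, A p -> A q -> OT_proj p = OT_proj q -> p = q].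

(* A Hermitian metric on X(K, U): g A is its expression in the chart A, and
   these expressions are related by the transition maps. The values of g A off
   A, and of g A when A is not a chart, are irrelevant.                       *)
Record hermitian_metric
    (g : set (Cn R (s + t)) ->
         Cn R (s + t) -> Cn R (s + t) -> Cn R (s + t) -> R) : Prop := {
  metric_smooth : forall A, OT_chart A ->
    forall v w, smooth_on A (fun p => g A p v w);
  metric_herm : forall A, OT_chart A ->
    forall p, A p -> hermitian_product (g A p);
  metric_transition : forall A B, OT_chart A -> OT_chart B ->
    forall (ga : K * K) p, OT_group ga -> A p -> B (act ga p) ->
    forall v w, g A p v w = g B (act ga p) (dact ga v) (dact ga w)
}.

(* del delbar omega^k = 0 on X(K, U)                                          *)
Definition ddbar_pow_closed
    (g : set (Cn R (s + t)) ->
         Cn R (s + t) -> Cn R (s + t) -> Cn R (s + t) -> R) (k : nat) : Prop :=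
  forall A, OT_chart A -> forall S p, A p ->
    del (delbar (wedge_pow k (fundamental_form (g A)))) S p = 0.

End NumberField.

(* Main.v *)
(* Glue the metric to an equivariant one on H^s x C^t. Every coefficient of
   omega^k, divided by a suitable monomial in the imaginary parts y_1, .., y_s,
   is bounded with all its derivatives, since the quotient is compact; the
   exponents come from |sigma_(s+i) u|^2 = \prod_j (sigma_j u)^(-c_ij). In the
   coordinates log y_j the averages of a derivative over long translations are
   small, so each component of del delbar omega^k = 0 turns into a linear
   relation between means of coefficients, whose factors are polynomials in the
   c_ij. The diagonal coefficients are determinants of positive Hermitian
   matrices up to a constant, so a relation involving a single one of them
   kills its factor. If k >= t this is already absurd. If k < t, every sum of k
   of the numbers c_1j, .., c_tj is 0 or 1, while the sum of all of them is 1,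
   so that up to order they are (1, 0, .., 0), or (1/k - 1, 1/k, .., 1/k) with
   t = 2k. Two real places are excluded by other components. For s = 1, some
   relation |sigma_i u|^2 = 1, or |sigma_i u|^(2k) sigma_1 u = 1, is transported
   to the other embeddings, where the absolute values contradict it. *)

(* Why exponents appear as factors: a coefficient of weight e is f = y^e F with F bounded, and y_j
   df/dy_j = y^e (e_j F + dF/d(log y_j)). The last term is the derivative of a bounded function and
   averages out, so on means d/dy_j acts as multiplication by e_j. Derivatives in x_j and at complex
   places average to 0, so only real places produce factors. All terms of one component of del
   delbar omega^k have the same weight, so the relation survives division by a single monomial.

   The obstacle is that a derivative in x_j or at a complex place changes the weight with no
   matching change of variable: after division by the weight of the derivative, its primitive is
   bounded only where the log y_j are bounded. Hence the means are taken in two stages, a fixed list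
   of translations first, then horizontal ones chosen for each bounded range of the log y_j.

   That the logarithms of units span R^s, on which the c_ij rest, is extracted from co-compactness:
   a linear relation among them would bound the constant 1 by a nonconstant monomial. That the c_ij
   add up to 1 over i is the norm of a unit being 1 or -1. *)
From HB Require Import structures.
Require Import Defs.
From mathcomp Require finmap.
From mathcomp Require Import ring lra zify.

Set Implicit Arguments.
Unset Strict Implicit.
Unset Printing Implicit Defensive.

Import Order.TTheory GRing.Theory Num.Theory.
Import numFieldNormedType.Exports.
Import ComplexField.Normc.

Local Open Scope ring_scope.

(** * Directional derivatives *)

Section DirectionalDerivative.
Local Open Scope classical_set_scope.
Local Open Scope ring_scope.
Context {R : realType} {V : normedModType R}.
Implicit Types (f : V -> R) (p v w : V).

Lemma is_derive_line f p v (x : R) : derivable f (x *: v + p) v ->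
  is_derive x (1 : R) (fun y : R => f (y *: v + p)) ('D_v f (x *: v + p)).
Proof.
have e : (fun h : R => h^-1 *: (f ((h *: (1 : R) + x) *: v + p) - f (x *: v + p)))
       = (fun h : R => h^-1 *: (f (h *: v + (x *: v + p)) - f (x *: v + p))).
  by apply/funext => h; rewrite (_ : h *: (1 : R) = h) ?scalerDl ?addrA //; exact: mulr1.
move=> fd; split; first by rewrite /derivable /= e.
by rewrite /derive /= e.
Qed.

Lemma mean_value_line f p v (h : R) :
  (forall x : R, `|x| <= `|h| -> derivable f (x *: v + p) v) ->
  exists2 x : R, `|x| <= `|h| & f (h *: v + p) - f p = h * 'D_v f (x *: v + p).
Proof.
move=> fd.
have [h0|h0] := leP 0 h.
- have fd' x : x \in `[0, h] -> derivable f (x *: v + p) v.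
    rewrite in_itv /= => /andP[x0 xh]; apply: fd.
    by rewrite !ger0_norm.
  have [||x xI e] := @MVT_segment R (fun y : R => f (y *: v + p))
     (fun y : R => 'D_v f (y *: v + p)) 0 h h0.
  + move=> x xI; apply: is_derive_line; apply: fd'.
    by apply: subset_itv_oo_cc xI.
  + apply: derivable_within_continuous => x xI.
    by have [] := is_derive_line (fd' x xI).
  + exists x; first by move: xI; rewrite in_itv /= => /andP[? ?]; rewrite !ger0_norm.
    by rewrite scale0r add0r subr0 in e; rewrite e mulrC.
- have h0' := ltW h0.
  have fd' x : x \in `[h, 0] -> derivable f (x *: v + p) v.
    rewrite in_itv /= => /andP[x0 xh]; apply: fd.
    by rewrite !ler0_norm // lerN2.
  have [||x xI e] := @MVT_segment R (fun y : R => f (y *: v + p))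
     (fun y : R => 'D_v f (y *: v + p)) h 0 h0'.
  + move=> x xI; apply: is_derive_line; apply: fd'.
    by apply: subset_itv_oo_cc xI.
  + apply: derivable_within_continuous => x xI.
    by have [] := is_derive_line (fd' x xI).
  + exists x; first by move: xI; rewrite in_itv /= => /andP[? ?]; rewrite !ler0_norm // lerN2.
    rewrite scale0r add0r sub0r mulrN in e.
    by rewrite -opprB e opprK mulrC.
Qed.

Lemma is_derive_scale_dir f p v (c : R) : derivable f p v ->
  is_derive p (c *: v) f (c * 'D_v f p).
Proof.
move=> fd; have [->|c0] := eqVneq c 0.
  by rewrite scale0r mul0r; split; [exact: derivable0|exact: derive0].
have lim : (fun h : R => h^-1 *: (f (h *: (c *: v) + p) - f p)) @ 0^' -->
    c * 'D_v f p.
  rewrite (_ : (fun h : R => _) =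
      (fun h : R => c * (h^-1 *: (f (h *: v + p) - f p))) \o
      (fun h => c * h)); last first.
    apply/funext => h /=; rewrite scalerA [h * c]mulrC invfM /GRing.scale /=.
    by rewrite !mulrA mulfV // mul1r.
  have fd' : (fun h : R => h^-1 *: (f (h *: v + p) - f p)) @ 0^' --> 'D_v f p by exact: fd.
  apply: (@cvg_comp _ _ _ _ _ _ (0^')); last exact: cvgM (cvg_cst c) fd'.
  move=> A /=; rewrite /nbhs /= => -[e /= e0 Ae].
  exists (e / `|c|) => /=; first by rewrite divr_gt0 // normr_gt0.
  move=> y; rewrite /= !sub0r !normrN => yl y0.
  apply: Ae => /=; last by rewrite mulf_neq0.
  by rewrite sub0r normrN normrM mulrC -ltr_pdivlMr // normr_gt0.
split; first by apply: cvgP lim.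
exact: cvg_lim lim.
Qed.

(** Smoothness is phrased with directional derivatives only, so linearity in the direction has to be
    earned. The increment is split into a step along [v] followed by a step along [w]; by the mean
    value theorem the second quotient is a value of ['D_w f] close to [p], and continuity
    concludes. *)
Lemma is_derive_add_dir (A : set V) f p v w : open A -> A p ->
  derivable f p v -> (forall q, A q -> derivable f q w) ->
  {for p, continuous ('D_w f)} ->
  is_derive p (v + w) f ('D_v f p + 'D_w f p).
Proof.
move=> oA Ap dv dw cw.
have lim : (fun h : R => h^-1 *: (f (h *: (v + w) + p) - f p)) @ 0^' -->
    'D_v f p + 'D_w f p.
  rewrite (_ : (fun h : R => _) =
      (fun h : R => h^-1 *: (f (h *: v + p) - f p)) \+
      (fun h : R => h^-1 *: (f (h *: w + (h *: v + p)) - f (h *: v + p)))); last first.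
    apply/funext => h /=; rewrite -[RHS]scalerDr; congr (_ *: _).
    by rewrite [RHS]addrC addrA subrK scalerDr [h *: v + h *: w]addrC -(addrA (h *: w)).
  apply: cvgD; first exact: dv.
  apply/cvgrPdist_lt => e e0.
  have : \forall q \near p, `|'D_w f p - 'D_w f q| < e /\ A q.
    near=> q; split; last by near: q; exact: open_nbhs_nbhs.
    by near: q; move/cvgrPdist_lt: cw; apply.
  move=> /nbhs_ballP[d /= d0 Bd].
  (* For [|h| < m] the whole segment from [h *: v + p] to [h *: w + (h *: v + p)] stays within
     distance [d] of [p]; the summand 1 keeps the denominator positive. *)
  pose m := d / (`|v| + `|w| + 1).
  have n0 : 0 < `|v| + `|w| + 1 by rewrite ltr_wpDl // addr_ge0.
  have m0 : 0 < m by rewrite divr_gt0.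
  exists m => //= h /=; rewrite sub0r normrN => hm h0.
  have inB x : `|x| <= `|h| -> ball p d (x *: w + (h *: v + p)).
    move=> xh; rewrite -ball_normE /= addrA opprD addrCA subrr addr0 normrN.
    apply: le_lt_trans (ler_normD _ _) _; rewrite !normrZ.
    move: hm; rewrite /m ltr_pdivlMr // => hm.
    apply: le_lt_trans hm.
    rewrite mulrDr mulr1 mulrDr; move: (normr_ge0 h) (normr_ge0 w) xh; nra.
  have [x xh ->] := @mean_value_line f (h *: v + p) w h
    (fun x xh => dw _ (Bd _ (inB x xh)).2).
  rewrite /GRing.scale /= mulrA mulVf // mul1r.
  by have [] := Bd _ (inB x xh).
split; first by apply: cvgP lim.
exact: cvg_lim lim.
Unshelve. all: by end_near.
Qed.

End DirectionalDerivative.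

(** * Closure properties of smooth functions *)

Section SmoothFunctions.
Local Open Scope classical_set_scope.
Local Open Scope ring_scope.
Context {R : realType} {n : nat}.
Implicit Types (A : set (Cn R n)) (f g : Cn R n -> R) (v w p : Cn R n).

Lemma derive_local A f g v p : open A -> {in A, f =1 g} -> A p ->
  'D_v f p = 'D_v g p /\ (derivable f p v -> derivable g p v).
Proof.
move=> oA fg Ap; have [->|v0] := eqVneq v 0.
  by rewrite !derive0; split => // _; exact: derivable0.
have nfg : {near p, f =1 g}.
  by near=> q; apply: fg; apply/mem_set; near: q; exact: open_nbhs_nbhs.
split; first exact: near_eq_derive.
exact: near_eq_derivable.
Unshelve. all: by end_near.
Qed.

(** Serves to glue the smoothness of a metric in each chart into smoothness on all of [HsCt]. *)
Lemma diff_class_local m A f : open A ->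
  (forall p, A p -> exists B, [/\ open B, B p & diff_class m B f]) ->
  diff_class m A f.
Proof.
move=> oA; elim: m f => [|m IH] f H.
  by split=> // p Ap; have [B [oB Bp []]] := H p Ap => + _; apply.
split; first by move=> p Ap; have [B [oB Bp []]] := H p Ap => + _; apply.
move=> v; split.
  by move=> p Ap; have [B [oB Bp [_ /(_ v) [+ _]]]] := H p Ap; apply.
apply: IH => p Ap; have [B [oB Bp [_ /(_ v) [_ Bv]]]] := H p Ap.
by exists B.
Qed.

Lemma diff_class_ext m A f g : open A -> {in A, f =1 g} ->
  diff_class m A f -> diff_class m A g.
Proof.
move=> oA; elim: m f g => [|m IH] f g fg [cf df]; split => //.
- move=> p Ap; have nfg : {near p, f =1 g}.
    by near=> q; apply: fg; apply/mem_set; near: q; exact: open_nbhs_nbhs.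
  have h : f @ p --> f p := cf p Ap.
  suff : g @ p --> g p by [].
  rewrite -(fg p) ?mem_set //.
  by apply: cvg_trans h; apply: near_eq_cvg; apply: filterS nfg => q ->.
- move=> p Ap; have nfg : {near p, f =1 g}.
    by near=> q; apply: fg; apply/mem_set; near: q; exact: open_nbhs_nbhs.
  have h : f @ p --> f p := cf p Ap.
  suff : g @ p --> g p by [].
  rewrite -(fg p) ?mem_set //.
  by apply: cvg_trans h; apply: near_eq_cvg; apply: filterS nfg => q ->.
- move=> v; have [d1 d2] := df v; split.
    by move=> p Ap; apply (derive_local v oA fg Ap).2; exact: d1.
  apply: IH d2 => p /set_mem Ap.
  by have [] := derive_local v oA fg Ap.
Unshelve. all: by end_near.
Qed.

Lemma diff_classW m A f : diff_class m.+1 A f -> diff_class m A f.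
Proof.
elim: m f => [|m IH] f [cf df]; split => // v.
have [d1 d2] := df v; split => //; exact: IH.
Qed.

Lemma diff_class_cst m A (c : R) : diff_class m A (cst c).
Proof.
elim: m c => [|m IH] c; (split; first by move=> p _; exact: cst_continuous) => // v.
split; first by move=> p _; exact: derivable_cst.
rewrite (_ : 'D_v (cst c) = cst 0); first exact: IH.
by apply/funext => p; rewrite derive_cst.
Qed.

Lemma diff_classD m A f g : open A ->
  diff_class m A f -> diff_class m A g -> diff_class m A (f \+ g).
Proof.
move=> oA; elim: m f g => [|m IH] f g [cf df] [cg dg].
  by split => // p Ap; apply: continuousD; [exact: cf|exact: cg].
split; first by move=> p Ap; apply: continuousD; [exact: cf|exact: cg].
move=> v; have [f1 f2] := df v; have [g1 g2] := dg v; split.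
  by move=> p Ap; apply: derivableD; [exact: f1|exact: g1].
apply: (diff_class_ext oA _ (IH _ _ f2 g2)) => p /set_mem Ap.
by rewrite deriveD //; [exact: f1|exact: g1].
Qed.

Lemma diff_classM m A f g : open A ->
  diff_class m A f -> diff_class m A g -> diff_class m A (f \* g).
Proof.
move=> oA; elim: m f g => [|m IH] f g /[dup] Hf [cf df] /[dup] Hg [cg dg].
  by split => // p Ap; apply: continuousM; [exact: cf|exact: cg].
split; first by move=> p Ap; apply: continuousM; [exact: cf|exact: cg].
move=> v; have [f1 f2] := df v; have [g1 g2] := dg v; split.
  by move=> p Ap; apply: derivableM; [exact: f1|exact: g1].
have H1 := IH _ _ f2 (diff_classW Hg).
have H2 := IH _ _ (diff_classW Hf) g2.
apply: (diff_class_ext oA _ (diff_classD oA H1 H2)) => p /set_mem Ap.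
rewrite /= deriveM //; [|exact: f1|exact: g1].
by rewrite addrC; congr (_ + _); rewrite mulrC.
Qed.

Lemma smooth_ext A f g : open A -> {in A, f =1 g} -> smooth_on A f -> smooth_on A g.
Proof. by move=> oA fg sf m; exact: diff_class_ext (sf m). Qed.

Lemma smooth_cst A (c : R) : smooth_on A (cst c).
Proof. by move=> m; exact: diff_class_cst. Qed.

Lemma smoothD A f g : open A -> smooth_on A f -> smooth_on A g -> smooth_on A (f \+ g).
Proof. by move=> oA sf sg m; exact: diff_classD. Qed.

Lemma smoothM A f g : open A -> smooth_on A f -> smooth_on A g -> smooth_on A (f \* g).
Proof. by move=> oA sf sg m; exact: diff_classM. Qed.

Lemma smoothZ A f (c : R) : open A -> smooth_on A f -> smooth_on A (fun p => c * f p).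
Proof. by move=> oA sf; exact: (smoothM oA (@smooth_cst A c) sf). Qed.

Lemma smooth_derive A f v : smooth_on A f -> smooth_on A ('D_v f).
Proof. by move=> sf m; have [_ /(_ v) []] := sf m.+1. Qed.

Lemma smooth_derivable A f v p : smooth_on A f -> A p -> derivable f p v.
Proof. by move=> sf Ap; have [_ /(_ v) [+ _]] := sf 1%N; apply. Qed.

Lemma smooth_continuous A f p : smooth_on A f -> A p -> {for p, continuous f}.
Proof. by move=> sf Ap; have [+ _] := sf 0%N; apply. Qed.

Lemma smooth_deriveDv A f v w p : open A -> smooth_on A f -> A p ->
  'D_(v + w) f p = 'D_v f p + 'D_w f p.
Proof.
move=> oA sf Ap; have [] // := @is_derive_add_dir _ _ A f p v w oA Ap.
- exact: smooth_derivable sf Ap.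
- by move=> q Aq; exact: smooth_derivable sf Aq.
- exact: smooth_continuous (smooth_derive w sf) Ap.
Qed.

Lemma smooth_deriveZv A f v c p : smooth_on A f -> A p ->
  'D_(c *: v) f p = c * 'D_v f p.
Proof.
by move=> sf Ap; have [] := is_derive_scale_dir c (smooth_derivable (v := v) sf Ap).
Qed.

End SmoothFunctions.

Section ComplexValued.
Local Open Scope classical_set_scope.
Local Open Scope ring_scope.
Context {R : realType} {n : nat}.
Implicit Types (A : set (Cn R n)) (f g : Cn R n -> R[i]) (v w p : Cn R n).

Definition csmooth A f : Prop :=
  smooth_on A (fun p => complex.Re (f p)) /\ smooth_on A (fun p => complex.Im (f p)).

Lemma csmooth_ext A f g : open A -> {in A, f =1 g} -> csmooth A f -> csmooth A g.
Proof.
move=> oA fg [f1 f2]; split.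
  by apply: smooth_ext f1 => // p Ap; rewrite fg.
by apply: smooth_ext f2 => // p Ap; rewrite fg.
Qed.

Lemma csmooth_cst A (c : R[i]) : csmooth A (fun _ => c).
Proof. by split; exact: smooth_cst. Qed.

Lemma csmoothD A f g : open A -> csmooth A f -> csmooth A g ->
  csmooth A (fun p => f p + g p).
Proof.
move=> oA [f1 f2] [g1 g2]; split.
- apply: (smooth_ext oA _ (smoothD oA f1 g1)) => p _ /=.
  by case: (f p) (g p) => ? ? [? ?].
- apply: (smooth_ext oA _ (smoothD oA f2 g2)) => p _ /=.
  by case: (f p) (g p) => ? ? [? ?].
Qed.

Lemma csmoothM A f g : open A -> csmooth A f -> csmooth A g ->
  csmooth A (fun p => f p * g p).
Proof.
move=> oA [f1 f2] [g1 g2]; split.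
- apply: (smooth_ext oA _ (smoothD oA (smoothM oA f1 g1)
     (smoothZ (-1) oA (smoothM oA f2 g2)))) => p _ /=.
  by case: (f p) (g p) => ? ? [? ?] /=; rewrite mulN1r.
- apply: (smooth_ext oA _ (smoothD oA (smoothM oA f1 g2)
     (smoothM oA f2 g1))) => p _ /=.
  by case: (f p) (g p) => ? ? [? ?] /=.
Qed.

Lemma csmoothZ A f (c : R[i]) : open A -> csmooth A f -> csmooth A (fun p => c * f p).
Proof. by move=> oA; apply: csmoothM => //; exact: csmooth_cst. Qed.

Lemma csmooth_sum (I : Type) (r : seq I) (P : pred I) A (F : I -> Cn R n -> R[i]) :
  open A -> (forall i, P i -> csmooth A (F i)) ->
  csmooth A (fun p => \sum_(i <- r | P i) F i p).
Proof.
move=> oA H; elim: r => [|i r IH].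
  apply: (csmooth_ext oA _ (csmooth_cst A 0)) => p _; by rewrite big_nil.
have [Pi|Pi] := boolP (P i).
  apply: (csmooth_ext oA _ (csmoothD oA (H i Pi) IH)) => p _.
  by rewrite big_cons Pi.
apply: (csmooth_ext oA _ IH) => p _.
by rewrite big_cons (negPf Pi).
Qed.

Lemma csmooth_cderive A f v : csmooth A f -> csmooth A (cderive v f).
Proof. by case=> f1 f2; split; exact: smooth_derive. Qed.

Lemma csmooth_frame_derive A f a : open A -> csmooth A f ->
  csmooth A (frame_derive a f).
Proof.
move=> oA sf; apply: csmoothD => //; first exact: csmooth_cderive.
by apply: csmoothZ => //; exact: csmooth_cderive.
Qed.

Lemma cderive_local A f g v p : open A -> {in A, f =1 g} -> A p ->
  cderive v f p = cderive v g p.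
Proof.
move=> oA fg Ap; rewrite /cderive; congr (Complex _ _).
  by apply: (derive_local _ oA _ Ap).1 => q Aq; rewrite fg.
by apply: (derive_local _ oA _ Ap).1 => q Aq; rewrite fg.
Qed.

Lemma frame_derive_local A f g a p : open A -> {in A, f =1 g} -> A p ->
  frame_derive a f p = frame_derive a g p.
Proof.
by move=> oA fg Ap; rewrite /frame_derive; congr (_ + _ * _);
  exact: (cderive_local _ oA fg Ap).
Qed.

Lemma cderiveD A f g v p : open A -> csmooth A f -> csmooth A g -> A p ->
  cderive v (fun q => f q + g q) p = cderive v f p + cderive v g p.
Proof.
move=> oA [f1 f2] [g1 g2] Ap; apply/eqP; rewrite eq_complex /=.
have e1 : 'D_v (fun q => complex.Re (f q + g q)) p =
    'D_v ((fun q => complex.Re (f q)) \+ (fun q => complex.Re (g q))) p.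
  by apply: (derive_local _ oA _ Ap).1 => q _ /=; case: (f q) (g q) => ? ? [].
have e2 : 'D_v (fun q => complex.Im (f q + g q)) p =
    'D_v ((fun q => complex.Im (f q)) \+ (fun q => complex.Im (g q))) p.
  by apply: (derive_local _ oA _ Ap).1 => q _ /=; case: (f q) (g q) => ? ? [].
by rewrite e1 e2 !deriveD ?eqxx //; apply: smooth_derivable Ap.
Qed.

Lemma cderiveZ A f (c : R[i]) v p : open A -> csmooth A f -> A p ->
  cderive v (fun q => c * f q) p = c * cderive v f p.
Proof.
move=> oA [f1 f2] Ap; apply/eqP; rewrite eq_complex.
case: c => a b /=.
have d1 := smooth_derivable (v := v) f1 Ap; have d2 := smooth_derivable (v := v) f2 Ap.
have dZ (c : R) h : derivable h p v -> 'D_v (fun q => c * h q) p = c * 'D_v h p.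
  exact: deriveZ.
have sZ (c : R) h : derivable h p v -> derivable (fun q => c * h q) p v.
  exact: derivableZ.
have e1 : 'D_v (fun q => complex.Re (Complex a b * f q)) p =
    'D_v ((fun q => a * complex.Re (f q)) \+ (fun q => - b * complex.Im (f q))) p.
  apply: (derive_local _ oA _ Ap).1 => q _ /=; case: (f q) => ? ? /=.
  by rewrite mulNr.
have e2 : 'D_v (fun q => complex.Im (Complex a b * f q)) p =
    'D_v ((fun q => a * complex.Im (f q)) \+ (fun q => b * complex.Re (f q))) p.
  by apply: (derive_local _ oA _ Ap).1 => q _ /=; case: (f q) => ? ?.
rewrite e1 e2 (deriveD (sZ a _ d1) (sZ (- b) _ d2)) (deriveD (sZ a _ d2) (sZ b _ d1)).
by rewrite (dZ _ _ d1) (dZ _ _ d1) (dZ _ _ d2) (dZ _ _ d2) mulNr !eqxx.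
Qed.

Lemma frame_deriveD A f g a p : open A -> csmooth A f -> csmooth A g -> A p ->
  frame_derive a (fun q => f q + g q) p = frame_derive a f p + frame_derive a g p.
Proof.
move=> oA sf sg Ap; rewrite /frame_derive !(cderiveD _ oA sf sg Ap).
by rewrite mulrDr addrACA.
Qed.

Lemma frame_deriveZ A f (c : R[i]) a p : open A -> csmooth A f -> A p ->
  frame_derive a (fun q => c * f q) p = c * frame_derive a f p.
Proof.
move=> oA sf Ap; rewrite /frame_derive !(cderiveZ _ _ oA sf Ap).
by rewrite [RHS]mulrDr [X in _ + X = _]mulrCA.
Qed.

Lemma frame_derive0 a p : frame_derive a (fun _ : Cn R n => 0 : R[i]) p = 0.
Proof.
rewrite /frame_derive /cderive /= !derive_cst.
by rewrite (_ : Complex 0 0 = 0 :> R[i]) // mulr0 addr0.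
Qed.

Lemma frame_derive_sum (I : Type) (r : seq I) (P : pred I) A
    (F : I -> Cn R n -> R[i]) a p :
  open A -> (forall i, P i -> csmooth A (F i)) -> A p ->
  frame_derive a (fun q => \sum_(i <- r | P i) F i q) p =
  \sum_(i <- r | P i) frame_derive a (F i) p.
Proof.
move=> oA H Ap; elim: r => [|i r IH].
  rewrite big_nil -[RHS](frame_derive0 a p).
  by apply: (frame_derive_local _ oA _ Ap) => q _; rewrite big_nil.
rewrite big_cons; have [Pi|Pi] := boolP (P i); last first.
  rewrite -IH; apply: (frame_derive_local _ oA _ Ap) => q _.
  by rewrite big_cons (negPf Pi).
rewrite -IH -(frame_deriveD _ oA (H i Pi) _ Ap); last exact: csmooth_sum.
by apply: (frame_derive_local _ oA _ Ap) => q _; rewrite big_cons Pi.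
Qed.

Lemma cderiveDv A f v w p : open A -> csmooth A f -> A p ->
  cderive (v + w) f p = cderive v f p + cderive w f p.
Proof.
move=> oA [f1 f2] Ap; apply/eqP; rewrite eq_complex /=.
by rewrite !(smooth_deriveDv _ _ oA _ Ap) ?eqxx.
Qed.

Lemma cderiveZv A f v (c : R) p : csmooth A f -> A p ->
  cderive (c *: v) f p = c%:C%C * cderive v f p.
Proof.
move=> [f1 f2] Ap; apply/eqP; rewrite eq_complex /=.
by rewrite (smooth_deriveZv _ _ f1 Ap) (smooth_deriveZv _ _ f2 Ap) !mul0r subr0 addr0 !eqxx.
Qed.

End ComplexValued.

(** * Averages over translations *)

Lemma sumr_const_seq (M : nmodType) (I : Type) (r : seq I) (x : M) :
  \sum_(i <- r) x = x *+ size r.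
Proof. by rewrite big_const_seq count_predT iter_addr_0. Qed.

Section Averages.
Local Open Scope classical_set_scope.
Local Open Scope ring_scope.
Context {R : realType} {s t : nat}.
Local Notation V := (Cn R (s + t)).
Implicit Types (l : seq V) (F G : V -> R) (v w : V).

(** Means over finite lists are enough: they commute, and an iterated mean is again a mean, over the
    pairwise sums of the two lists. *)
Definition avg l F : V -> R := fun v =>
  (size l)%:R^-1 * \sum_(w <- l) F (v + w).

(** To be read in the coordinates of [exp_chart], where this component is log y_j: a horizontal
    translation fixes every y_j. *)
Definition horizontal w := forall j : 'I_s, w.2 0 (lshift t j) = 0.

(** In logarithmic coordinates this bounds every log y_j, so each monomial in the y_j is bounded
    above and below on a slab. *)
Definition slab (r : R) v := forall j : 'I_s, `|v.2 0 (lshift t j)| <= r.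

Lemma size_neq0 l : l != [::] -> (size l)%:R != 0 :> R.
Proof. by case: l => // x l _; rewrite pnatr_eq0. Qed.

Lemma avg_allpairs l1 l2 F :
  avg [seq a + b | a <- l1, b <- l2] F = avg l1 (avg l2 F).
Proof.
apply/funext => v; rewrite /avg size_allpairs natrM invfM -mulrA; congr (_ * _).
rewrite big_allpairs_dep mulr_sumr; apply: eq_bigr => a _; congr (_ * _).
by apply: eq_bigr => b _; rewrite addrA.
Qed.

Lemma avg_comm l1 l2 F : avg l1 (avg l2 F) = avg l2 (avg l1 F).
Proof.
apply/funext => v; rewrite /avg -!mulr_sumr !mulrA [X in X * _]mulrC; congr (_ * _).
rewrite exchange_big; apply: eq_bigr => b _; apply: eq_bigr => a _.
by rewrite addrAC.
Qed.

Lemma avgD l F G : avg l (F \+ G) = avg l F \+ avg l G.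
Proof. by apply/funext => v; rewrite /avg /= big_split mulrDr. Qed.

Lemma avgZ l (c : R) F : avg l (fun v => c * F v) = (fun v => c * avg l F v).
Proof. by apply/funext => v; rewrite /avg -mulr_sumr mulrCA. Qed.

Lemma avg_norm_le l F v (e : R) : l != [::] ->
  (forall w, w \in l -> `|F (v + w)| <= e) -> `|avg l F v| <= e.
Proof.
move=> l0 H; rewrite /avg normrM normfV normr_nat mulrC ler_pdivrMr; last first.
  by rewrite lt_neqAle eq_sym size_neq0 // ler0n.
apply: le_trans (ler_norm_sum _ _ _) _.
rewrite big_seq; apply: le_trans (ler_sum _ H) _.
by rewrite -big_seq sumr_const_seq mulr_natr.
Qed.

Lemma avg_ge l F v (e : R) : l != [::] -> (forall w, e <= F w) -> e <= avg l F v.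
Proof.
move=> l0 H; rewrite /avg mulrC ler_pdivlMr; last first.
  by rewrite lt_neqAle eq_sym size_neq0 // ler0n.
apply: le_trans (ler_sum _ (fun w _ => H (v + w))).
by rewrite sumr_const_seq mulr_natr.
Qed.

(* Negligible functions have arbitrarily small averages. A bounded set of
   translations is fixed first; the horizontal translations may then depend on
   the slab, since horizontal derivatives are bounded on slabs only. *)
Definition negligible F : Prop := forall e : R, 0 < e ->
  exists2 l, l != [::] & forall r : R, exists2 l', l' != [::] &
    (forall w, w \in l' -> horizontal w) /\
    (forall v, slab r v -> `|avg l' (avg l F) v| <= e).

Lemma slab_bound l : exists2 m : R, 0 <= m & forall w, w \in l -> slab m w.
Proof.
elim: l => [|a l [m m0 H]]; first by exists 0.
exists (m + \sum_(j < s) `|a.2 0 (lshift t j)|); first by rewrite addr_ge0 ?sumr_ge0.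
move=> w; rewrite in_cons => /orP[/eqP -> j|wl j].
  rewrite (bigD1 j) //= addrCA lerDl addr_ge0 // ?sumr_ge0 //.
by apply: le_trans (H w wl j) _; rewrite lerDl sumr_ge0.
Qed.

Lemma slabD (r m : R) v w : slab r v -> slab m w -> slab (r + m) (v + w).
Proof.
by move=> sv sw j; rewrite mxE; apply: le_trans (ler_normD _ _) _; rewrite lerD.
Qed.

Lemma slab_horizontal (r : R) v w : slab r v -> horizontal w -> slab r (v + w).
Proof. by move=> sv hw j; rewrite mxE hw addr0. Qed.

Lemma allpairs_neq0 l1 l2 : l1 != [::] -> l2 != [::] ->
  [seq a + b | a <- l1, b <- l2] != [::].
Proof. by case: l1 => // a l1; case: l2. Qed.

(** Both averagings are performed. To estimate the [F] part, the means over [l2] and [l2'] are moved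
    outside: they shift the point by a horizontal vector and by one in the slab of radius [m2], so
    the estimate for [F] is requested on the slab of radius [r + m2]. This works because [l2], hence
    [m2], is fixed before [r]. *)
Lemma negligibleD F G : negligible F -> negligible G -> negligible (F \+ G).
Proof.
move=> nF nG e e0; have e2 : 0 < e / 2 by rewrite divr_gt0.
have [l1 l10 H1] := nF _ e2; have [l2 l20 H2] := nG _ e2.
exists [seq a + b | a <- l1, b <- l2]; first exact: allpairs_neq0.
move=> r; have [m1 _ B1] := slab_bound l1; have [m2 _ B2] := slab_bound l2.
have [l1' l10' [h1 H1']] := H1 (r + m2); have [l2' l20' [h2 H2']] := H2 (r + m1).
exists [seq a + b | a <- l1', b <- l2']; first exact: allpairs_neq0.
split.
  move=> w /allpairsP[[a b] /= [/h1 ha /h2 hb ->]] j.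
  by rewrite mxE ha hb addr0.
move=> v sv; rewrite !avg_allpairs !avgD /=.
apply: le_trans (ler_normD _ _) _.
rewrite [leRHS](splitr e); apply: lerD.
  rewrite (avg_comm l1' l2') (avg_comm l1 l2 F) (avg_comm l1' l2).
  apply: avg_norm_le => // a al; apply: avg_norm_le => // b bl; apply: H1'.
  exact: slabD (slab_horizontal sv (h2 _ al)) (B2 _ bl).
rewrite (avg_comm l2' l1).
apply: avg_norm_le => // a al; apply: avg_norm_le => // b bl; apply: H2'.
exact: slabD (slab_horizontal sv (h1 _ al)) (B1 _ bl).
Qed.

Lemma negligibleZ (c : R) F : negligible F -> negligible (fun v => c * F v).
Proof.
move=> nF e e0; have c0 : 0 < `|c| + 1 by rewrite ltr_wpDl.
have [|l l0 H] := nF (e / (`|c| + 1)); first by rewrite divr_gt0.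
exists l => // r; have [l' l0' [h H']] := H r; exists l' => //; split=> // v sv.
rewrite (avgZ l c F) (avgZ l' c (avg l F)) normrM; apply: le_trans (ler_wpM2l (normr_ge0 c) (H' v sv)) _.
rewrite mulrA ler_pdivrMr // mulrC; apply: ler_wpM2l; first exact: ltW.
by rewrite lerDl.
Qed.

Lemma negligible_ext F G : F =1 G -> negligible F -> negligible G.
Proof. by move=> /funext ->. Qed.

Lemma negligible0 : negligible (fun=> 0).
Proof.
move=> e e0; exists [:: 0] => // r; exists [:: 0] => //; split.
  by move=> w; rewrite inE => /eqP -> j; rewrite mxE.
move=> v _; rewrite /avg !big_seq1 !mulr0 normr0; exact: ltW.
Qed.

Lemma not_negligible_pos F (d : R) : 0 < d -> (forall v, d <= F v) -> ~ negligible F.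
Proof.
move=> d0 H nF; have [|l l0 Hl] := nF (d / 2); first by rewrite divr_gt0.
have [l' l0' [_ H']] := Hl 0.
have s0 : slab 0 0 by move=> j; rewrite mxE normr0.
have := H' 0 s0; apply/negP; rewrite -ltNge.
apply: (@lt_le_trans _ _ d); first by lra.
apply: le_trans (ler_norm _); apply: avg_ge => // w; exact: avg_ge.
Qed.

Definition grid (h : R) (N : nat) w : seq V := [seq (i%:R * h) *: w | i <- iota 0 N].

(** A Riemann sum compared with its primitive: two uses of the mean value theorem show that [h * F]
    differs from the increment of [G] over one step by at most [h * (h * M)]. The increments
    telescope to at most [2 * M], and everything is divided by the length [N * h]. *)
Lemma avg_grid_le G F F2 w v (M h : R) N : 0 < h -> (0 < N)%N ->
  (forall u, is_derive u w G (F u)) -> (forall u, is_derive u w F (F2 u)) ->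
  (forall x : R, `|G (v + x *: w)| <= M) -> (forall x : R, `|F2 (v + x *: w)| <= M) ->
  `|avg (grid h N w) F v| <= h * M + 2 * M / (N%:R * h).
Proof.
move=> h0 N0 dG dF bG bF.
have step i : `|h * F (v + (i%:R * h) *: w) -
    (G (v + (i.+1%:R * h) *: w) - G (v + (i%:R * h) *: w))| <= h * (h * M).
  set u := v + (i%:R * h) *: w.
  have [|x xh e] := @mean_value_line _ _ G u w h.
    by move=> x _; have [] := dG (x *: w + u).
  have -> : v + (i.+1%:R * h) *: w = h *: w + u.
    by rewrite /u -natr1 mulrDl mul1r scalerDl addrCA addrC [RHS]addrA; congr (_ + _); rewrite addrC.
  have [_ eG] := dG (x *: w + u); rewrite e eG.
  have [|y yx e2] := @mean_value_line _ _ F u w x.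
    by move=> y _; have [] := dF (y *: w + u).
  have [_ eF] := dF (y *: w + u).
  rewrite -mulrBr normrM gtr0_norm // ler_pM2l // distrC e2 eF normrM.
  have -> : y *: w + u = v + (i%:R * h + y) *: w by rewrite /u scalerDl addrC addrA.
  rewrite -(gtr0_norm h0); apply: ler_pM => //.
have Nh : 0 < N%:R * h :> R by rewrite mulr_gt0 // ltr0n.
have M0 : 0 <= M by apply: le_trans (bG 0); rewrite normr_ge0.
have tel : `|h * \sum_(i <- iota 0 N) F (v + (i%:R * h) *: w)| <=
    N%:R * (h * (h * M)) + 2 * M.
  have -> : h * \sum_(i <- iota 0 N) F (v + (i%:R * h) *: w) =
     \sum_(i <- iota 0 N) (h * F (v + (i%:R * h) *: w) -
    (G (v + (i.+1%:R * h) *: w) - G (v + (i%:R * h) *: w))) +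
     (G (v + (N%:R * h) *: w) - G (v + (0%:R * h) *: w)).
    rewrite sumrB -mulr_sumr.
    have -> : iota 0 N = index_iota 0 N by rewrite /index_iota subn0.
    by rewrite (telescope_sumr (fun i => G (v + (i%:R * h) *: w))) // subrK.
  apply: le_trans (ler_normD _ _) _; apply: lerD.
    apply: le_trans (ler_norm_sum _ _ _) _.
    apply: le_trans (ler_sum _ (fun i _ => step i)) _.
    by rewrite sumr_const_seq size_iota mulr_natl.
  apply: le_trans (ler_normB _ _) _.
  by rewrite [leRHS]mulr_natl [leRHS]mulr2n lerD.
rewrite /avg /grid size_map size_iota big_map normrM normfV normr_nat.
rewrite mulrC ler_pdivrMr ?ltr0n //.
rewrite -(ler_pM2l h0); rewrite normrM gtr0_norm // in tel.
apply: le_trans tel _.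
have N1 : N%:R != 0 :> R by rewrite pnatr_eq0 -lt0n.
have h1 : h != 0 by rewrite gt_eqF.
rewrite [leRHS](_ : _ = N%:R * (h * (h * M)) + 2 * M) //; field.
by rewrite h1 N1.
Qed.

Lemma small_grid (M e : R) : 0 <= M -> 0 < e -> exists h : R, exists N,
  [/\ 0 < h, (0 < N)%N & h * M + 2 * M / (N%:R * h) <= e].
Proof.
move=> M0 e0.
(* Each of the two terms receives [e / 2]; [M + 1] replaces [M] to allow [M = 0]. *)
pose h := e / (2 * (M + 1)).
have h0 : 0 < h by rewrite divr_gt0 // mulr_gt0 // ltr_wpDl.
pose N := (Num.truncn (4 * M / (e * h))).+1.
exists h, N; split => //.
have NB : 4 * M / (e * h) <= N%:R by apply/ltW; exact: truncnS_gt.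
have N0 : 0 < N%:R :> R by rewrite ltr0n.
have : h * M <= e / 2.
  rewrite /h mulrAC ler_pdivrMr ?mulr_gt0 ?ltr_wpDl //.
  rewrite [leRHS](_ : _ = e * (M + 1)); last by field.
  by rewrite ler_pM2l // lerDl.
have : 2 * M / (N%:R * h) <= e / 2.
  have Nh : 0 < N%:R * h by exact: mulr_gt0.
  have eh : 0 < e * h by exact: mulr_gt0.
  rewrite (ler_pdivrMr _ _ Nh); rewrite (ler_pdivrMr _ _ eh) in NB.
  by rewrite [leRHS](_ : _ = (N%:R * (e * h)) / 2); [lra|field].
by move=> a b; rewrite [leRHS]splitr lerD.
Qed.

Lemma grid_neq0 h N w : (0 < N)%N -> grid h N w != [::].
Proof. by case: N. Qed.

(** The bounds are global, so the grid along [w] serves as the fixed list and the horizontal list is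
    trivial. *)
Lemma negligible_derive w G F F2 (M : R) :
  (forall u, is_derive u w G (F u)) -> (forall u, is_derive u w F (F2 u)) ->
  (forall u, `|G u| <= M) -> (forall u, `|F2 u| <= M) -> negligible F.
Proof.
move=> dG dF bG bF e e0.
have M0 : 0 <= M by apply: le_trans (bG 0); rewrite normr_ge0.
have [h [N [h0 N0 hN]]] := small_grid M0 e0.
exists (grid h N w); first exact: grid_neq0.
move=> r; exists [:: 0] => //; split.
  by move=> u; rewrite inE => /eqP -> j; rewrite mxE.
move=> v _; apply: avg_norm_le => // u _; apply: le_trans hN.
exact: avg_grid_le h0 N0 dG dF _ _.
Qed.

(** The bounds, hence the mesh and length of the grid, depend on the slab, so the grid must be the
    second list. It stays inside the slab because [w] is horizontal. *)
Lemma negligible_horizontal_derive w G F F2 : horizontal w ->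
  (forall u, is_derive u w G (F u)) -> (forall u, is_derive u w F (F2 u)) ->
  (forall r, exists M, forall u, slab r u -> `|G u| <= M /\ `|F2 u| <= M) ->
  negligible F.
Proof.
move=> hw dG dF B e e0; exists [:: 0] => // r.
have [M HM] := B `|r|.
have s0 : slab `|r| 0 by move=> j; rewrite mxE normr0.
have M0 : 0 <= M by apply: le_trans (HM 0 s0).1; rewrite normr_ge0.
have [h [N [h0 N0 hN]]] := small_grid M0 e0.
have hx x : horizontal (x *: w) by move=> j; rewrite mxE hw mulr0.
exists (grid h N w); first exact: grid_neq0.
split; first by move=> u /mapP[i _ ->].
move=> v sv; apply: le_trans hN.
rewrite (_ : avg [:: 0] F = F); last first.
  by apply/funext => u; rewrite /avg big_seq1 invr1 mul1r addr0.
have sv' : slab `|r| v by move=> j; apply: le_trans (sv j) (ler_norm _).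
by apply: avg_grid_le h0 N0 dG dF _ _ => x; have [] := HM _ (slab_horizontal sv' (hx x)).
Qed.

End Averages.

(** * The complex frame and the group action *)

Section Frames.
Local Open Scope classical_set_scope.
Local Open Scope ring_scope.
Context {R : realType} {n : nat}.
Implicit Types (p v : Cn R n).

Lemma eq_Cn p v : (forall j, p.1 0 j = v.1 0 j) -> (forall j, p.2 0 j = v.2 0 j) -> p = v.
Proof.
case: p v => [a b] [c d] /= H1 H2; congr (_, _); apply/rowP => j; [exact: H1|exact: H2].
Qed.

Lemma continuous_coord1 j p : {for p, continuous (fun q : Cn R n => q.1 0 j)}.
Proof.
apply: (@continuous_comp _ _ _ (fun q : Cn R n => q.1) (fun y : 'rV[R]_n => y 0 j)).
  exact: cvg_fst.
exact: coord_continuous.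
Qed.

Lemma continuous_coord2 j p : {for p, continuous (fun q : Cn R n => q.2 0 j)}.
Proof.
apply: (@continuous_comp _ _ _ (fun q : Cn R n => q.2) (fun y : 'rV[R]_n => y 0 j)).
  exact: cvg_snd.
exact: coord_continuous.
Qed.

Lemma zcoord_of_coords (z : 'I_n -> R[i]) j : zcoord (of_coords z) j = z j.
Proof. by rewrite /zcoord /of_coords /= !mxE; case: (z j). Qed.

Lemma imE : 'i = Complex 0 1 :> R[i].
Proof. by rewrite -complexiE. Qed.

Lemma cplxJE v : cplxJ v = (- v.2, v.1).
Proof.
by apply: eq_Cn => j; rewrite /cplxJ imE /of_coords /zcoord /= !mxE /=; ring.
Qed.

Lemma evecE j : evec j = (\row_l (l == j)%:R, 0) :> Cn R n.
Proof.
by apply: eq_Cn => l; rewrite /evec /of_coords /= !mxE; case: (l == j).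
Qed.

Definition place (a : 'I_(n + n)) : 'I_n :=
  match fintype.split a with inl j => j | inr j => j end.

Lemma split_lshift (m k : nat) (j : 'I_m) : fintype.split (lshift k j) = inl j.
Proof. exact: (unsplitK (inl j : 'I_m + 'I_k)). Qed.

Lemma split_rshift (m k : nat) (j : 'I_k) : fintype.split (rshift m j) = inr j.
Proof. exact: (unsplitK (inr j : 'I_m + 'I_k)). Qed.

Lemma placeL j : place (lshift n j) = j. Proof. by rewrite /place split_lshift. Qed.
Lemma placeR j : place (rshift n j) = j. Proof. by rewrite /place split_rshift. Qed.

Lemma frame_reE a : frame_re a = 2^-1 *: evec (place a) :> Cn R n.
Proof. by rewrite /frame_re /place; case: (fintype.split a). Qed.

(** Chosen so that E_a = (d/dx + [frame_sign a] i d/dy) / 2. *)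
Definition frame_sign (a : 'I_(n + n)) : R :=
  match fintype.split a with inl _ => -1 | inr _ => 1 end.

Lemma frame_imE a :
  frame_im a = (frame_sign a / 2) *: cplxJ (evec (place a)) :> Cn R n.
Proof.
rewrite /frame_im /place /frame_sign; case: (fintype.split a) => j.
  by rewrite mulN1r scaleNr.
by rewrite mul1r.
Qed.

Lemma frame_deriveE A (f : Cn R n -> R[i]) a p : csmooth A f -> A p ->
  frame_derive a f p = (2^-1)%:C%C * (cderive (evec (place a)) f p
     + (frame_sign a)%:C%C * 'i * cderive (cplxJ (evec (place a))) f p).
Proof.
move=> sf Ap; rewrite /frame_derive frame_reE frame_imE !(cderiveZv _ _ sf Ap).
rewrite rmorphM /=; move: (_%:C)%C (_%:C)%C (cderive _ _ _) (cderive _ _ _) ('i) => a1 a2 a3 a4 a5.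
ring.
Qed.

Lemma cderive_evec A (f : Cn R n -> R[i]) j p : csmooth A f -> A p ->
  cderive (evec j) f p = frame_derive (lshift n j) f p + frame_derive (rshift n j) f p.
Proof.
move=> sf Ap; rewrite !(frame_deriveE _ sf Ap) placeL placeR /frame_sign.
rewrite split_lshift split_rshift rmorphN rmorph1 mulN1r mul1r.
have : (2^-1)%:C%C + (2^-1)%:C%C = 1 :> R[i].
  by rewrite -rmorphD /= (_ : 2^-1 + 2^-1 = 1) //; field.
move: (_%:C)%C (cderive _ _ _) (cderive _ _ _) ('i) => a1 a3 a4 a5 e.
by rewrite -[LHS]mul1r -e; ring.
Qed.

Lemma cderive_Jevec A (f : Cn R n -> R[i]) j p : csmooth A f -> A p ->
  cderive (cplxJ (evec j)) f p =
  'i * (frame_derive (lshift n j) f p - frame_derive (rshift n j) f p).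
Proof.
move=> sf Ap; rewrite !(frame_deriveE _ sf Ap) placeL placeR /frame_sign.
rewrite split_lshift split_rshift rmorphN rmorph1 mulN1r mul1r.
have : (2^-1)%:C%C + (2^-1)%:C%C = 1 :> R[i].
  by rewrite -rmorphD /= (_ : 2^-1 + 2^-1 = 1) //; field.
have : 'i * 'i = -1 :> R[i] by rewrite -expr2 sqrCi.
move: (_%:C)%C (cderive _ _ _) (cderive _ _ _) ('i) => a1 a3 a4 a5 ei e.
have -> : a5 * (a1 * (a3 + - a5 * a4) - a1 * (a3 + a5 * a4)) =
   - (a5 * a5) * (a1 + a1) * a4 by ring.
by rewrite ei e opprK !mul1r.
Qed.

End Frames.

Section Modulus.
Context {R : realType}.
Implicit Types z : R[i].

Lemma normc_conj z : normc (z^*%C) = normc z.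
Proof. by case: z => a b /=; rewrite sqrrN. Qed.

Lemma normc_ReIm z : normc z = Num.sqrt (complex.Re z ^+ 2 + complex.Im z ^+ 2).
Proof. by case: z. Qed.

Lemma normc_nneg z : 0 <= normc z.
Proof. by rewrite normc_ReIm sqrtr_ge0. Qed.

Lemma normc_Re z : `|complex.Re z| <= normc z.
Proof.
case: z => a b /=; rewrite -sqrtr_sqr ler_sqrt ?addr_ge0 ?sqr_ge0 //.
by rewrite lerDl sqr_ge0.
Qed.

Lemma normc_Im z : `|complex.Im z| <= normc z.
Proof.
case: z => a b /=; rewrite -sqrtr_sqr ler_sqrt ?addr_ge0 ?sqr_ge0 //.
by rewrite lerDr sqr_ge0.
Qed.

Lemma normc_prod (I : Type) (r : seq I) (P : pred I) (F : I -> R[i]) :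
  normc (\prod_(i <- r | P i) F i) = \prod_(i <- r | P i) normc (F i).
Proof. exact: (big_morph _ (@normcM R) (@normc1 R)). Qed.

Lemma mul_conj_normc z : z * z^*%C = (normc z ^+ 2)%:C%C.
Proof.
case: z => a b; apply/eqP; rewrite eq_complex /= sqr_sqrtr ?addr_ge0 ?sqr_ge0 //.
by apply/andP; split; apply/eqP; ring.
Qed.

End Modulus.

Lemma continuous_at_sum {R : realType} {T : topologicalType} (I : Type) (r : seq I)
    (F : I -> T -> R) (p : T) : (forall i, {for p, continuous (F i)}) ->
  {for p, continuous (fun q => \sum_(i <- r) F i q)}.
Proof.
move=> H; elim: r => [|i r IH].
  rewrite (_ : (fun q => _) = fun=> 0); first exact: cst_continuous.
  by apply/funext => q; rewrite big_nil.
rewrite (_ : (fun q => _) = fun q => F i q + \sum_(j <- r) F j q).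
  by apply: continuousD.
by apply/funext => q; rewrite big_cons.
Qed.

(** * Equivariant functions and their bounds by monomials in the y_j *)

Section Equivariance.
Local Open Scope classical_set_scope.
Local Open Scope ring_scope.
Context {R : realType} {s t : nat} {K : fieldExtType rat}.
Context (sigma : 'I_(s + t + t) -> {rmorphism K -> R[i]}) (U : set K).
Context (Hemb : labelled_embeddings sigma) (Hadm : admissible sigma U).
Local Notation n := (s + t)%N.
Local Notation V := (Cn R n).
Local Notation HsCt := (@HsCt R s t).
Local Notation act := (act sigma).
Local Notation dact := (dact sigma).
Local Notation OTg := (OT_group U).
Implicit Types (p v w : V) (e : 'I_s -> R) (g : V -> R[i]).

Definition rsig (j : 'I_s) (u : K) : R := complex.Re (emb sigma (lshift t j) u).

Lemma emb_rsig j u : emb sigma (lshift t j) u = (rsig j u)%:C%C.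
Proof.
rewrite /rsig /emb; have := emb_real Hemb j u.
by case: (sigma _ u) => a b /= ->.
Qed.

Lemma rsig_gt0 j u : U u -> 0 < rsig j u.
Proof.
move=> /(adm_unit Hadm)[_ _ _ /(_ j)].
by rewrite -[sigma _ _]/(emb sigma (lshift t j) u) emb_rsig ltcR.
Qed.

Lemma rsigM j (x y : K) : rsig j (x * y) = rsig j x * rsig j y.
Proof.
apply: complexI; rewrite -emb_rsig [RHS]rmorphM /= -!emb_rsig.
exact: rmorphM.
Qed.

Definition lnsig (j : 'I_s) (u : K) : R := ln (rsig j u).

Lemma open_HsCt : open HsCt.
Proof.
rewrite openE => p Hp.
suff F : forall j : 'I_s, nbhs p [set q : V | 0 < complex.Im (zcoord q (lshift t j))].
  by apply: (filter_forall _ F).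
move=> j; have pj : 0 < p.2 0 (lshift t j) := Hp j.
have c : {for p, continuous (fun q : V => q.2 0 (lshift t j))} by exact: continuous_coord2.
by apply: (c [set y | 0 < y]); exact: lt_nbhsr.
Qed.

(** The monomial y^e with real exponents; only the real places enter. *)
Definition height e p : R := expR (\sum_j e j * ln (p.2 0 (lshift t j))).

Lemma height_gt0 e p : 0 < height e p. Proof. exact: expR_gt0. Qed.

Lemma act_im (g : K * K) p (j : 'I_s) : (act g p).2 0 (lshift t j) =
  rsig j g.2 * p.2 0 (lshift t j).
Proof.
rewrite /Defs.act /of_coords /= mxE !emb_rsig /zcoord /=; ring.
Qed.

Lemma act_HsCt (g : K * K) p : OTg g -> HsCt p -> HsCt (act g p).
Proof.
move=> [_ Ug] Hp j; rewrite -[complex.Im _]/((act g p).2 0 (lshift t j)) act_im.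
by rewrite mulr_gt0 ?rsig_gt0 //; exact: Hp.
Qed.

Lemma height_act e (g : K * K) p : OTg g -> HsCt p ->
  height e (act g p) = height e p * expR (\sum_j e j * lnsig j g.2).
Proof.
move=> [_ Ug] Hp; rewrite /height -expRD -big_split; congr expR.
apply: eq_bigr => j _; rewrite act_im lnM ?posrE ?rsig_gt0 //; last exact: Hp.
by rewrite /lnsig /=; ring.
Qed.

Lemma dactE (g : K * K) v (h : R) p : act g (h *: v + p) = h *: dact g v + act g p.
Proof.
apply: eq_Cn => j; rewrite /Defs.act /Defs.dact /of_coords /= !mxE /zcoord /= !mxE.
  by case: (emb sigma j g.2) (emb sigma j g.1) => a b [c d] /=; ring.
by case: (emb sigma j g.2) (emb sigma j g.1) => a b [c d] /=; ring.
Qed.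

Lemma derive_act (f : V -> R) ga v p :
  'D_v (fun q => f (act ga q)) p = 'D_(dact ga v) f (act ga p).
Proof.
have e : (fun h : R => h^-1 *: (f (act ga (h *: v + p)) - f (act ga p))) =
    (fun h : R => h^-1 *: (f (h *: dact ga v + act ga p) - f (act ga p))).
  by apply/funext => h; rewrite dactE.
by rewrite /derive /= e.
Qed.

Lemma cderive_act g ga v p :
  cderive v (fun q => g (act ga q)) p = cderive (dact ga v) g (act ga p).
Proof.
rewrite /cderive; congr Complex.
  exact: (derive_act (fun q => complex.Re (g q))).
exact: (derive_act (fun q => complex.Im (g q))).
Qed.

(** The eigenvalue on E_a of the complexified differential [dact]. *)
Definition frame_factor (a : 'I_(n + n)) (u : K) : R[i] :=
  match fintype.split a with
  | inl j => emb sigma j u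
  | inr j => (emb sigma j u)^*%C
  end.

Lemma dact_scale ga (c : R) v : dact ga (c *: v) = c *: dact ga v.
Proof.
by apply: eq_Cn => j; rewrite /Defs.dact /of_coords /= !mxE /zcoord /= !mxE;
  case: (emb sigma j ga.2) => a b /=; ring.
Qed.

Lemma dact_evec ga j : dact ga (evec j) =
  complex.Re (emb sigma j ga.2) *: evec j + complex.Im (emb sigma j ga.2) *: cplxJ (evec j).
Proof.
rewrite cplxJE evecE /=.
apply: eq_Cn => l; rewrite /Defs.dact /of_coords /= !mxE /zcoord /= !mxE.
  have [->|_] := eqVneq l j; case: (emb sigma _ ga.2) => a b /=; ring.
have [->|_] := eqVneq l j; case: (emb sigma _ ga.2) => a b /=; ring.
Qed.

Lemma dact_Jevec ga j : dact ga (cplxJ (evec j)) =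
  complex.Re (emb sigma j ga.2) *: cplxJ (evec j) - complex.Im (emb sigma j ga.2) *: evec j.
Proof.
rewrite cplxJE evecE /=.
apply: eq_Cn => l; rewrite /Defs.dact /of_coords /= !mxE /zcoord /= !mxE.
  have [->|_] := eqVneq l j; case: (emb sigma _ ga.2) => a b /=; ring.
have [->|_] := eqVneq l j; case: (emb sigma _ ga.2) => a b /=; ring.
Qed.

Lemma dact_frame_re ga a : dact ga (frame_re a) =
  complex.Re (frame_factor a ga.2) *: frame_re a
   - complex.Im (frame_factor a ga.2) *: frame_im a.
Proof.
rewrite frame_reE frame_imE dact_scale dact_evec /frame_factor /place /frame_sign.
case: (fintype.split a) => j; case: (emb sigma j ga.2) => x y /=.
  rewrite !scalerDr !scalerA mulN1r mulrN scaleNr opprK.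
  by congr (_ *: _ + _ *: _); ring.
rewrite !scalerDr !scalerA mul1r mulNr scaleNr opprK.
by congr (_ *: _ + _ *: _); ring.
Qed.

Lemma dact_frame_im ga a : dact ga (frame_im a) =
  complex.Re (frame_factor a ga.2) *: frame_im a
   + complex.Im (frame_factor a ga.2) *: frame_re a.
Proof.
rewrite frame_reE frame_imE dact_scale dact_Jevec /frame_factor /place /frame_sign.
case: (fintype.split a) => j; case: (emb sigma j ga.2) => x y /=.
  rewrite !scalerDr scalerN !scalerA -scaleNr.
  by congr (_ *: _ + _ *: _); ring.
rewrite !scalerDr scalerN !scalerA -scaleNr.
by congr (_ *: _ + _ *: _); ring.
Qed.

Lemma frame_derive_act g ga a p : csmooth HsCt g -> OTg ga -> HsCt p ->
  frame_derive a (fun q => g (act ga q)) p =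
  frame_factor a ga.2 * frame_derive a g (act ga p).
Proof.
move=> sg OTga Hp; have Hq := act_HsCt OTga Hp.
rewrite /frame_derive !cderive_act dact_frame_re dact_frame_im -scaleNr.
rewrite !(cderiveDv _ _ open_HsCt sg Hq) !(cderiveZv _ _ sg Hq).
rewrite [in RHS](complexE (frame_factor a ga.2)) -complexiE complexiE rmorphN /=.
have : 'i * 'i = -1 :> R[i] by rewrite -expr2 sqrCi.
move: (cderive _ _ _) (cderive _ _ _) (_%:C)%C (_%:C)%C ('i) => a2 a1 a4 a3 a5 e.
have -> : (a3 + a5 * a4) * (a1 + a5 * a2) =
  a3 * a1 + a5 * a3 * a2 + a5 * a4 * a1 + (a5 * a5) * (a4 * a2) by ring.
by rewrite e; ring.
Qed.

(** The convention is that |sigma_j u| is the product of the (sigma_l u)^(- [weight j l]). At a real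
    place the weight is minus a basis vector, in accordance with |sigma_j u| = sigma_j u, so a
    derivative there costs one power of y_j. *)
Context (weight : 'I_n -> 'I_s -> R).
Context (weight_real : forall j l : 'I_s, weight (lshift t j) l = - (l == j)%:R).
Context (weightP : forall j u, U u ->
  normc (emb sigma j u) = expR (- \sum_l weight j l * lnsig l u)).

Lemma normc_frame_factor a u : U u ->
  normc (frame_factor a u) = expR (- \sum_l weight (place a) l * lnsig l u).
Proof.
move=> Uu; rewrite /frame_factor /place; case: (fintype.split a) => j;
 by rewrite ?normc_conj weightP.
Qed.

Definition bounded_weight e g : Prop :=
  exists M : R, forall p, HsCt p -> normc (g p) <= M * height e p.

(** Only the modulus of the automorphy factor [chi] is prescribed; the phases coming from the
    complex places do not affect the bounds. The sign is such that [normc (g p) / height e p] is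
    invariant under the group. *)
Definition equivariant e g : Prop :=
  csmooth HsCt g /\ exists chi : K -> R[i],
    (forall u, U u -> normc (chi u) = expR (- \sum_l e l * lnsig l u)) /\
    (forall ga p, OTg ga -> HsCt p -> g (act ga p) * chi ga.2 = g p).

Lemma equivariant_norm e g ga p : equivariant e g -> OTg ga -> HsCt p ->
  normc (g (act ga p)) * height (fun l => - e l) (act ga p) =
  normc (g p) * height (fun l => - e l) p.
Proof.
move=> [_ [chi [chi1 chi2]]] OTga Hp; rewrite height_act // -(chi2 ga p) // normcM chi1; last by case: OTga.
rewrite -mulrA; congr (_ * _); rewrite mulrC; congr (expR _ * _).
by rewrite -sumrN; apply: eq_bigr => l _; rewrite mulNr.
Qed.

Lemma heightN e p : height (fun l => - e l) p = (height e p)^-1.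
Proof.
rewrite /height -expRN; congr expR; rewrite -sumrN.
by apply: eq_bigr => l _; rewrite mulNr.
Qed.

Lemma continuous_at_normc g e p : csmooth HsCt g -> HsCt p ->
  {for p, continuous (fun q => normc (g q) * height e q)}.
Proof.
move=> [g1 g2] Hp.
have c1 := smooth_continuous g1 Hp; have c2 := smooth_continuous g2 Hp.
have -> : (fun q => normc (g q) * height e q) = (fun q =>
    Num.sqrt (complex.Re (g q) ^+ 2 + complex.Im (g q) ^+ 2) * height e q).
  by apply/funext => q; rewrite normc_ReIm.
apply: continuousM.
  apply: (@continuous_comp _ _ _ (fun q : V => complex.Re (g q) ^+ 2 + complex.Im (g q) ^+ 2) Num.sqrt);
    last exact: sqrt_continuous.
  by apply: continuousD; apply: continuousM.
apply: (@continuous_comp _ _ _ (fun q : V => \sum_j e j * ln (q.2 0 (lshift t j))) expR);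
    last exact: continuous_expR.
apply: continuous_at_sum => j; apply: continuousM; first exact: cst_continuous.
apply: (@continuous_comp _ _ _ (fun q : V => q.2 0 (lshift t j)) (@ln R)).
  exact: continuous_coord2.
by apply: continuous_ln; exact: Hp.
Qed.

Lemma within_continuous_at (f : V -> R) (C : set V) : C `<=` HsCt ->
  (forall p, HsCt p -> {for p, continuous f}) -> {within C, continuous f}.
Proof.
move=> CH cf; apply: continuous_in_subspaceT => p /set_mem Cp; apply: cf; exact: CH.
Qed.

Lemma HsCt_neq0 : exists p : V, HsCt p.
Proof. by exists (0, const_mx 1) => j; rewrite /zcoord /= mxE. Qed.

Lemma cocompact_point : exists2 C : set V, compact C & [/\ C !=set0, C `<=` HsCt &
  forall p, HsCt p -> exists2 g, OTg g & C (act g p)].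
Proof.
have [C cC [CH HC]] := adm_cocompact Hadm; exists C => //; split => //.
by have [p /HC[g _ Cg]] := HsCt_neq0; exists (act g p).
Qed.

(** The quotient of [normc g] by [height e] is continuous and invariant, so its maximum on a compact
    set that meets every orbit bounds it everywhere. *)
Lemma equivariant_bounded e g : equivariant e g -> bounded_weight e g.
Proof.
move=> Eg; have [C cC [C0 CH HC]] := cocompact_point.
pose F q := normc (g q) * height (fun l => - e l) q.
have cF : {within C, continuous F}.
  apply: within_continuous_at => // p Hp; exact: continuous_at_normc Eg.1 Hp.
have [c _ Hc] := compact_EVT_max C0 cC cF.
exists (F c) => p Hp; have [ga OTga Cga] := HC p Hp.
rewrite -ler_pdivrMr ?height_gt0 // -heightN.
by rewrite -(equivariant_norm Eg OTga Hp); apply: Hc; apply/mem_set.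
Qed.

Lemma equivariant_lower e g : equivariant e g -> (forall p, HsCt p -> g p != 0) ->
  exists2 d : R, 0 < d & forall p, HsCt p -> d * height e p <= normc (g p).
Proof.
move=> Eg g0; have [C cC [C0 CH HC]] := cocompact_point.
pose F q := normc (g q) * height (fun l => - e l) q.
have cF : {within C, continuous F}.
  apply: within_continuous_at => // p Hp; exact: continuous_at_normc Eg.1 Hp.
have [c cC' Hc] := compact_EVT_min C0 cC cF.
have Hcc : HsCt c by apply: CH; apply/set_mem.
exists (F c).
  rewrite mulr_gt0 ?height_gt0 // lt_neqAle normc_nneg andbT eq_sym.
  by apply: contra (g0 c Hcc) => /eqP/eq0_normc ->.
move=> p Hp; have [ga OTga Cga] := HC p Hp.
rewrite -ler_pdivlMr ?height_gt0 // -heightN.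
by rewrite -(equivariant_norm Eg OTga Hp); apply: Hc; apply/mem_set.
Qed.

(** Differentiating the identity g(p) = chi(u) g(act p) multiplies the automorphy factor by
    [frame_factor a]. Thus all iterated derivatives are again bounded by monomials. *)
Lemma equivariant_frame_derive e g a : equivariant e g ->
  equivariant (fun l => e l + weight (place a) l) (frame_derive a g).
Proof.
move=> [sg [chi [chi1 chi2]]]; split; first exact: csmooth_frame_derive open_HsCt sg.
exists (fun u => chi u * frame_factor a u); split.
  move=> u Uu; rewrite normcM chi1 // normc_frame_factor // -expRD; congr expR.
  rewrite -opprD -big_split; congr (- _); apply: eq_bigr => l _.
  by rewrite mulrDl.
move=> ga p OTga Hp.
have -> : frame_derive a g p =
  frame_derive a (fun q => chi ga.2 * g (act ga q)) p.
  apply: (frame_derive_local _ open_HsCt _ Hp) => q /set_mem Hq.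
  by rewrite mulrC chi2.
rewrite (frame_deriveZ _ _ open_HsCt _ Hp); first by rewrite frame_derive_act //; ring.
have chi0 : chi ga.2 != 0.
  apply/eqP => c0; have := chi1 ga.2 OTga.2; rewrite c0 normc0 => /esym/eqP.
  by rewrite expR_eq0.
(* No chain rule is required for smoothness of [g] composed with the action: by equivariance the
   composite is [g] divided by the constant [chi ga.2]. *)
apply: (csmooth_ext open_HsCt _ (csmoothZ (chi ga.2)^-1 open_HsCt sg)) => q /set_mem Hq.
by rewrite -(chi2 ga q) // mulrCA mulVf // mulr1.
Qed.

Lemma bounded_weightD e g1 g2 : bounded_weight e g1 -> bounded_weight e g2 ->
  bounded_weight e (fun p => g1 p + g2 p).
Proof.
move=> [M1 H1] [M2 H2]; exists (M1 + M2) => p Hp.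
by rewrite mulrDl; apply: le_trans (le_normcD _ _) _; apply: lerD; [exact: H1|exact: H2].
Qed.

Lemma bounded_weightZ e g c : bounded_weight e g -> bounded_weight e (fun p => c * g p).
Proof.
move=> [M H]; exists (normc c * M) => p Hp.
by rewrite normcM -mulrA ler_wpM2l ?normc_nneg // H.
Qed.

Lemma bounded_weight_ext e g1 g2 : {in HsCt, g1 =1 g2} -> bounded_weight e g1 ->
  bounded_weight e g2.
Proof. by move=> e12 [M H]; exists M => p Hp; rewrite -e12 ?mem_set // H. Qed.

End Equivariance.

(** * Logarithmic coordinates *)

Lemma is_derive_comp1 {R : realType} (f g : R -> R) (x df dg : R) :
  is_derive x 1 f df -> is_derive (f x) 1 g dg ->
  is_derive x 1 (fun y => g (f y)) (dg * df).
Proof.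
move=> [f1 f2] [g1 g2]; split.
  apply/derivable1_diffP.
  by apply: (@differentiable_comp _ _ _ _ f g); apply/derivable1_diffP.
have := @derive1_comp R f g x f1 g1; rewrite !derive1E f2 g2 => <-.
by [].
Qed.

Lemma is_derive_of_line {R : realType} {V : normedModType R} (F : V -> R) (v w : V) (d : R) :
  is_derive (0 : R) 1 (fun h : R => F (h *: w + v)) d -> is_derive v w F d.
Proof.
have e : (fun h : R => h^-1 *: (F ((h *: (1 : R) + 0) *: w + v) - F (0 *: w + v)))
       = (fun h : R => h^-1 *: (F (h *: w + v) - F v)).
  apply/funext => h; rewrite (_ : h *: (1 : R) = h) ?addr0 ?scale0r ?add0r //.
  exact: mulr1.
by move=> [d1 d2]; split; [move: d1|move: d2]; rewrite /derivable /derive /= e.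
Qed.

Section LogCoordinates.
Local Open Scope classical_set_scope.
Local Open Scope ring_scope.
Context {R : realType} {s t : nat}.
Local Notation n := (s + t)%N.
Local Notation V := (Cn R n).
Local Notation HsCt := (@HsCt R s t).
Implicit Types (p v w : V) (e : 'I_s -> R) (f : V -> R) (g : V -> R[i]).

(** At a real place the second component of [v] is log y_j; all other coordinates are unchanged. The
    source is a whole vector space, so that translations are defined everywhere. *)
Definition exp_chart v : V :=
  (v.1, \row_l match fintype.split l with
               | inl _ => expR (v.2 0 l)
               | inr _ => v.2 0 l
               end).

Lemma exp_chart_im v (j : 'I_s) : (exp_chart v).2 0 (lshift t j) = expR (v.2 0 (lshift t j)).
Proof. by rewrite /exp_chart /= mxE split_lshift. Qed.

Lemma exp_chart_HsCt v : HsCt (exp_chart v).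
Proof.
by move=> j; rewrite -[complex.Im _]/((exp_chart v).2 0 (lshift t j)) exp_chart_im expR_gt0.
Qed.

Lemma height_exp_chart e v :
  height e (exp_chart v) = expR (\sum_j e j * v.2 0 (lshift t j)).
Proof. by congr expR; apply: eq_bigr => j _; rewrite exp_chart_im expRK. Qed.

(** The quotient of [f] by [height e], read in logarithmic coordinates. *)
Definition pull e f v : R := expR (- \sum_j e j * v.2 0 (lshift t j)) * f (exp_chart v).

Definition vert (j : 'I_s) : V := cplxJ (evec (lshift t j)).

Lemma vertE j : vert j = (0, \row_l (l == lshift t j)%:R).
Proof. by rewrite /vert cplxJE evecE /= oppr0. Qed.

Lemma exp_chart_horizontal w v (h : R) : horizontal w ->
  exp_chart (h *: w + v) = h *: w + exp_chart v.
Proof.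
move=> hw; apply: eq_Cn => l; rewrite /exp_chart /= !mxE //.
case: (fintype.splitP l) => j lj //.
have -> : l = lshift t j by apply: val_inj.
by rewrite hw mulr0 !add0r.
Qed.

(** A vertical line goes to a vertical line run at exponential speed, so the one-variable chain rule
    suffices for [is_derive_pull_vert]. *)
Lemma exp_chart_vert j v (h : R) : exp_chart (h *: vert j + v) =
  (expR (h + v.2 0 (lshift t j)) - expR (v.2 0 (lshift t j))) *: vert j + exp_chart v.
Proof.
apply: eq_Cn => l; rewrite vertE /exp_chart /= !mxE ?mulr0 //.
case: (fintype.splitP l) => k lk.
  have -> : l = lshift t k by apply: val_inj.
  have [->|kj] := eqVneq (lshift t k) (lshift t j); first by rewrite !mulr1 subrK.
  by rewrite !mulr0 !add0r.
have -> : l = rshift s k by apply: val_inj.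
by rewrite eq_rlshift !mulr0 !add0r.
Qed.

Lemma is_derive_pull_horizontal e f v w : horizontal w -> derivable f (exp_chart v) w ->
  is_derive v w (pull e f) (pull e ('D_w f) v).
Proof.
move=> hw df; apply: is_derive_of_line.
rewrite (_ : (fun h => _) = (expR (- \sum_j e j * v.2 0 (lshift t j)))
    *: (fun h : R => f (h *: w + exp_chart v))).
  apply: is_deriveZ; rewrite -[X in 'D_w f X]add0r -[X in X + _](scale0r w).
  by apply: is_derive_line; rewrite scale0r add0r.
apply/funext => h; rewrite /pull exp_chart_horizontal //.
congr (expR (- _) * _); apply: eq_bigr => j _.
by rewrite /= !mxE hw mulr0 add0r.
Qed.

(** The weight of df/dy_j when [f] has weight [e]. *)
Definition lower e (j : 'I_s) : 'I_s -> R := fun l => e l - (l == j)%:R.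

Lemma sum_lower e j (x : 'I_s -> R) :
  \sum_l lower e j l * x l = \sum_l e l * x l - x j.
Proof.
rewrite (eq_bigr (fun l => e l * x l - (l == j)%:R * x l)); last first.
  by move=> l _; rewrite mulrBl.
rewrite sumrB; congr (_ - _); rewrite (bigD1 j) //= eqxx mul1r big1 ?addr0 //.
by move=> l /negPf ->; rewrite mul0r.
Qed.

Lemma sum_vert_line e j v (h : R) :
  \sum_l e l * (h *: vert j + v).2 0 (lshift t l) =
  \sum_l e l * v.2 0 (lshift t l) + e j * h.
Proof.
rewrite (eq_bigr (fun l => e l * v.2 0 (lshift t l) + e l * (h * (l == j)%:R))).
  rewrite big_split; congr (_ + _); rewrite (bigD1 j) //= eqxx mulr1 big1 ?addr0 //.
  by move=> l /negPf ->; rewrite !mulr0.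
by move=> l _; rewrite vertE /= !mxE (inj_eq (@lshift_inj _ _)); ring.
Qed.

(** The speed y_j of the curve turns the factor y^(-e) into y^(-[lower e j]), so the derivative of
    [f] comes out normalised by its own weight. The other term, from differentiating y^(-e), is the
    origin of every polynomial factor in the final relations. *)
Lemma is_derive_pull_vert e f v j : derivable f (exp_chart v) (vert j) ->
  is_derive v (vert j) (pull e f)
    (pull (lower e j) ('D_(vert j) f) v - e j * pull e f v).
Proof.
move=> df; apply: is_derive_of_line.
pose c := \sum_j e j * v.2 0 (lshift t j).
pose y := v.2 0 (lshift t j).
have -> : (fun h => pull e f (h *: vert j + v)) =
  (fun h => expR (- (c + e j * h))) * (fun h : R => f ((expR (h + y) - expR y) *: vert j + exp_chart v)).
  apply/funext => h; rewrite /pull exp_chart_vert [RHS]/GRing.mul /=.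
  by rewrite sum_vert_line.
have d1 : is_derive (0 : R) 1 (fun h : R => expR (- (c + e j * h))) (- e j * expR (- c)).
  have -> : - e j * expR (- c) = expR (- (c + e j * 0)) * - (e j).
    by rewrite mulr0 addr0 mulrC.
  apply: (is_derive_comp1 (f := fun h => - (c + e j * h)) (g := expR)).
  rewrite (_ : (fun h => _) = - (cst c + e j *: id)); last by apply/funext.
  by apply: is_derive_eq; rewrite add0r /GRing.scale /= mulr1.
have d2 : is_derive (0 : R) 1 (fun h : R => f ((expR (h + y) - expR y) *: vert j + exp_chart v))
    ('D_(vert j) f (exp_chart v) * expR y).
  have -> : 'D_(vert j) f (exp_chart v) * expR y =
     'D_(vert j) f ((expR (0 + y) - expR y) *: vert j + exp_chart v) * expR (0 + y).
    by rewrite !add0r subrr scale0r add0r.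
  apply: (is_derive_comp1 (f := fun h : R => expR (h + y) - expR y)
     (g := fun x : R => f (x *: vert j + exp_chart v))).
    rewrite (_ : (fun h => _) = (fun h => expR (h + y)) - cst (expR y)); last by apply/funext.
    have d3 : is_derive (0 : R) 1 (fun h : R => expR (h + y)) (expR (0 + y)).
      rewrite -[X in is_derive _ _ _ X]mulr1.
      apply: (is_derive_comp1 (f := fun h : R => h + y) (g := expR)).
      by apply: is_derive_eq; rewrite addr0.
    by apply: is_derive_eq; rewrite subr0.
  by apply: is_derive_line; rewrite add0r subrr scale0r add0r.
apply: is_derive_eq; rewrite /= mulr0 addr0 add0r subrr scale0r add0r /pull -/c.
have -> : - (\sum_l lower e j l * v.2 0 (lshift t l)) = - c + y.
  by rewrite sum_lower opprB addrC.
rewrite expRD /GRing.scale /=; ring.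
Qed.

Definition rbounded e f : Prop :=
  exists M : R, forall p, HsCt p -> `|f p| <= M * height e p.

Lemma pull_bounded e f : rbounded e f -> exists M, forall v, `|pull e f v| <= M.
Proof.
move=> [M HM]; exists M => v; rewrite /pull normrM ger0_norm ?expR_ge0 //.
rewrite expRN mulrC ler_pdivrMr ?expR_gt0 // -height_exp_chart.
exact/HM/exp_chart_HsCt.
Qed.

(** The normalising weight [e'] may differ from the weight [e] of [f]: both monomials are bounded on
    a slab. *)
Lemma pull_bounded_slab e e' f (r : R) : rbounded e f ->
  exists M, forall v, slab r v -> `|pull e' f v| <= M.
Proof.
move=> [M HM]; exists (expR (\sum_j `|e' j| * r) * (`|M| * expR (\sum_j `|e j| * r))) => v sv.
rewrite /pull normrM ger0_norm ?expR_ge0 //.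
apply: ler_pM; rewrite ?expR_ge0 //.
  rewrite ler_expR -sumrN; apply: ler_sum => j _.
  apply: le_trans (ler_norm _) _; rewrite normrN normrM ler_wpM2l //; exact: sv.
apply: le_trans (HM _ (exp_chart_HsCt v)) _.
apply: le_trans (ler_norm _) _; rewrite normrM ler_wpM2l // height_exp_chart.
rewrite ger0_norm ?expR_ge0 // ler_expR; apply: ler_sum => j _.
by apply: le_trans (ler_norm _) _; rewrite normrM ler_wpM2l //; exact: sv.
Qed.

(** In the application [e'] is the weight of the derivative and not of [f], so [pull e' f] has no
    global bound; this is what forces the averaging by slabs. *)
Lemma negligible_pull_horizontal e e' e'' f w : smooth_on HsCt f -> horizontal w ->
  rbounded e f -> rbounded e'' ('D_w ('D_w f)) -> negligible (pull e' ('D_w f)).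
Proof.
move=> sf hw B0 B2.
apply: (@negligible_horizontal_derive _ _ _ w (pull e' f) _ (pull e' ('D_w ('D_w f)))) => //.
- move=> u; apply: is_derive_pull_horizontal => //.
  exact: smooth_derivable sf (exp_chart_HsCt u).
- move=> u; apply: is_derive_pull_horizontal => //.
  exact: smooth_derivable (smooth_derive w sf) (exp_chart_HsCt u).
move=> r; have [M0 H0] := pull_bounded_slab e' r B0.
have [M2 H2] := pull_bounded_slab e' r B2.
exists (Num.max M0 M2) => u su; rewrite !le_max H0 //= H2 ?orbT //.
Qed.

Lemma negligible_pull_vert e f j : smooth_on HsCt f ->
  rbounded e f -> rbounded (lower e j) ('D_(vert j) f) ->
  rbounded (lower (lower e j) j) ('D_(vert j) ('D_(vert j) f)) ->
  negligible (fun v => pull (lower e j) ('D_(vert j) f) v - e j * pull e f v).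
Proof.
move=> sf B0 B1 B2.
have [M0 H0] := pull_bounded B0; have [M1 H1] := pull_bounded B1.
have [M2 H2] := pull_bounded B2.
pose F u := pull (lower e j) ('D_(vert j) f) u - e j * pull e f u.
pose F2 u := (pull (lower (lower e j) j) ('D_(vert j) ('D_(vert j) f)) u -
  lower e j j * pull (lower e j) ('D_(vert j) f) u) - e j * F u.
have HF u : `|F u| <= M1 + `|e j| * M0.
  apply: le_trans (ler_normB _ _) _; rewrite [X in _ + X <= _]normrM; apply: lerD => //.
  by rewrite ler_wpM2l.
have d0 u : is_derive u (vert j) (pull e f) (F u).
  by apply: is_derive_pull_vert; exact: smooth_derivable sf (exp_chart_HsCt u).
pose M := M0 + (M2 + `|lower e j j| * M1 + `|e j| * (M1 + `|e j| * M0)).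
have M00 : 0 <= M0 by apply: le_trans (H0 0).
have M10 : 0 <= M1 by apply: le_trans (H1 0).
have M20 : 0 <= M2 by apply: le_trans (H2 0).
apply: (@negligible_derive _ _ _ (vert j) (pull e f) F F2 M) => //.
- move=> u; apply: is_deriveB.
    apply: is_derive_pull_vert.
    exact: smooth_derivable (smooth_derive _ sf) (exp_chart_HsCt u).
- move=> u; apply: le_trans (H0 u) _; rewrite lerDl !addr_ge0 // mulr_ge0 //.
  by rewrite addr_ge0 // mulr_ge0.
move=> u; rewrite /M -[leLHS]add0r; apply: lerD => //.
apply: le_trans (ler_normB _ _) _; rewrite [X in _ + X <= _]normrM; apply: lerD.
  apply: le_trans (ler_normB _ _) _; rewrite [X in _ + X <= _]normrM; apply: lerD => //.
  by rewrite ler_wpM2l.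
by rewrite ler_wpM2l.
Qed.

End LogCoordinates.

Section ComplexNegligible.
Local Open Scope classical_set_scope.
Local Open Scope ring_scope.
Context {R : realType} {s t : nat}.
Local Notation n := (s + t)%N.
Local Notation V := (Cn R n).
Implicit Types (F G : V -> R[i]) (e : 'I_s -> R).

Definition cnegligible F : Prop :=
  negligible (fun v => complex.Re (F v)) /\ negligible (fun v => complex.Im (F v)).

Lemma cnegligible_ext F G : F =1 G -> cnegligible F -> cnegligible G.
Proof. by move=> /funext ->. Qed.

Lemma cnegligibleD F G : cnegligible F -> cnegligible G ->
  cnegligible (fun v => F v + G v).
Proof.
move=> [F1 F2] [G1 G2]; split.
  by apply: negligible_ext (negligibleD F1 G1) => v /=; case: (F v) (G v) => ? ? [].
by apply: negligible_ext (negligibleD F2 G2) => v /=; case: (F v) (G v) => ? ? [].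
Qed.

Lemma cnegligibleZ F (c : R[i]) : cnegligible F -> cnegligible (fun v => c * F v).
Proof.
move=> [F1 F2]; case: c => a b; split.
  apply: negligible_ext (negligibleD (negligibleZ a F1) (negligibleZ (- b) F2)) => v /=.
  by case: (F v) => x y /=; rewrite mulNr.
apply: negligible_ext (negligibleD (negligibleZ a F2) (negligibleZ b F1)) => v /=.
by case: (F v).
Qed.

Lemma cnegligible0 : cnegligible (fun=> 0).
Proof. by split; exact: negligible0. Qed.

Lemma cnegligible_sum (I : Type) (r : seq I) (P : pred I) (F : I -> V -> R[i]) :
  (forall i, P i -> cnegligible (F i)) ->
  cnegligible (fun v => \sum_(i <- r | P i) F i v).
Proof.
move=> H; elim: r => [|i r IH].
  by apply: cnegligible_ext cnegligible0 => v; rewrite big_nil.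
have [Pi|Pi] := boolP (P i); last first.
  by apply: cnegligible_ext IH => v; rewrite big_cons (negPf Pi).
by apply: cnegligible_ext (cnegligibleD (H i Pi) IH) => v; rewrite big_cons Pi.
Qed.

Definition cpull e (g : V -> R[i]) (v : V) : R[i] :=
  (expR (- \sum_j e j * v.2 0 (lshift t j)))%:C%C * g (exp_chart v).

Lemma Re_cpull e g (v : V) : complex.Re (cpull e g v) = pull e (fun p => complex.Re (g p)) v.
Proof. by rewrite /cpull /pull; case: (g _) => a b /=; rewrite mul0r subr0. Qed.

Lemma Im_cpull e g (v : V) : complex.Im (cpull e g v) = pull e (fun p => complex.Im (g p)) v.
Proof. by rewrite /cpull /pull; case: (g _) => a b /=; rewrite mul0r addr0. Qed.

End ComplexNegligible.

(** * Frame derivatives of equivariant functions, up to negligible terms *)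

Section Derivatives.
Local Open Scope classical_set_scope.
Local Open Scope ring_scope.
Context {R : realType} {s t : nat} {K : fieldExtType rat}.
Context (sigma : 'I_(s + t + t) -> {rmorphism K -> R[i]}) (U : set K).
Context (Hemb : labelled_embeddings sigma) (Hadm : admissible sigma U).
Local Notation n := (s + t)%N.
Local Notation V := (Cn R n).
Local Notation HsCt := (@HsCt R s t).
Context (weight : 'I_n -> 'I_s -> R).
Context (weight_real : forall j l : 'I_s, weight (lshift t j) l = - (l == j)%:R).
Context (weightP : forall j u, U u ->
  normc (emb sigma j u) = expR (- \sum_l weight j l * lnsig sigma l u)).
Local Notation equivariant := (equivariant sigma U).
Implicit Types (p v w : V) (e : 'I_s -> R) (g : V -> R[i]).

Definition shift_weight e (l : 'I_n) : 'I_s -> R := fun i => e i + weight l i.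

Definition is_basis_dir (l : 'I_n) w := w = evec l \/ w = cplxJ (evec l).

Lemma cderive_basis_dir l w : is_basis_dir l w -> exists c1 c2 : R[i],
  forall g p, csmooth HsCt g -> HsCt p ->
  cderive w g p = c1 * frame_derive (lshift n l) g p + c2 * frame_derive (rshift n l) g p.
Proof.
case=> ->.
  exists 1, 1.
  move=> g p sg Hp.
  rewrite (cderive_evec l sg Hp).
  by congr (_ + _); rewrite mul1r.
exists 'i, (- 'i) => g p sg Hp.
rewrite (cderive_Jevec l sg Hp).
by rewrite mulrBr mulNr.
Qed.

Lemma bounded_cderive e g l w : equivariant e g -> is_basis_dir l w ->
  bounded_weight (shift_weight e l) (cderive w g).
Proof.
move=> Eg /cderive_basis_dir [c1 [c2 H]].
have B1 := equivariant_bounded Hemb Hadm (equivariant_frame_derive Hemb Hadm weightP (lshift n l) Eg).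
have B2 := equivariant_bounded Hemb Hadm (equivariant_frame_derive Hemb Hadm weightP (rshift n l) Eg).
rewrite placeL in B1; rewrite placeR in B2.
apply: bounded_weight_ext (bounded_weightD (bounded_weightZ c1 B1) (bounded_weightZ c2 B2)).
move=> p /set_mem Hp; rewrite H //; exact: Eg.1.
Qed.

Lemma bounded_cderive2 e g l w : equivariant e g -> is_basis_dir l w ->
  bounded_weight (shift_weight (shift_weight e l) l) (cderive w (cderive w g)).
Proof.
move=> Eg lw; have [c1 [c2 H]] := cderive_basis_dir lw.
have E1 := equivariant_frame_derive Hemb Hadm weightP (lshift n l) Eg.
have E2 := equivariant_frame_derive Hemb Hadm weightP (rshift n l) Eg.
rewrite placeL in E1; rewrite placeR in E2.
have B1 := bounded_cderive E1 lw; have B2 := bounded_cderive E2 lw.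
apply: bounded_weight_ext (bounded_weightD (bounded_weightZ c1 B1) (bounded_weightZ c2 B2)).
move=> p /set_mem Hp; have oH := @open_HsCt R s t.
have s1 := csmooth_frame_derive (lshift n l) oH Eg.1.
have s2 := csmooth_frame_derive (rshift n l) oH Eg.1.
rewrite -(cderiveZ _ _ oH s1 Hp) -(cderiveZ _ _ oH s2 Hp).
rewrite -(cderiveD _ oH (csmoothZ c1 oH s1) (csmoothZ c2 oH s2) Hp).
apply: (cderive_local _ oH _ Hp) => q /set_mem Hq.
by rewrite (H _ _ Eg.1 Hq).
Qed.

Lemma rbounded_Re e g : bounded_weight e g -> rbounded e (fun p => complex.Re (g p)).
Proof.
by move=> [M H]; exists M => p Hp; apply: le_trans (normc_Re _) (H p Hp).
Qed.

Lemma rbounded_Im e g : bounded_weight e g -> rbounded e (fun p => complex.Im (g p)).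
Proof.
by move=> [M H]; exists M => p Hp; apply: le_trans (normc_Im _) (H p Hp).
Qed.

Lemma cnegligible_horizontal e e' g l w : equivariant e g -> is_basis_dir l w ->
  horizontal w -> cnegligible (cpull e' (cderive w g)).
Proof.
move=> Eg lw hw; have [s1 s2] := Eg.1.
have B0 := equivariant_bounded Hemb Hadm Eg.
have B2 := bounded_cderive2 Eg lw.
split.
  apply: (negligible_ext (fun v => esym (Re_cpull _ _ v))).
  exact: (negligible_pull_horizontal e' s1 hw (rbounded_Re B0) (rbounded_Re B2)).
apply: (negligible_ext (fun v => esym (Im_cpull _ _ v))).
exact: (negligible_pull_horizontal e' s2 hw (rbounded_Im B0) (rbounded_Im B2)).
Qed.

Lemma shift_weight_real e j : shift_weight e (lshift t j) = lower e j.
Proof. by apply/funext => l; rewrite /shift_weight weight_real. Qed.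

Lemma cnegligible_vert e g j : equivariant e g ->
  cnegligible (fun v => cpull (shift_weight e (lshift t j)) (cderive (vert j) g) v
                        - (e j)%:C%C * cpull e g v).
Proof.
move=> Eg; have [s1 s2] := Eg.1.
have lw : is_basis_dir (lshift t j) (vert j : V) by right.
have B0 := equivariant_bounded Hemb Hadm Eg.
have B1 := bounded_cderive Eg lw.
have B2 := bounded_cderive2 Eg lw.
rewrite !shift_weight_real in B1 B2 *.
split.
  apply: (negligible_ext _ (negligible_pull_vert s1 (rbounded_Re B0) (rbounded_Re B1) (rbounded_Re B2))).
move=> v.
have h1 := Re_cpull (lower e j) (cderive (vert j) g) v; have h2 := Re_cpull e g v.
rewrite [LHS](_ : _ = complex.Re (cpull (lower e j) (cderive (vert j) g) v)
   - e j * complex.Re (cpull e g v)); last by rewrite h1 h2.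
by case: (cpull (lower e j) _ v) (cpull e g v) => x y [z w] /=; ring.
apply: (negligible_ext _ (negligible_pull_vert s2 (rbounded_Im B0) (rbounded_Im B1) (rbounded_Im B2))).
move=> v.
have h1 := Im_cpull (lower e j) (cderive (vert j) g) v; have h2 := Im_cpull e g v.
rewrite [LHS](_ : _ = complex.Im (cpull (lower e j) (cderive (vert j) g) v)
   - e j * complex.Im (cpull e g v)); last by rewrite h1 h2.
by case: (cpull (lower e j) _ v) (cpull e g v) => x y [z w] /=; ring.
Qed.

(** The scalar by which d/d(log y_l) acts on averages; it is 0 at a complex place, where derivatives
    average out. *)
Definition expo e (l : 'I_n) : R :=
  match fintype.split l with inl j => e j | inr _ => 0 end.

Lemma horizontal_evec l : horizontal (evec l : V).
Proof. by move=> j; rewrite evecE /= mxE. Qed.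

Lemma horizontal_Jevec (l : 'I_t) : horizontal (cplxJ (evec (rshift s l)) : V).
Proof. by move=> j; rewrite cplxJE evecE /= mxE eq_lrshift. Qed.

(** Of the two real derivatives in E_a, the one in x is negligible, and the one in y contributes its
    exponent, with the coefficient [frame_sign a] i / 2 that it has in E_a. *)
Lemma cnegligible_frame_derive e g a : equivariant e g ->
  cnegligible (fun v => cpull (shift_weight e (place a)) (frame_derive a g) v
     - (frame_sign a)%:C%C * 'i * (2^-1)%:C%C * (expo e (place a))%:C%C * cpull e g v).
Proof.
move=> Eg; set e' := shift_weight e (place a).
have N1 : cnegligible (cpull e' (cderive (evec (place a)) g)).
  apply: (cnegligible_horizontal _ Eg) (horizontal_evec _).
  by left; reflexivity.
have N2 : cnegligible (fun v => cpull e' (cderive (cplxJ (evec (place a))) g) v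
     - (expo e (place a))%:C%C * cpull e g v).
  rewrite /e' /expo; case: (fintype.splitP (place a)) => j lj.
    have -> : place a = lshift t j by apply: val_inj.
    exact: cnegligible_vert.
  have -> : place a = rshift s j by apply: val_inj.
  apply: cnegligible_ext (cnegligible_horizontal (shift_weight e (rshift s j)) Eg _ (@horizontal_Jevec j)).
    by move=> v; rewrite mul0r subr0.
  by right; reflexivity.
apply: cnegligible_ext (cnegligibleD (cnegligibleZ (2^-1)%:C%C N1)
  (cnegligibleZ ((2^-1)%:C%C * ((frame_sign a)%:C%C * 'i)) N2)) => v.
rewrite /cpull (frame_deriveE _ Eg.1 (exp_chart_HsCt v)).
move: (_%:C)%C (cderive _ _ _) (_%:C)%C (cderive _ _ _) (_%:C)%C (_%:C)%C ('i) (g _).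
by move=> *; ring.
Qed.

(** The sign and the 4 come from (i/2)^2 = -1/4. The inner derivative sees the weight [e], the outer
    one the weight already shifted by [c]. *)
Lemma cnegligible_frame_derive2 e f a c : equivariant e f ->
  cnegligible (fun v =>
    cpull (shift_weight (shift_weight e (place c)) (place a))
      (frame_derive a (frame_derive c f)) v
    + (frame_sign a * frame_sign c / 4 *
        (expo (shift_weight e (place c)) (place a) * expo e (place c)))%:C%C * cpull e f v).
Proof.
move=> Ef; have Ec := equivariant_frame_derive Hemb Hadm weightP c Ef.
have N1 := cnegligible_frame_derive c Ef.
have N2 := cnegligible_frame_derive a Ec.
set k := (frame_sign a)%:C%C * 'i * (2^-1)%:C%C * (expo (shift_weight e (place c)) (place a))%:C%C : R[i].
apply: cnegligible_ext (cnegligibleD N2 (cnegligibleZ k N1)) => v.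
have -> : (4^-1) = 2^-1 * 2^-1 :> R by field.
rewrite /k !rmorphM /=.
have : 'i * 'i = -1 :> R[i] by rewrite -expr2 sqrCi.
rewrite -/(shift_weight e (place c)).
move: (cpull _ _ _) (_%:C)%C  (cpull _ _ _) (_%:C)%C (_%:C)%C (cpull _ _ _) (_%:C)%C (_%:C)%C ('i) => x1 x2 x3 x4 x5 x6 x7 x8 I hI.
rewrite [LHS](_ : _ = x6 - I * I * (x8 * x4 * (x7 * x7) * (x5 * x2) * x1)); last by ring.
by rewrite hI mulN1r opprK.
Qed.

End Derivatives.

(** * Powers of a (1,1)-form *)

Section JoinSets.
Import boot.finset.
Context {m k : nat}.
Implicit Types (A : {set 'I_m}) (B : {set 'I_k}) (S T : {set 'I_(m + k)}).

(** Used at two levels: for holomorphic and antiholomorphic indices in ['I_(n + n)], and for real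
    and complex places in ['I_(s + t)]. *)
Definition join_set A B : {set 'I_(m + k)} :=
  [set lshift k i | i in A] :|: [set rshift m j | j in B].

Lemma in_join_setL A B i : (lshift k i \in join_set A B) = (i \in A).
Proof.
rewrite in_setU mem_imset; last exact: lshift_inj.
by case: (i \in A) => //=; apply/negP => /imsetP[j _ /eqP]; rewrite eq_lrshift.
Qed.

Lemma in_join_setR A B j : (rshift m j \in join_set A B) = (j \in B).
Proof.
rewrite in_setU orbC mem_imset; last exact: rshift_inj.
by case: (j \in B) => //=; apply/negP => /imsetP[i _ /eqP]; rewrite eq_rlshift.
Qed.

Lemma join_setP S T : (forall i, (lshift k i \in S) = (lshift k i \in T)) ->
  (forall j, (rshift m j \in S) = (rshift m j \in T)) -> S = T.
Proof.
move=> H1 H2; apply/setP => a; case: (fintype.splitP a) => j aj.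
  by have -> : a = lshift k j by apply: val_inj.
by have -> : a = rshift m j by apply: val_inj.
Qed.

Lemma join_setD1L A B i : join_set A B :\ lshift k i = join_set (A :\ i) B.
Proof.
apply: join_setP => l; rewrite in_setD1.
  by rewrite !in_join_setL in_setD1 (inj_eq (@lshift_inj _ _)).
by rewrite !in_join_setR eq_rlshift.
Qed.

Lemma join_setD1R A B j : join_set A B :\ rshift m j = join_set A (B :\ j).
Proof.
apply: join_setP => l; rewrite in_setD1.
  by rewrite !in_join_setL eq_lrshift.
by rewrite !in_join_setR in_setD1 (inj_eq (@rshift_inj _ _)).
Qed.

Lemma sum_join_set (M : nmodType) A B (F : 'I_(m + k) -> M) :
  \sum_(x in join_set A B) F x = \sum_(i in A) F (lshift k i) + \sum_(j in B) F (rshift m j).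
Proof.
by rewrite big_split_ord /=; congr (_ + _); apply: eq_bigl => x;
  [exact: in_join_setL|exact: in_join_setR].
Qed.

Lemma card_join_set A B : #|join_set A B| = (#|A| + #|B|)%N.
Proof. by rewrite -!sum1_card sum_join_set. Qed.

End JoinSets.

Section WedgePowers.
Import boot.finset.
Context {R : realType} {n : nat}.
Local Notation V := (Cn R n).
Local Notation idx := 'I_(n + n).
Implicit Types (p q : V) (S T : {set idx}) (alpha beta : dform R n).

Lemma wedge_pow_local k alpha beta p : (forall S, alpha S p = beta S p) ->
  forall S, wedge_pow k alpha S p = wedge_pow k beta S p.
Proof.
move=> H; elim: k => //= k IH S; rewrite /wedge.
by apply: eq_bigr => T _; rewrite H -/(wedge_pow k alpha) IH.
Qed.

Lemma csmooth_wedge_pow A k alpha : open A -> (forall S, csmooth A (alpha S)) ->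
  forall S, csmooth A (wedge_pow k alpha S).
Proof.
move=> oA H; elim: k => [|k IH] S; first exact: csmooth_cst.
apply: csmooth_sum => // T _; apply: csmoothZ => //.
by apply: csmoothM => //; exact: IH.
Qed.

(** A diagonal change of frame scales theta_S by a product over S, and this product splits along
    each pair T, S \ T of the wedge product. *)
Lemma wedge_pow_scale k alpha (lam : idx -> R[i]) p q :
  (forall S, alpha S q * \prod_(a in S) lam a = alpha S p) ->
  forall S, wedge_pow k alpha S q * \prod_(a in S) lam a = wedge_pow k alpha S p.
Proof.
move=> H; elim: k => [|k IH] S.
  rewrite /wedge_pow /= /dform1; case: eqP => [/cards0_eq ->|_].
    by rewrite big_set0 mulr1.
  by rewrite mul0r.
rewrite /= /wedge mulr_suml; apply: eq_bigr => T TS.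
rewrite -H -IH -mulrA; congr (_ * _).
rewrite [in LHS](big_setID T) /= (finset.setIidPr TS) mulrACA.
by rewrite -/(wedge_pow k alpha).
Qed.

Definition frame_sgn S (a : idx) : R[i] := \prod_(b in S | (b < a)%N) (-1).

Lemma frame_sgn_neq0 S a : frame_sgn S a != 0.
Proof. by apply/prodf_neq0 => b _; rewrite oppr_eq0 oner_neq0. Qed.

Lemma del_delbarE A alpha S p : open A -> A p -> (forall T, csmooth A (alpha T)) ->
  del (delbar alpha) S p =
  \sum_(a in S | (a < n)%N) \sum_(c in S :\ a | (n <= c)%N)
    frame_sgn S a * frame_sgn (S :\ a) c *
      frame_derive a (frame_derive c (alpha (S :\ a :\ c))) p.
Proof.
move=> oA Ap sa; rewrite /del /partial_d; apply: eq_bigr => a _.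
rewrite -/(frame_sgn S a).
have sd c T : csmooth A (frame_derive c (alpha T)) by exact: csmooth_frame_derive.
rewrite /delbar /partial_d.
rewrite (@frame_derive_sum _ _ _ _ _ A) //; last first.
  by move=> c _; apply: csmoothZ.
rewrite mulr_sumr; apply: eq_bigr => c _.
by rewrite (frame_deriveZ _ _ oA (sd _ _) Ap) mulrA.
Qed.

Definition mono_set k (e f : 'I_k -> 'I_n) : {set idx} :=
  join_set [set e i | i in [set: 'I_k]] [set f i | i in [set: 'I_k]].

Lemma card_ltn k (i : 'I_k.+1) : #|[pred i' : 'I_k | (i' < i)%N]| = i.
Proof.
have ik : (i <= k)%N by rewrite -ltnS.
rewrite -[RHS](card_ord i) -(fintype.card_image (f := widen_ord ik)); last first.
  by move=> x y /(congr1 val) /= /val_inj.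
apply: eq_card => x; rewrite inE; apply/idP/fintype.imageP => [xi|[y _ ->]].
  by exists (Ordinal xi) => //; apply: val_inj.
exact: (ltn_ord y).
Qed.

Lemma prod_mono_set k (e f : 'I_k -> 'I_n) (P : pred idx) :
  injective e -> injective f ->
  \prod_(b in mono_set e f | P b) (-1) =
   (-1) ^+ #|[pred i | P (lshift n (e i))]| * (-1) ^+ #|[pred i | P (rshift n (f i))]| :> R[i].
Proof.
move=> ie jf.
rewrite (bigID (fun b : idx => (b < n)%N)) /=; congr (_ * _).
  rewrite prodr_const; congr (_ ^+ _).
  rewrite -(fintype.card_image (f := fun i => lshift n (e i)) _ [pred i | P (lshift n (e i))]); last first.
    by move=> x y /lshift_inj /ie.
  apply: eq_card => b; rewrite [LHS]unfold_in /=; case: (fintype.splitP b) => j bj.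
    have -> : b = lshift n j by apply: val_inj.
    rewrite /mono_set in_join_setL andbT; apply/andP/fintype.imageP.
      by move=> [/imsetP[i _ ->] Pi]; exists i.
    by move=> [i Pi /lshift_inj ->]; split => //; apply/imsetP; exists i.
  have -> : b = rshift n j by apply: val_inj.
  rewrite andbF; apply/esym/fintype.imageP => -[i _ /eqP].
  by rewrite eq_rlshift.
rewrite prodr_const; congr (_ ^+ _).
rewrite -(fintype.card_image (f := fun i => rshift n (f i)) _ [pred i | P (rshift n (f i))]); last first.
  by move=> x y /rshift_inj /jf.
apply: eq_card => b; rewrite [LHS]unfold_in /=; case: (fintype.splitP b) => j bj.
  have -> : b = lshift n j by apply: val_inj.
  rewrite andbF; apply/esym/fintype.imageP => -[i _ /eqP].
  by rewrite eq_lrshift.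
have -> : b = rshift n j by apply: val_inj.
rewrite /mono_set in_join_setR andbT; apply/andP/fintype.imageP.
  by move=> [/imsetP[i _ ->] Pi]; exists i.
by move=> [i Pi /rshift_inj ->]; split => //; apply/imsetP; exists i.
Qed.

(** In closed form (-1)^(k(k-1)/2) k!: the factorial counts the orders of the factors, the sign
    moves all dz in front of all dzbar. *)
Definition det_const : nat -> R[i] :=
  fix c k := if k is k'.+1 then (-1) ^+ k' * k'.+1%:R * c k' else 1.

Lemma det_const_neq0 k : det_const k != 0.
Proof.
by elim: k => [|k IH] /=; rewrite ?oner_neq0 // !mulf_neq0 // ?signr_eq0 // pnatr_eq0.
Qed.

Definition increasing k (e : 'I_k -> 'I_n) := forall i j : 'I_k, (i < j)%N -> (e i < e j)%N.

Lemma increasing_inj k (e : 'I_k -> 'I_n) : increasing e -> injective e.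
Proof.
move=> He i j eij; apply: val_inj; case: (ltngtP i j) => // /He; rewrite eij ltnn //.
Qed.

Lemma increasing_lt k (e : 'I_k -> 'I_n) i j : increasing e -> (e i < e j)%N = (i < j)%N.
Proof.
move=> He; case: (ltngtP i j) => [/He //|/He h|/val_inj ->]; last by rewrite ltnn.
by apply/negbTE; rewrite -leqNgt ltnW.
Qed.

Lemma increasing_lift k (e : 'I_k.+1 -> 'I_n) i : increasing e -> increasing (e \o lift i).
Proof.
move=> He a b ab; apply: He; rewrite /= /bump.
by move: ab; case: (leqP i a); case: (leqP i b) => /=; lia.
Qed.

Lemma increasing_enum k (I : {set 'I_n}) : #|I| = k ->
  exists2 e : 'I_k -> 'I_n, increasing e & [set e i | i in [set: 'I_k]] = I.
Proof.
move=> kI; case: (posnP k) => [k0|k0].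
  move: kI; rewrite k0 => /cards0_eq ->.
  exists (fun i : 'I_0 => False_rect _ (match i with Ordinal _ h => notF h end)).
    by case.
  by apply/setP => x; rewrite inE; apply/negP => /imsetP[[]].
have /card_gt0P[x0 _] : (0 < #|I|)%N by rewrite kI.
have se : size (enum I) = k by rewrite -cardE.
have so : sorted ltn (map val (enum I)).
  apply: (subseq_sorted ltn_trans (s2 := map val (enum 'I_n))).
    by apply: map_subseq; rewrite enumT /enum_mem; exact: filter_subseq.
  by rewrite val_enum_ord; exact: iota_ltn_sorted.
exists (fun i => nth x0 (enum I) i).
  move=> i j ij.
  have := sorted_ltn_nth ltn_trans 0%N so.
  move=> /(_ i j); rewrite !inE size_map se !ltn_ord => /(_ isT isT ij).
  by rewrite !(nth_map x0) ?se.
apply/setP => x; apply/imsetP/idP => [[i _ ->]|xI].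
  by rewrite -mem_enum mem_nth // se.
have xe : (index x (enum I) < k)%N by rewrite -se index_mem mem_enum.
exists (Ordinal xe); first by rewrite inE.
by rewrite [RHS](_ : _ = nth x0 (enum I) (index x (enum I))) // nth_index // mem_enum.
Qed.

Lemma lift_lt k (i : 'I_k.+1) (i' : 'I_k) : (lift i i' < i)%N = (i' < i)%N.
Proof. by rewrite /= /bump; case: (leqP i i') => /=; lia. Qed.

Lemma mono_set_lift k (e f : 'I_k.+1 -> 'I_n) i j : increasing e -> increasing f ->
  mono_set e f :\: [set lshift n (e i); rshift n (f j)] = mono_set (e \o lift i) (f \o lift j).
Proof.
move=> He Hf; apply: join_setP => l; rewrite in_setD in_set2.
  rewrite !in_join_setL eq_lrshift orbF (inj_eq (@lshift_inj _ _)).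
  apply/andP/imsetP => [[li /imsetP[i' _ e1]]|[i' _ ->]].
    case: (unliftP i i') e1 => [i'' ->|->] e1; last by rewrite e1 eqxx in li.
    by exists i''.
  split; last by apply/imsetP; exists (lift i i').
  by rewrite (inj_eq (increasing_inj He)) /= eq_sym neq_lift.
rewrite !in_join_setR eq_rlshift orFb (inj_eq (@rshift_inj _ _)).
apply/andP/imsetP => [[li /imsetP[i' _ e1]]|[i' _ ->]].
  case: (unliftP j i') e1 => [i'' ->|->] e1; last by rewrite e1 eqxx in li.
  by exists i''.
split; last by apply/imsetP; exists (lift j i').
by rewrite (inj_eq (increasing_inj Hf)) /= eq_sym neq_lift.
Qed.

(** The index [e i] exceeds [i] of the remaining dz indices, while the dzbar index [f j] exceeds all
    [k] remaining dz indices and [j] of the dzbar ones. The part [i + j] is the cofactor sign; the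
    part [k] goes into [det_const]. *)
Lemma shuffle_sign_mono k (e f : 'I_k.+1 -> 'I_n) i j : increasing e -> increasing f ->
  shuffle_sign [set lshift n (e i); rshift n (f j)]
    (mono_set e f :\: [set lshift n (e i); rshift n (f j)]) =
  (-1) ^+ k * (-1) ^+ (i + j) :> R[i].
Proof.
move=> He Hf; rewrite /shuffle_sign mono_set_lift //.
have He' := increasing_inj (increasing_lift i He).
have Hf' := increasing_inj (increasing_lift j Hf).
rewrite big_setU1 /= ?inE ?eq_lrshift // big_set1.
rewrite (prod_mono_set (fun b => (b < e i)%N)) // (prod_mono_set (fun b => (b < n + f j)%N)) //.
rewrite (eq_card (B := [pred i' : 'I_k | (i' < i)%N])); last first.
  by move=> i'; rewrite !inE /= (increasing_lt _ _ He) lift_lt.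
rewrite card_ltn.
rewrite (eq_card (B := pred0)) ?card0 ?mulr1; last first.
  by move=> i'; rewrite !inE /=; apply/negbTE; rewrite -leqNgt; have := ltn_ord (e i); lia.
rewrite (eq_card (B := predT)) ?card_ord; last first.
  by move=> i'; rewrite !inE /=; have := ltn_ord (e (lift i i')); lia.
rewrite (eq_card (B := [pred i' : 'I_k | (i' < j)%N])); last first.
  by move=> i'; rewrite !inE /= ltn_add2l (increasing_lt _ _ Hf) lift_lt.
by rewrite card_ltn exprD; ring.
Qed.

(* Laplace expansion along every row: each of the k.+1 rows contributes the
   whole determinant. *)
Lemma wedge_pow_det alpha (h : 'I_n -> 'I_n -> R[i]) p :
  (forall i j, alpha [set lshift n i; rshift n j] p = h i j) ->
  (forall S, (forall i j, S <> [set lshift n i; rshift n j]) -> alpha S p = 0) ->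
  forall k (e f : 'I_k -> 'I_n), increasing e -> increasing f ->
  wedge_pow k alpha (mono_set e f) p = det_const k * \det (\matrix_(i, j) h (e i) (f j)).
Proof.
move=> Hh H0; elim=> [|k IH] e f He Hf.
  rewrite det_mx00 mulr1 /wedge_pow /= /dform1 cards_eq0.
  have -> : mono_set e f = finset.set0.
    by apply: join_setP => l; rewrite ?in_join_setL ?in_join_setR inE;
       apply/negP => /imsetP[[]].
  by rewrite eqxx.
pose S := mono_set e f.
pose T (x : 'I_k.+1 * 'I_k.+1) : {set idx} := [set lshift n (e x.1); rshift n (f x.2)].
have Tinj : injective T.
  move=> [i j] [i' j'] /setP TT.
  have := TT (lshift n (e i)); rewrite !inE /= eqxx !eq_lrshift !orbF (inj_eq (@lshift_inj _ _)).
  move=> /esym/eqP h1; have -> := increasing_inj He h1.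
  have := TT (rshift n (f j)); rewrite !inE /= eqxx !eq_rlshift !orFb (inj_eq (@rshift_inj _ _)).
  by move=> /esym/eqP h2; have -> := increasing_inj Hf h2.
have TS x : T x \subset S.
  apply/fintype.subsetP => a; rewrite in_set2 => /orP[] /eqP ->; rewrite /S /mono_set.
    by rewrite in_join_setL; apply/imsetP; exists x.1.
  by rewrite in_join_setR; apply/imsetP; exists x.2.
rewrite [LHS]/= /wedge -/(wedge_pow k alpha) -/S.
rewrite (bigID (fun T' => T' \in [set T x | x : 'I_k.+1 * 'I_k.+1])) /= [X in _ + X]big1 ?addr0; last first.
  move=> T' /andP[T'S T'n]; rewrite H0 ?mul0r ?mulr0 // => i j eT'.
  have : lshift n i \in S by apply: (fintype.subsetP T'S); rewrite eT' !inE eqxx.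
  rewrite in_join_setL => /imsetP[i' _ ei].
  have : rshift n j \in S by apply: (fintype.subsetP T'S); rewrite eT' !inE eqxx orbT.
  rewrite in_join_setR => /imsetP[j' _ ej].
  by move/negP: T'n; apply; apply/imsetP; exists (i', j') => //; rewrite /T /= -ei -ej.
rewrite (eq_bigl (fun T' => T' \in [set T x | x : 'I_k.+1 * 'I_k.+1])); last first.
  move=> T'; apply/andP/idP => [[]//|T'T]; split => //.
  by case/imsetP: T'T => x _ ->.
rewrite big_imset /=; last by move=> x y _ _; exact: Tinj.
rewrite (eq_bigl xpredT); last by move=> x; rewrite inE.
rewrite -(pair_bigA _ (fun i j => shuffle_sign (T (i, j)) (S :\: T (i, j)) *
  (alpha (T (i, j)) p * wedge_pow k alpha (S :\: T (i, j)) p))) /=.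
set A := \matrix_(i, j) _.
rewrite (eq_bigr (fun i : 'I_k.+1 => (-1) ^+ k * det_const k * \det A)).
  rewrite sumr_const card_ord -mulr_natr; ring.
move=> i _; rewrite (expand_det_row A i) mulr_sumr; apply: eq_bigr => j _.
rewrite shuffle_sign_mono // Hh mono_set_lift // IH; [|exact: increasing_lift|exact: increasing_lift].
rewrite /cofactor mxE.
have -> : (\matrix_(i0, j0) h ((e \o lift i) i0) ((f \o lift j) j0)) = row' i (col' j A).
  by apply/matrixP => x y; rewrite !mxE.
by move: (\det _) => d; ring.
Qed.

End WedgePowers.

(** By the spectral theorem the determinant is the product of the eigenvalues, and the i-th
    eigenvalue is the value of the form on the i-th row of the unitary matrix, which is nonzero. *)
Lemma det_posdef_gt0 (C : numClosedFieldType) k (A : 'M[C]_k) :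
  (forall i j, A j i = (A i j)^*) ->
  (forall v : 'I_k -> C, (exists i, v i != 0) ->
     0 < \sum_i \sum_j v i * A i j * (v j)^*) ->
  0 < \det A.
Proof.
move=> hA pA.
have : A \is hermsymmx.
  apply/is_hermitianmxP; rewrite expr0 scale1r; apply/matrixP => i j.
  by rewrite !mxE hA.
move=> /hermitian_normalmx/orthomx_spectralP.
have := spectral_unitarymx A; set P := spectralmx A; set d := spectral_diag A => uP eA.
have Pu := unitarymx_unit uP.
have eD : diag_mx d = P *m A *m P^t*%sesqui.
  by rewrite eA -invmx_unitary // !mulmxA mulmxV // mul1mx mulmxK.
have -> : \det A = \prod_i d 0 i.
  rewrite eA !det_mulmx det_diag mulrAC -det_mulmx mulVmx // det1 mul1r //.
apply: prodr_gt0 => i _.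
have -> : d 0 i = \sum_j \sum_l P i j * A j l * (P i l)^*.
  have /matrixP/(_ i i) := eD; rewrite !mxE eqxx mulr1n => ->.
  rewrite exchange_big; apply: eq_bigr => l _.
  by rewrite !mxE mulr_suml.
apply: pA; apply: contrapT => /forallNP P0.
have /matrixP/(_ i i) : P *m invmx P = 1%:M by rewrite mulmxV.
rewrite !mxE eqxx big1 => [/eqP|j _]; first by rewrite eq_sym oner_eq0.
by have /negP := P0 j; rewrite negbK => /eqP ->; rewrite mul0r.
Qed.

(** * The positive Hermitian matrix of a metric in the complex frame *)

Section HermitianForms.
Import boot.finset.
Context {R : realType} {n : nat}.
Local Notation V := (Cn R n).
Local Notation idx := 'I_(n + n).
Context (g : V -> V -> R) (Hg : hermitian_product g).
Implicit Types (v w : V).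

Lemma hermD1 v v' w : g (v + v') w = g v w + g v' w.
Proof. by rewrite -{1}[v]scale1r (herm_linear Hg) mul1r. Qed.

Lemma herm0 w : g 0 w = 0.
Proof. by have := hermD1 0 0 w; rewrite addr0; lra. Qed.

Lemma hermZ1 (c : R) v w : g (c *: v) w = c * g v w.
Proof. by rewrite -[c *: v]addr0 (herm_linear Hg) herm0 addr0. Qed.

Lemma hermD2 v w w' : g v (w + w') = g v w + g v w'.
Proof. by rewrite (herm_sym Hg) hermD1 !(herm_sym Hg v). Qed.

Lemma hermZ2 (c : R) v w : g v (c *: w) = c * g v w.
Proof. by rewrite (herm_sym Hg) hermZ1 !(herm_sym Hg v). Qed.

Lemma herm_sum1 (I : Type) (r : seq I) (F : I -> V) w :
  g (\sum_(i <- r) F i) w = \sum_(i <- r) g (F i) w.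
Proof.
elim: r => [|i r IH]; first by rewrite !big_nil herm0.
by rewrite !big_cons hermD1 IH.
Qed.

Lemma herm_sum2 (I : Type) (r : seq I) (F : I -> V) w :
  g w (\sum_(i <- r) F i) = \sum_(i <- r) g w (F i).
Proof. by rewrite (herm_sym Hg) herm_sum1; apply: eq_bigr => i _; rewrite (herm_sym Hg). Qed.

Lemma cplxJK v : cplxJ (cplxJ v) = - v.
Proof. by rewrite !cplxJE; case: v. Qed.

Lemma hermJ1 v w : g (cplxJ v) w = - g v (cplxJ w).
Proof.
rewrite -[LHS](herm_J Hg) cplxJK -scaleN1r hermZ1 mulN1r //.
Qed.

Lemma cplxJZ (c : R) v : cplxJ (c *: v) = c *: cplxJ v.
Proof. by rewrite !cplxJE; congr (_, _); rewrite /= scalerN. Qed.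

(** The complexified metric on the pair E_j, Ebar_l; up to the factor i this is the coefficient of
    dz_j /\ dzbar_l in omega. *)
Definition levi (j l : 'I_n) : R[i] := frame_val g (lshift n j) (rshift n l).

Lemma frame_reL j : frame_re (lshift n j) = 2^-1 *: evec j :> V.
Proof. by rewrite frame_reE placeL. Qed.
Lemma frame_reR j : frame_re (rshift n j) = 2^-1 *: evec j :> V.
Proof. by rewrite frame_reE placeR. Qed.
Lemma frame_imL j : frame_im (lshift n j) = - (2^-1 *: cplxJ (evec j)) :> V.
Proof. by rewrite /frame_im split_lshift. Qed.
Lemma frame_imR j : frame_im (rshift n j) = 2^-1 *: cplxJ (evec j) :> V.
Proof. by rewrite /frame_im split_rshift. Qed.

Let gN1 v w : g (- v) w = - g v w.
Proof. by rewrite -scaleN1r hermZ1 mulN1r. Qed.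
Let gN2 v w : g v (- w) = - g v w.
Proof. by rewrite -scaleN1r hermZ2 mulN1r. Qed.

Lemma leviE j l : levi j l =
  Complex (g (evec j) (evec l) / 2) (g (evec j) (cplxJ (evec l)) / 2).
Proof.
rewrite /levi /frame_val frame_reL frame_imL frame_reR frame_imR.
rewrite !(gN1, gN2) !(hermZ1, hermZ2) (herm_J Hg) hermJ1.
by congr Complex; field.
Qed.

Lemma levi_conj j l : levi l j = (levi j l)^*%C.
Proof.
rewrite !leviE /= (herm_sym Hg (evec l)); congr Complex.
by rewrite (herm_sym Hg (evec l)) hermJ1 mulNr.
Qed.

Let b v w := g (cplxJ v) w.

Lemma cplxJN v : cplxJ (- v) = - cplxJ v.
Proof. by rewrite -scaleN1r cplxJZ scaleN1r. Qed.

Lemma frame_val_J_LR j l : frame_val b (lshift n j) (rshift n l) = 'i * levi j l.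
Proof.
rewrite leviE /frame_val /b frame_reL frame_imL frame_reR frame_imR imE.
rewrite !(cplxJN, cplxJZ) !cplxJK !(gN1, gN2, hermZ1, hermZ2) !hermJ1 !cplxJK !(gN1, gN2).
by apply/eqP; rewrite eq_complex /=; apply/andP; split; apply/eqP; field.
Qed.

Lemma frame_val_J_LL j l : frame_val b (lshift n j) (lshift n l) = 0.
Proof.
rewrite /frame_val /b !frame_reL !frame_imL.
rewrite !(cplxJN, cplxJZ) !cplxJK !(gN1, gN2, hermZ1, hermZ2) !hermJ1 !cplxJK !(gN1, gN2).
by apply/eqP; rewrite eq_complex /=; apply/andP; split; apply/eqP; field.
Qed.

Lemma frame_val_J_RR j l : frame_val b (rshift n j) (rshift n l) = 0.
Proof.
rewrite /frame_val /b !frame_reR !frame_imR.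
rewrite !(cplxJN, cplxJZ) !cplxJK !(gN1, gN2, hermZ1, hermZ2) !hermJ1 !cplxJK !(gN1, gN2).
by apply/eqP; rewrite eq_complex /=; apply/andP; split; apply/eqP; field.
Qed.

(** Multiplication by the complex scalar [c], with J playing the part of i. *)
Definition rot (c : R[i]) v : V := complex.Re c *: v + complex.Im c *: cplxJ v.

Lemma cplxJD v w : cplxJ (v + w) = cplxJ v + cplxJ w.
Proof. by rewrite !cplxJE; congr (_, _); rewrite /= opprD. Qed.

Lemma cplxJ_sum (I : Type) (r : seq I) (F : I -> V) :
  cplxJ (\sum_(i <- r) F i) = \sum_(i <- r) cplxJ (F i).
Proof.
elim: r => [|i r IH]; last by rewrite !big_cons cplxJD IH.
by rewrite !big_nil cplxJE oppr0.
Qed.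

Lemma sum_Complex (I : Type) (r : seq I) (x y : I -> R) :
  \sum_(i <- r) Complex (x i) (y i) = Complex (\sum_(i <- r) x i) (\sum_(i <- r) y i).
Proof. by elim: r => [|i r IH]; rewrite ?big_nil // !big_cons IH. Qed.

Lemma levi_rot (c d : R[i]) j l : c * levi j l * d^*%C =
  Complex (g (rot c (evec j)) (rot d (evec l)) / 2)
    (g (rot c (evec j)) (cplxJ (rot d (evec l))) / 2).
Proof.
rewrite leviE /rot cplxJD !cplxJZ cplxJK scalerN !(hermD1, hermD2) !(gN1, gN2).
rewrite !(hermZ1, hermZ2) (herm_J Hg) hermJ1.
move: (g _ _) (g _ _) => x y; case: c d => c1 c2 [d1 d2] /=.
by congr Complex; field.
Qed.

(** By sesquilinearity the double sum is half the Hermitian square of the complex combination [Z] of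
    the vectors [evec (e i)]. Its imaginary part [g Z (cplxJ Z) / 2] vanishes because J is skew for
    [g], and [Z] is nonzero since its coordinate at [e i0] is [v i0]. *)
Lemma levi_posdef k (e : 'I_k -> 'I_n) (v : 'I_k -> R[i]) : injective e ->
  (exists i, v i != 0) ->
  0 < \sum_i \sum_j v i * levi (e i) (e j) * (v j)^*%C.
Proof.
move=> ie [i0 vi0].
pose Z : V := \sum_i rot (v i) (evec (e i)).
have -> : \sum_i \sum_j v i * levi (e i) (e j) * (v j)^*%C = Complex (g Z Z / 2) 0.
  have -> : Complex (g Z Z / 2) 0 = Complex (g Z Z / 2) (g Z (cplxJ Z) / 2).
    congr Complex; have := hermJ1 Z Z; rewrite (herm_sym Hg); lra.
  rewrite {2}/Z cplxJ_sum /Z !herm_sum1 !mulr_suml -sum_Complex; apply: eq_bigr => i _.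
  rewrite !herm_sum2 !mulr_suml -sum_Complex; apply: eq_bigr => j _.
  by rewrite levi_rot.
rewrite ltcE /= eqxx divr_gt0 // (herm_pos Hg) //.
apply: contra vi0 => /eqP Z0.
have sum1 (F : 'I_k -> V) l : (\sum_i F i).1 0 l = \sum_i (F i).1 0 l.
  by elim/big_rec2 : _ => [|i x y _ <-]; rewrite mxE.
have sum2 (F : 'I_k -> V) l : (\sum_i F i).2 0 l = \sum_i (F i).2 0 l.
  by elim/big_rec2 : _ => [|i x y _ <-]; rewrite mxE.
have r1 i : (rot (v i) (evec (e i))).1 0 (e i0) = complex.Re (v i) * (i == i0)%:R.
  by rewrite /rot cplxJE evecE /= !mxE (inj_eq ie) eq_sym oppr0 mulr0 addr0.
have r2 i : (rot (v i) (evec (e i))).2 0 (e i0) = complex.Im (v i) * (i == i0)%:R.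
  by rewrite /rot cplxJE evecE /= !mxE (inj_eq ie) eq_sym mulr0 add0r.
have := congr1 (fun z : V => z.1 0 (e i0)) Z0; have := congr1 (fun z : V => z.2 0 (e i0)) Z0.
rewrite /= sum1 sum2 (eq_bigr _ (fun i _ => r1 i)) (eq_bigr _ (fun i _ => r2 i)).
rewrite (bigD1 i0) //= eqxx mulr1 big1 => [|i /negPf ->]; last by rewrite mulr0.
rewrite (bigD1 i0) //= eqxx mulr1 big1 => [|i /negPf ->]; last by rewrite mulr0.
by rewrite !mxE !addr0 eq_complex /= => -> ->; rewrite !eqxx.
Qed.

Lemma det_levi_gt0 k (e : 'I_k -> 'I_n) : injective e ->
  0 < \det (\matrix_(i, j) levi (e i) (e j)).
Proof.
move=> ie; apply: det_posdef_gt0.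
  by move=> i j; rewrite !mxE levi_conj.
move=> v v0; have := levi_posdef ie v0.
rewrite (eq_bigr (fun i => \sum_j v i * (\matrix_(i, j) levi (e i) (e j)) i j * (v j)^*)) //.
by move=> i _; apply: eq_bigr => j _; rewrite mxE.
Qed.

End HermitianForms.

(** * Invariant metrics *)

Section InvariantMetric.
Import boot.finset.
Context {R : realType} {s t : nat} {K : fieldExtType rat}.
Context (sigma : 'I_(s + t + t) -> {rmorphism K -> R[i]}) (U : set K).
Context (Hemb : labelled_embeddings sigma) (Hadm : admissible sigma U).
Local Notation n := (s + t)%N.
Local Notation V := (Cn R n).
Local Notation idx := 'I_(n + n).
Local Notation HsCt := (@HsCt R s t).
Context (weight : 'I_n -> 'I_s -> R).
Context (weight_real : forall j l : 'I_s, weight (lshift t j) l = - (l == j)%:R).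
Context (weightP : forall j u, U u ->
  normc (emb sigma j u) = expR (- \sum_l weight j l * lnsig sigma l u)).
Context (g : V -> V -> V -> R).
Context (g_smooth : forall v w, smooth_on HsCt (fun p => g p v w)).
Context (g_herm : forall p, HsCt p -> hermitian_product (g p)).
Context (g_inv : forall ga p, OT_group U ga -> HsCt p -> forall v w,
  g p v w = g (act sigma ga p) (dact sigma ga v) (dact sigma ga w)).
Implicit Types (S T : {set idx}) (p : V).

Let omega := fundamental_form g.
Let b p (v w : V) := g p (cplxJ v) w.

Lemma card2_pair S a c : #|S| = 2%N -> a \in S -> c \in S -> (a < c)%N -> S = [set a; c].
Proof.
move=> S2 aS cS ac; apply/esym/eqP; rewrite eqEcard S2 cards2.
have -> : a != c by apply: contraTneq ac => ->; rewrite ltnn.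
by rewrite andbT; apply/fintype.subsetP => x; rewrite in_set2 => /orP[] /eqP ->.
Qed.

Lemma fundamental_formP S p (P : R[i] -> Prop) : P 0 ->
  (forall x y, P x -> P y -> P (x + y)) ->
  (forall a c, S = [set a; c] -> (a < c)%N -> P (frame_val (b p) a c)) ->
  P (omega S p).
Proof.
move=> P0 PD H; apply: big_ind => // a aS; apply: big_ind => // c /andP[cS /andP[/eqP S2 ac]].
by apply: H => //; exact: card2_pair.
Qed.

Lemma csmooth_fundamental_form S : csmooth HsCt (omega S).
Proof.
have oH := @open_HsCt R s t.
apply: csmooth_sum => // a _; apply: csmooth_sum => // c _; split.
  apply: (smooth_ext oH _ (smoothD oH (g_smooth (cplxJ (frame_re a)) (frame_re c))
    (smoothZ (-1) oH (g_smooth (cplxJ (frame_im a)) (frame_im c))))) => p _ /=.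
  by rewrite mulN1r.
exact: smoothD oH (g_smooth _ _) (g_smooth _ _).
Qed.

Lemma dact_cplxJ ga (v : V) : dact sigma ga (cplxJ v) = cplxJ (dact sigma ga v).
Proof.
rewrite !cplxJE; apply: eq_Cn => j; rewrite /dact /of_coords /= !mxE /zcoord /= !mxE;
 by case: (emb sigma j ga.2) => x y /=; ring.
Qed.

Lemma frame_val_act ga p a c : OT_group U ga -> HsCt p ->
  frame_val (b (act sigma ga p)) a c * (frame_factor sigma a ga.2 * frame_factor sigma c ga.2) =
  frame_val (b p) a c.
Proof.
move=> OTga Hp.
have Hq := act_HsCt Hemb Hadm OTga Hp; have hq := g_herm Hq.
have e v w : b p v w = b (act sigma ga p) (dact sigma ga v) (dact sigma ga w).
  by rewrite /b (g_inv OTga Hp) dact_cplxJ.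
rewrite /frame_val !e !dact_frame_re !dact_frame_im /b.
set x := frame_factor sigma a _; set y := frame_factor sigma c _.
have gN1 v w : g (act sigma ga p) (- v) w = - g (act sigma ga p) v w.
  by rewrite -scaleN1r (hermZ1 hq) mulN1r.
have gN2 v w : g (act sigma ga p) v (- w) = - g (act sigma ga p) v w.
  by rewrite -scaleN1r (hermZ2 hq) mulN1r.
rewrite !(cplxJD, cplxJN, cplxJZ) !(hermD1 hq, hermD2 hq, gN1, gN2).
rewrite !(hermD1 hq, hermD2 hq, gN1, gN2, hermZ1 hq, hermZ2 hq).
case: x y => x1 x2 [y1 y2] /=.
by move: (g _ _ _) (g _ _ _) (g _ _ _) (g _ _ _) => *; congr Complex; ring.
Qed.

Lemma fundamental_form_act ga p S : OT_group U ga -> HsCt p ->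
  omega S (act sigma ga p) * \prod_(a in S) frame_factor sigma a ga.2 = omega S p.
Proof.
move=> OTga Hp; rewrite /omega /fundamental_form /two_form mulr_suml.
apply: eq_bigr => a aS; rewrite mulr_suml; apply: eq_bigr => c /andP[cS /andP[/eqP S2 ac]].
rewrite -(frame_val_act _ _ OTga Hp); congr (_ * _).
rewrite (card2_pair S2 aS cS ac) big_setU1 /= ?big_set1 // in_set1.
by apply: contraTneq ac => ->; rewrite ltnn.
Qed.

Lemma fundamental_form_LR i j p : HsCt p ->
  omega [set lshift n i; rshift n j] p = 'i * levi (g p) i j.
Proof.
move=> Hp; rewrite -frame_val_J_LR; last exact: g_herm.
have ij : lshift n i != rshift n j by rewrite eq_lrshift.
have c2 : #|[set lshift n i; rshift n j]| = 2%N by rewrite cards2 ij.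
have lij : (lshift n i < rshift n j)%N by rewrite /=; have := ltn_ord i; lia.
rewrite /omega /fundamental_form /two_form c2 eqxx.
rewrite (bigD1 (lshift n i)) ?in_set2 ?eqxx //= [X in _ + X]big1 ?addr0; last first.
  move=> a /andP[]; rewrite in_set2 => /orP[/eqP -> /eqP //|/eqP -> _].
  by apply: big1 => c /andP[]; rewrite in_set2 => /orP[] /eqP -> /=; rewrite ?ltnn //; have := ltn_ord i; lia.
rewrite (bigD1 (rshift n j)) /= ?in_set2 ?eqxx ?orbT //= [X in _ + X]big1 ?addr0 //.
by move=> c /andP[/andP[]]; rewrite in_set2 => /orP[] /eqP -> /=; rewrite ?ltnn ?eqxx.
Qed.

Lemma fundamental_form_eq0 S p : HsCt p ->
  (forall i j, S <> [set lshift n i; rshift n j]) -> omega S p = 0.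
Proof.
move=> Hp SN; have hp := g_herm Hp.
apply: (@fundamental_formP S p (fun x => x = 0)) => //.
  by move=> x y -> ->; rewrite addr0.
move=> a c eS ac; case: (fintype.splitP a) (fintype.splitP c) => i ai [] j cj.
- have -> : a = lshift n i by apply: val_inj.
  have -> : c = lshift n j by apply: val_inj.
  exact: frame_val_J_LL.
- have ea : a = lshift n i by apply: val_inj.
  have ec : c = rshift n j by apply: val_inj.
  by case: (SN i j); rewrite eS ea ec.
- by move: ac; rewrite ai cj; have := ltn_ord j; lia.
- have -> : a = rshift n i by apply: val_inj.
  have -> : c = rshift n j by apply: val_inj.
  exact: frame_val_J_RR.
Qed.

Context (k : nat).
Let Omega := wedge_pow k omega.

Definition set_weight S : 'I_s -> R := fun l => \sum_(a in S) weight (place a) l.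

Lemma equivariant_wedge_pow S : equivariant sigma U (set_weight S) (Omega S).
Proof.
split.
  exact: csmooth_wedge_pow (@open_HsCt R s t) csmooth_fundamental_form S.
exists (fun u => \prod_(a in S) frame_factor sigma a u); split.
  move=> u Uu; rewrite normc_prod.
  rewrite (eq_bigr (fun a => expR (- \sum_l weight (place a) l * lnsig sigma l u))); last first.
    by move=> a _; rewrite (normc_frame_factor weightP).
  rewrite -expR_sum; congr expR; rewrite sumrN exchange_big; congr (- _).
  by apply: eq_bigr => l _; rewrite mulr_suml.
move=> ga p OTga Hp; apply: wedge_pow_scale => T.
exact: fundamental_form_act.
Qed.

(** The constant phase is what matters: divided by it, a diagonal coefficient is a positive real, so
    no cancellation can occur in its means. *)
Lemma wedge_pow_diag (I : {set 'I_n}) p : HsCt p -> #|I| = k ->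
  exists2 D : R[i], 0 < D & Omega (join_set I I) p = det_const k * 'i ^+ k * D.
Proof.
move=> Hp kI; have [e he <-] := increasing_enum kI.
exists (\det (\matrix_(i, j) levi (g p) (e i) (e j))).
  apply: det_levi_gt0; [exact: g_herm|exact: increasing_inj he].
rewrite -/(mono_set e e) /Omega (wedge_pow_det (h := fun i j => 'i * levi (g p) i j)) //.
- rewrite -mulrA; congr (_ * _); rewrite -detZ; congr (\det _).
  by apply/matrixP => i j; rewrite !mxE.
- by move=> i j; exact: fundamental_form_LR.
- by move=> S SN; exact: fundamental_form_eq0.
Qed.

Context (ddbar0 : forall S p, HsCt p -> del (delbar Omega) S p = 0).

(* On averages in the coordinates log y, the derivative E_i Ebar_j of the
   coefficient of index (I :\ i, J :\ j) acts as multiplication by kappa / 4. *)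
Definition kappa (I J : {set 'I_n}) (i j : 'I_n) : R :=
  let e := set_weight (join_set (I :\ i) (J :\ j)) in
  expo (shift_weight weight e j) i * expo e j.

Lemma set_weightD1 S a : a \in S ->
  set_weight S = shift_weight weight (set_weight (S :\ a)) (place a).
Proof.
move=> aS; apply/funext => l.
by rewrite /set_weight /shift_weight (big_setD1 a aS) addrC.
Qed.

Lemma sum_join_setL (I J : {set 'I_n}) (F : idx -> R[i]) :
  \sum_(a in join_set I J | (a < n)%N) F a = \sum_(i in I) F (lshift n i).
Proof.
rewrite big_split_ord /= [X in _ + X]big1 ?addr0; last first.
  by move=> j /andP[_]; rewrite ltnNge leq_addr.
by apply: eq_bigl => i; rewrite in_join_setL ltn_ord andbT.
Qed.

Lemma sum_join_setR (I J : {set 'I_n}) (F : idx -> R[i]) :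
  \sum_(a in join_set I J | (n <= a)%N) F a = \sum_(j in J) F (rshift n j).
Proof.
rewrite big_split_ord /= [X in X + _]big1 ?add0r; last first.
  by move=> i /andP[_]; rewrite leqNgt ltn_ord.
by apply: eq_bigl => j; rewrite in_join_setR leq_addr andbT.
Qed.

(** Averaging the component (I, J) of the equation leaves a signed sum of kappa/4 times means of
    coefficients of omega^k. If a single kappa may be nonzero and its coefficient is diagonal, that
    coefficient would be negligible after division by its monomial. But it has constant phase and a
    positive lower bound by co-compactness. *)
Lemma ddbar_test (I J : {set 'I_n}) (i0 j0 : 'I_n) : i0 \in I -> j0 \in J ->
  I :\ i0 = J :\ j0 -> #|I :\ i0| = k ->
  (forall i j, i \in I -> j \in J -> (i, j) <> (i0, j0) -> kappa I J i j = 0) ->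
  kappa I J i0 j0 = 0.
Proof.
move=> iI jJ eIJ kI H0; apply: contrapT => /eqP kap0.
pose S := join_set I J; pose e := set_weight S.
pose sg i j := frame_sgn S (lshift n i) * frame_sgn (S :\ lshift n i) (rshift n j) : R[i].
pose T i j := join_set (I :\ i) (J :\ j).
(* The weight of each term is that of the whole index set, whichever pair (i, j) is differentiated;
   one monomial therefore normalises the entire sum. *)
have eT i j : i \in I -> j \in J ->
    e = shift_weight weight (shift_weight weight (set_weight (T i j)) (place (rshift n j))) (place (lshift n i)).
  move=> iI' jJ'; rewrite /e /S (@set_weightD1 _ (lshift n i)) ?in_join_setL //.
  by rewrite join_setD1L (@set_weightD1 _ (rshift n j)) ?in_join_setR // join_setD1R.
pose f i j := fun v : V => cpull e (frame_derive (lshift n i) (frame_derive (rshift n j) (Omega (T i j)))) v.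
have sum0 v : \sum_(i in I) \sum_(j in J) sg i j * f i j v = 0.
  have := ddbar0 S (exp_chart_HsCt v).
  rewrite (del_delbarE _ (@open_HsCt R s t) (exp_chart_HsCt v)); last first.
    by move=> T'; exact: (equivariant_wedge_pow T').1.
  rewrite sum_join_setL => h.
  rewrite -[RHS](mulr0 (expR (- \sum_j e j * v.2 0 (lshift t j)))%:C%C) -[in RHS]h mulr_sumr.
  apply: eq_bigr => i _; rewrite /S join_setD1L sum_join_setR mulr_sumr.
  apply: eq_bigr => j _; rewrite join_setD1R /f /cpull /sg /S join_setD1L.
  by move: (frame_derive _ _ _) => x; rewrite mulrCA.
have neg i j : i \in I -> j \in J ->
    cnegligible (fun v => f i j v - (kappa I J i j / 4)%:C%C * cpull (set_weight (T i j)) (Omega (T i j)) v).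
  move=> iI' jJ'.
  have := cnegligible_frame_derive2 Hemb Hadm weight_real weightP (lshift n i) (rshift n j)
    (equivariant_wedge_pow (T i j)).
  rewrite -(eT i j iI' jJ') !placeL !placeR /frame_sign split_lshift split_rshift.
  apply: cnegligible_ext => v; rewrite /f; congr (_ + _); rewrite -mulNr; congr (_ * _).
  rewrite -rmorphN; congr (_%:C)%C; by rewrite /kappa /T; field.
have main : cnegligible (fun v => sg i0 j0 * ((kappa I J i0 j0 / 4)%:C%C *
    cpull (set_weight (T i0 j0)) (Omega (T i0 j0)) v)).
  have : cnegligible (fun v => \sum_(i in I) \sum_(j in J) (- sg i j) * (f i j v -
      (kappa I J i j / 4)%:C%C * cpull (set_weight (T i j)) (Omega (T i j)) v)).
    apply: (@cnegligible_sum R s t _ _ (fun i => i \in I) (fun i v =>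
      \sum_(j in J) (- sg i j) * (f i j v -
      (kappa I J i j / 4)%:C%C * cpull (set_weight (T i j)) (Omega (T i j)) v))) => x xI.
    apply: (@cnegligible_sum R s t _ _ (fun j => j \in J) (fun j v =>
      (- sg x j) * (f x j v -
      (kappa I J x j / 4)%:C%C * cpull (set_weight (T x j)) (Omega (T x j)) v))) => y yJ.
    by apply: cnegligibleZ; exact: neg.
  apply: cnegligible_ext => v.
  have -> : \sum_(i in I) \sum_(j in J) (- sg i j) * (f i j v - (kappa I J i j / 4)%:C%C *
       cpull (set_weight (T i j)) (Omega (T i j)) v) =
     \sum_(i in I) \sum_(j in J) sg i j * ((kappa I J i j / 4)%:C%C *
       cpull (set_weight (T i j)) (Omega (T i j)) v) -
     \sum_(i in I) \sum_(j in J) sg i j * f i j v.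
    rewrite -sumrB; apply: eq_bigr => i _; rewrite -sumrB; apply: eq_bigr => j _.
    by rewrite mulNr mulrBr opprB.
  rewrite sum0 subr0 (bigD1 i0) //= (bigD1 j0) //= -addrA -[RHS]addr0; congr (_ + _).
  rewrite big1 ?add0r; last first.
    move=> j /andP[jJ' jj]; rewrite H0 //; first by rewrite mul0r rmorph0 mul0r mulr0.
    by case=> /eqP; rewrite (negPf jj).
  apply: big1 => i /andP[iI' ii]; apply: big1 => j jJ'.
  rewrite H0 //; first by rewrite mul0r rmorph0 mul0r mulr0.
  by case=> /eqP; rewrite (negPf ii).
have eT0 : T i0 j0 = join_set (I :\ i0) (I :\ i0) by rewrite /T eIJ.
pose cst := det_const k * 'i ^+ k : R[i].
have cst0 : cst != 0 by rewrite mulf_neq0 ?det_const_neq0 // expf_neq0 // neq0Ci.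
have Opos p : HsCt p -> exists2 D : R, 0 < D & Omega (T i0 j0) p = cst * D%:C%C.
  move=> Hp; rewrite eT0; have [D D0 ->] := wedge_pow_diag Hp kI.
  exists (complex.Re D); first by move: D0; rewrite ltcE => /andP[].
  congr (_ * _); move: D0; rewrite ltcE => /andP[/eqP]; case: (D) => x y /= -> _.
  by [].
have Oneq0 p : HsCt p -> Omega (T i0 j0) p != 0.
  by move=> /Opos[D D0 ->]; rewrite mulf_neq0 // eq_complex /= negb_and gt_eqF.
have [d d0 Hd] := equivariant_lower Hemb Hadm (equivariant_wedge_pow (T i0 j0)) Oneq0.
(* Dividing by sign, kappa and phase, which are all nonzero, leaves a positive real function; its
   real part alone gives the contradiction. *)
have [N _] := cnegligibleZ ((sg i0 j0 * (kappa I J i0 j0 / 4)%:C%C * cst)^-1) main.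
have cstn : 0 < normc cst.
  rewrite lt_neqAle normc_nneg andbT eq_sym; apply/eqP => /eq0_normc h.
  by rewrite h eqxx in cst0.
apply: (not_negligible_pos (d := d / normc cst) _ _ N); first by rewrite divr_gt0.
move=> v.
have [D D0 eO] := Opos _ (exp_chart_HsCt v).
have := Hd _ (exp_chart_HsCt v); rewrite height_exp_chart eO normcM.
rewrite [normc D%:C%C](_ : _ = D); last by rewrite /= expr0n addr0 sqrtr_sqr gtr0_norm.
move=> hD.
have -> : complex.Re ((sg i0 j0 * (kappa I J i0 j0 / 4)%:C%C * cst)^-1 *
   (sg i0 j0 * ((kappa I J i0 j0 / 4)%:C%C * cpull (set_weight (T i0 j0)) (Omega (T i0 j0)) v))) =
   expR (- \sum_l set_weight (T i0 j0) l * v.2 0 (lshift t l)) * D.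
  rewrite /cpull eO.
  set x := sg i0 j0; set y := (kappa I J i0 j0 / 4)%:C%C.
  have x0 : x != 0 by rewrite mulf_neq0 ?frame_sgn_neq0.
  have y0 : y != 0 by rewrite /y eq_complex /= negb_and mulf_neq0 // invr_eq0 pnatr_eq0.
  have xyc : x * y * cst != 0 by apply: mulf_neq0 => //; exact: mulf_neq0.
  have ringE (a1 a2 : R[i]) : (x * y * cst)^-1 * (x * (y * (a1 * (cst * a2)))) = a1 * a2.
    have -> : x * (y * (a1 * (cst * a2))) = (x * y * cst) * (a1 * a2) by ring.
    by rewrite mulKf.
  by rewrite ringE -rmorphM.
rewrite ler_pdivrMr // expRN -mulrA [D * _]mulrC [leRHS]mulrC.
by rewrite ler_pdivlMr ?expR_gt0.
Qed.

End InvariantMetric.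

(** * From a metric on the quotient to an invariant metric on H^s x C^t *)

Section GlobalMetric.
Import finmap.
Local Open Scope classical_set_scope.
Local Open Scope ring_scope.
Context {R : realType} {s t : nat} {K : fieldExtType rat}.
Context (sigma : 'I_(s + t + t) -> {rmorphism K -> R[i]}) (U : set K).
Context (Hemb : labelled_embeddings sigma) (Hadm : admissible sigma U).
Context (s_gt0 : (0 < s)%N).
Local Notation n := (s + t)%N.
Local Notation V := (Cn R n).
Local Notation HsCt := (@HsCt R s t).
Local Notation OTg := (OT_group U).
Implicit Types (p q v w : V) (A B : set V).

Lemma compact_nbhs_HsCt p : HsCt p -> exists2 C : set V, compact C &
  C `<=` HsCt /\ nbhs p C.
Proof.
(* Half of y_j as lower end keeps the box inside the upper half-planes. *)
move=> Hp; pose lo i := match fintype.split i with inl _ => p.2 0 i / 2 | inr _ => p.2 0 i - 1 end.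
have lo_lt i : lo i < p.2 0 i.
  rewrite /lo; case: (fintype.splitP i) => j ij; last by rewrite ltrBlDr ltrDl.
  have -> : i = lshift t j by apply: val_inj.
  have h : 0 < p.2 0 (lshift t j) := Hp j; lra.
pose C1 := [set y : 'rV[R]_n | forall i, `[p.1 0 i - 1, p.1 0 i + 1]%classic (y ord0 i)].
pose C2 := [set y : 'rV[R]_n | forall i, `[lo i, p.2 0 i + 1]%classic (y ord0 i)].
exists (C1 `*` C2).
  apply: compact_setX.
    apply: (@rV_compact R n (fun i => `[p.1 0 i - 1, p.1 0 i + 1]%classic)) => i.
    exact: segment_compact.
  apply: (@rV_compact R n (fun i => `[lo i, p.2 0 i + 1]%classic)) => i.
  exact: segment_compact.
split.
  move=> q [_ C2q] j; have /= := C2q (lshift t j).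
  rewrite in_itv /= /lo split_lshift => /andP[h _].
  apply: lt_le_trans h; rewrite divr_gt0 //; exact: Hp.
have N1 : forall i, nbhs p [set q : V | `[p.1 0 i - 1, p.1 0 i + 1]%classic (q.1 0 i)].
  move=> i; apply: (@continuous_coord1 R n i p [set y | y \in `[p.1 0 i - 1, p.1 0 i + 1]]).
  near=> y; rewrite /= in_itv /=; apply/andP; split; apply: ltW; near: y.
    by apply: lt_nbhsr; rewrite ltrBlDr ltrDl.
  by apply: lt_nbhsl; rewrite ltrDl.
have N2 : forall i, nbhs p [set q : V | `[lo i, p.2 0 i + 1]%classic (q.2 0 i)].
  move=> i; apply: (@continuous_coord2 R n i p [set y | y \in `[lo i, p.2 0 i + 1]]).
  near=> y; rewrite /= in_itv /=; apply/andP; split; apply: ltW; near: y.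
    exact: lt_nbhsr.
  by apply: lt_nbhsl; rewrite ltrDl.
have M1 := filter_forall _ N1; have M2 := filter_forall _ N2.
near=> q; split.
  near: q; exact: M1.
near: q; exact: M2.
Unshelve. all: by end_near.
Qed.

Lemma act1 p : act sigma (0, 1) p = p.
Proof.
apply: eq_Cn => j; rewrite /act /of_coords /= !mxE /emb rmorph1 rmorph0 mul1r addr0 /zcoord /=;
by [].
Qed.

Lemma dact1 v : dact sigma (0, 1) v = v.
Proof.
by apply: eq_Cn => j; rewrite /dact /of_coords /= !mxE /emb rmorph1 mul1r /zcoord.
Qed.

Lemma OT_group1 : OTg (0, 1).
Proof. by split; [exact: (@mxpoly.integral0 int K intr)|exact: adm_one Hadm]. Qed.

(** One real place decides: y_j is positive and is multiplied by sigma_j(u), so sigma_j(u) = 1 and u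
    = 1; then sigma_j(a) = 0. This is where s > 0 enters. *)
Lemma act_free ga p : OTg ga -> HsCt p -> act sigma ga p = p -> ga = (0, 1).
Proof.
case: ga => a u OTga Hp e; pose j0 := Ordinal s_gt0.
have pj : 0 < p.2 0 (lshift t j0) := Hp j0.
have := act_im Hemb (a, u) p j0; rewrite e /= => /esym/eqP.
rewrite -subr_eq0 -{2}[p.2 0 _]mul1r -mulrBl mulf_eq0 (gt_eqF pj) orbF subr_eq0 => /eqP r1.
have u1 : u = 1.
  apply: (fmorph_inj (sigma (lshift t (lshift t j0)))).
  by rewrite rmorph1 -[LHS]/(emb sigma (lshift t j0) u) (emb_rsig Hemb) r1.
congr (_, _) => //; apply: (fmorph_inj (sigma (lshift t (lshift t j0)))).
rewrite rmorph0 -[LHS]/(emb sigma (lshift t j0) a).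
have := congr1 (fun q : V => zcoord q (lshift t j0)) e.
rewrite /act zcoord_of_coords /= u1 {1}/emb rmorph1 mul1r => /eqP.
by rewrite -subr_eq0 addrAC subrr add0r => /eqP.
Qed.

(** Some real coordinate [c] distinguishes [p] from its image; on [W] both [c] and its composite
    with the action vary by less than half of the gap. *)
Lemma act_separates ga p : act sigma ga p <> p ->
  exists2 W : set V, nbhs p W & forall q q', W q -> W q' -> act sigma ga q <> q'.
Proof.
move=> np.
have [c [cc cac e]] : exists c : V -> R, [/\ {for p, continuous c},
    {for p, continuous (fun q => c (act sigma ga q))} & c (act sigma ga p) <> c p].
  apply: contrapT => /forallNP H; apply: np; apply: eq_Cn => j.
    have := H (fun q => q.1 0 j); apply: contra_notP => h; split => //.
      exact: continuous_coord1.
    have -> : (fun q => (act sigma ga q).1 0 j) = (fun q : V =>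
       complex.Re (emb sigma j ga.2) * q.1 0 j + - complex.Im (emb sigma j ga.2) * q.2 0 j
       + complex.Re (emb sigma j ga.1)).
      apply/funext => q; rewrite /act /of_coords /= mxE /zcoord.
      by case: (emb _ _ _) (emb _ _ _) => a1 a2 [b1 b2] /=; ring.
    apply: continuousD; last exact: cst_continuous.
    apply: continuousD; apply: continuousM; try exact: cst_continuous.
      exact: continuous_coord1.
    exact: continuous_coord2.
  have := H (fun q => q.2 0 j); apply: contra_notP => h; split => //.
    exact: continuous_coord2.
  have -> : (fun q => (act sigma ga q).2 0 j) = (fun q : V =>
     complex.Im (emb sigma j ga.2) * q.1 0 j + complex.Re (emb sigma j ga.2) * q.2 0 j
     + complex.Im (emb sigma j ga.1)).
    apply/funext => q; rewrite /act /of_coords /= mxE /zcoord.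
    by case: (emb _ _ _) (emb _ _ _) => a1 a2 [b1 b2] /=; ring.
  apply: continuousD; last exact: cst_continuous.
  apply: continuousD; apply: continuousM; try exact: cst_continuous.
    exact: continuous_coord1.
  exact: continuous_coord2.
pose d := `|c (act sigma ga p) - c p|.
have d0 : 0 < d by rewrite normr_gt0 subr_eq0; apply/eqP.
have d2 : 0 < d / 2 by rewrite divr_gt0.
exists [set q | `|c p - c q| < d / 2 /\ `|c (act sigma ga p) - c (act sigma ga q)| < d / 2].
  near=> q; split; near: q.
    by move/cvgrPdist_lt: cc; apply.
  by move/cvgrPdist_lt: cac; apply.
move=> q q' [_ h1] [h2 _] eq'; rewrite eq' in h1.
have := ler_distD (c q') (c (act sigma ga p)) (c p); rewrite -/d distrC [X in _ + X]distrC.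
rewrite distrC in h1; rewrite distrC [X in _ + X]distrC.
by move=> h; move: h; apply/negP; rewrite -ltNge [ltRHS]splitr ltrD // distrC.
Unshelve. all: by end_near.
Qed.

(** By proper discontinuity only finitely many group elements bring a point of the compact
    neighbourhood [C] back into [C]. Each nontrivial one among them moves [p], so a smaller
    neighbourhood is disjoint from its image; finitely many such neighbourhoods are intersected. *)
Lemma OT_chart_exists p : HsCt p -> exists A, OT_chart sigma U A /\ A p.
Proof.
move=> Hp; have [C cC [CH nC]] := compact_nbhs_HsCt Hp.
have /finite_fsetP[X eX] := adm_discontinuous Hadm cC CH.
have W ga : exists W : set V, nbhs p W /\ forall q q', W q -> W q' -> ga <> (0, 1) ->
    OTg ga -> act sigma ga q <> q'.
  have [->|/eqP ga1] := eqVneq ga (0, 1); first by exists setT; split => //; exact: filterT.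
  have [OTga|OTga] := pselect (OTg ga); last by exists setT; split => //; exact: filterT.
  have [W nW HW] : exists2 W : set V, nbhs p W & forall q q', W q -> W q' -> act sigma ga q <> q'.
    by apply: act_separates => e; apply: ga1; exact: act_free e.
  by exists W; split => // q q' *; exact: HW.
have [Wf HW] := choice W.
pose N := [set q | C q /\ forall ga, [set` X] ga -> Wf ga q].
have nN : nbhs p N.
  apply: filterI => //.
  by apply: filter_bigI => ga _; case: (HW ga).
exists N^°; split; last exact: nN.
split; first exact: open_interior.
  by move=> q /interior_subset [Cq _]; exact: CH.
move=> q q' /interior_subset [Cq Wq] /interior_subset [Cq' Wq'] e.
have : OT_proj sigma U q' q' by exists (0, 1); [exact: OT_group1|exact: act1].
rewrite -e => -[ga OTga eq'].
have gaX : [set` X] ga.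
  by rewrite -eX; split => //; exists q => //; rewrite eq'.
have [ga1|/eqP ga1] := eqVneq ga (0, 1); first by rewrite -eq' ga1 act1.
by have [_ /(_ q q' (Wq _ gaX) (Wq' _ gaX) ga1 OTga)] := HW ga.
Qed.

Context (g : set V -> V -> V -> V -> R) (Hg : hermitian_metric sigma U g).

(** An arbitrary choice; the transition rule for the identity element makes the resulting metric
    independent of it. *)
Definition chart_at p : set V := xget set0 [set A | OT_chart sigma U A /\ A p].

Lemma chart_atP p : HsCt p -> OT_chart sigma U (chart_at p) /\ chart_at p p.
Proof. by move=> /OT_chart_exists h; exact: (xgetPex set0 h). Qed.

Definition global_metric p v w : R := g (chart_at p) p v w.

Lemma global_metricE A p : OT_chart sigma U A -> A p ->
  forall v w, global_metric p v w = g A p v w.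
Proof.
move=> cA Ap v w; have Hp : HsCt p by case: cA => _ + _; apply.
have [cB Bp] := chart_atP Hp.
have Ap' : A (act sigma (0, 1) p) by rewrite act1.
by have := metric_transition Hg cB cA OT_group1 Bp Ap' v w; rewrite act1 !dact1.
Qed.

Lemma global_metric_smooth v w : smooth_on HsCt (fun p => global_metric p v w).
Proof.
move=> m; apply: diff_class_local; first exact: open_HsCt.
move=> p Hp; have [A [cA Ap]] := OT_chart_exists Hp.
exists A; split => //; first by case: cA.
apply: diff_class_ext (metric_smooth Hg cA v w m); first by case: cA.
by move=> q /set_mem Aq; rewrite (global_metricE cA Aq).
Qed.

Lemma global_metric_herm p : HsCt p -> hermitian_product (global_metric p).
Proof. by move=> Hp; have [cB Bp] := chart_atP Hp; exact: metric_herm Hg _ cB _ Bp. Qed.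

Lemma global_metric_act ga p : OTg ga -> HsCt p -> forall v w,
  global_metric p v w = global_metric (act sigma ga p) (dact sigma ga v) (dact sigma ga w).
Proof.
move=> OTga Hp v w; have [cA Ap] := chart_atP Hp.
have [cB Bp] := chart_atP (act_HsCt Hemb Hadm OTga Hp).
rewrite /global_metric; exact: (metric_transition Hg cA cB OTga Ap Bp v w).
Qed.

Lemma del_delbar_local A (alpha beta : dform R n) p : open A -> A p ->
  (forall S q, A q -> alpha S q = beta S q) ->
  forall S, del (delbar alpha) S p = del (delbar beta) S p.
Proof.
move=> oA Ap e.
have local1 P S q : A q -> partial_d P alpha S q = partial_d P beta S q.
  move=> Aq; apply: eq_bigr => c _.
  have h : frame_derive c (alpha (S :\ c)%SET) q = frame_derive c (beta (S :\ c)%SET) q.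
    by apply: (frame_derive_local _ oA _ Aq) => r /set_mem Ar; exact: e.
  by rewrite h.
move=> S; apply: eq_bigr => a _.
have h : frame_derive a (delbar alpha (S :\ a)%SET) p = frame_derive a (delbar beta (S :\ a)%SET) p.
  by apply: (frame_derive_local _ oA _ Ap) => q /set_mem Aq; exact: local1.
by rewrite h.
Qed.

Lemma global_metric_ddbar k : ddbar_pow_closed sigma U g k -> forall S p, HsCt p ->
  del (delbar (wedge_pow k (fundamental_form global_metric))) S p = 0.
Proof.
move=> Hk S p Hp; have [A [cA Ap]] := OT_chart_exists Hp.
rewrite -(Hk A cA S p Ap); apply: (@del_delbar_local A) => //; first by case: cA.
move=> T q Aq; apply: wedge_pow_local => T'.
rewrite /fundamental_form /two_form; apply: eq_bigr => a _; apply: eq_bigr => c _.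
by rewrite /frame_val !(global_metricE cA Aq).
Qed.

End GlobalMetric.

(** * Exponents of the complex places *)

Section UnitLattice.
Context {R : realType} {s t : nat} {K : fieldExtType rat}.
Context (sigma : 'I_(s + t + t) -> {rmorphism K -> R[i]}) (U : set K).
Context (Hemb : labelled_embeddings sigma) (Hadm : admissible sigma U).
Local Notation n := (s + t)%N.
Local Notation HsCt := (@HsCt R s t).

Lemma U_neq0 u : U u -> u != 0.
Proof. by move=> /(adm_unit Hadm)[]. Qed.

Lemma normc_sigma_gt0 x u : U u -> 0 < normc (sigma x u).
Proof.
move=> Uu; rewrite lt_neqAle normc_nneg andbT eq_sym; apply/eqP => /eq0_normc /eqP.
by rewrite fmorph_eq0 (negPf (U_neq0 Uu)).
Qed.

Lemma lnsigM j x y : U x -> U y -> lnsig sigma j (x * y) = lnsig sigma j x + lnsig sigma j y.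
Proof.
by move=> Ux Uy; rewrite /emb /lnsig (rsigM Hemb) lnM // posrE (rsig_gt0 Hemb Hadm).
Qed.

Lemma U_exprn x m : U x -> U (x ^+ m).
Proof.
move=> Ux; elim: m => [|m IH]; first by rewrite expr0; exact: adm_one Hadm.
by rewrite exprS; apply: (adm_mul Hadm) => //.
Qed.

Lemma U_exprz x (m : int) : U x -> U (x ^ m).
Proof.
by move=> Ux; case: m => m /=; [|apply: (adm_inv Hadm)]; exact: U_exprn.
Qed.

Lemma U_prod (I : Type) (r : seq I) (F : I -> K) : (forall i, U (F i)) -> U (\prod_(i <- r) F i).
Proof.
move=> H; apply: (big_ind U) => //; first exact: adm_one Hadm.
by move=> x y; move=> *; apply: (adm_mul Hadm).
Qed.

(* On U a logarithm is determined by its values on s independent elements,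
   since every element of U depends on them. *)
Lemma additive_vanish (F : K -> R) (e : 'I_s -> K) :
  (forall x y, U x -> U y -> F (x * y) = F x + F y) ->
  (forall i, U (e i)) -> mult_independent e -> (forall i, F (e i) = 0) ->
  forall u, U u -> F u = 0.
Proof.
move=> FM Ue ie Fe u Uu.
have F1 : F 1 = 0.
  have := FM 1 1 (adm_one Hadm) (adm_one Hadm); rewrite mulr1; lra.
have FX x m : U x -> F (x ^+ m) = m%:R * F x.
  move=> Ux; elim: m => [|m IH]; first by rewrite expr0 F1 mul0r.
  by rewrite exprS FM ?IH //; [rewrite -natr1; ring|exact: U_exprn].
have FV x : U x -> F x^-1 = - F x.
  move=> Ux; have := FM _ _ Ux (adm_inv Hadm Ux).
  by rewrite mulfV ?U_neq0 // F1; lra.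
have FZ x (m : int) : U x -> F (x ^ m) = m%:~R * F x.
  move=> Ux; case: m => m; first by rewrite -[x ^ _]/(x ^+ m) FX // pmulrn.
  rewrite NegzE -invr_expz FV; last exact: U_exprn.
  by rewrite -[x ^ _]/(x ^+ m.+1) FX // mulrNz mulNr pmulrn.
have FP (I : Type) (r : seq I) (G : I -> K) : (forall i, U (G i)) ->
    F (\prod_(i <- r) G i) = \sum_(i <- r) F (G i).
  move=> UG; elim: r => [|i r IH]; first by rewrite !big_nil F1.
  by rewrite !big_cons FM ?IH //; exact: U_prod.
pose e' (i : 'I_s.+1) := if unlift ord0 i is Some j then e j else u.
have Ue' i : U (e' i) by rewrite /e'; case: (unlift _ _).
have [_ nI] := adm_rank Hadm.
have : ~ mult_independent e' by move=> ie'; apply: nI; exists e'.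
move=> /existsNP[m] /not_implyP[m1 /existsNP[i mi]].
rewrite big_ord_recl /e' unlift_none in m1.
have {}m1 : u ^ m ord0 * \prod_(j < s) e j ^ m (lift ord0 j) = 1.
  rewrite -[RHS]m1; congr (_ * _); apply: eq_bigr => j _; by rewrite liftK.
have m0 : m ord0 != 0.
  apply/eqP => m0; move: m1; rewrite m0 expr0z mul1r => /(ie _) H.
  apply: mi; case: (unliftP ord0 i) => [j ->|-> //]; exact: H.
have := congr1 F m1; rewrite F1 FM; [|exact: U_exprz|by apply: U_prod => j; exact: U_exprz].
rewrite FP; last by move=> j; exact: U_exprz.
rewrite big1 ?addr0; last by move=> j _; rewrite FZ // Fe mulr0.
rewrite FZ // => /eqP; rewrite mulf_eq0 intr_eq0 (negPf m0) => /eqP; exact.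
Qed.

(** This is the spanning half of the lattice property. If [d] annihilates all logarithms of units,
    the constant 1 is equivariant of weight [d], hence bounded by a multiple of y^d, which can be
    made arbitrarily small unless [d] is 0. *)
Lemma lnsig_span (d : 'I_s -> R) :
  (forall u, U u -> \sum_l d l * lnsig sigma l u = 0) -> forall l, d l = 0.
Proof.
move=> H l0; apply/eqP; apply: contrapT => /negP d0.
have E : equivariant sigma U d (fun=> 1).
  split; first exact: csmooth_cst.
  exists (fun=> 1); split; last by move=> *; rewrite mulr1.
  by move=> u Uu; rewrite H // oppr0 expR0 normc1.
have [M HM] := equivariant_bounded Hemb Hadm E.
pose N := \sum_l d l ^+ 2.
have N0 : 0 < N.
  by rewrite /N (bigD1 l0) //= ltr_wpDr ?sumr_ge0 // => [i _|]; rewrite ?sqr_ge0 // exprn_even_gt0.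
(* At this point y^d equals exp(-|M|), so the bound reads 1 <= M exp(-|M|), against exp(|M|) >= 1 +
   |M|. *)
pose p : Cn R n := (0, \row_i match fintype.split i with
   inl l => expR (- (`|M| / N) * d l) | inr _ => 0 end).
have py l : p.2 0 (lshift t l) = expR (- (`|M| / N) * d l) by rewrite mxE split_lshift.
have Hp : HsCt p by move=> l; rewrite -[complex.Im _]/(p.2 0 (lshift t l)) py expR_gt0.
have := HM p Hp; rewrite normc1 /height.
rewrite (eq_bigr (fun l => (- (`|M| / N)) * d l ^+ 2)); last first.
  by move=> l _; rewrite py expRK; ring.
rewrite -mulr_sumr -/N mulNr divfK ?gt_eqF // => h.
have := expR_ge1Dx `|M|; have := expR_gt0 `|M|; have := ler_norm M.
move: h; rewrite expRN ler_pdivlMr ?expR_gt0 //; lra.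
Qed.

Lemma independent_units : exists2 e : 'I_s -> K, (forall i, U (e i)) & mult_independent e.
Proof. by have [[e [Ue ie]] _] := adm_rank Hadm; exists e. Qed.

(** On [s] independent units the matrix [L] of logarithms is invertible: a vector in its left kernel
    annihilates the logarithms of all units by [additive_vanish], so it is 0 by [lnsig_span].
    Solving a linear system gives [c] on these units, and [additive_vanish] extends the formula to
    [U]. *)
Lemma exponents_exist (F : K -> R) :
  (forall x y, U x -> U y -> F (x * y) = F x + F y) ->
  exists c : 'I_s -> R, forall u, U u -> F u = \sum_l c l * lnsig sigma l u.
Proof.
move=> FM; have [e Ue ie] := independent_units.
pose L : 'M[R]_s := \matrix_(j, l) lnsig sigma j (e l).
have Lu : row_free L.
  rewrite -kermx_eq0; apply/rowV0P => v /sub_kermxP vL.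
  apply/rowP => l; rewrite mxE; apply: (lnsig_span (d := fun l => v 0 l)).
  apply: (additive_vanish _ Ue ie).
    move=> x y Ux Uy; rewrite -big_split; apply: eq_bigr => j _.
    by rewrite lnsigM // mulrDr.
  move=> i; have /rowP/(_ i) := vL; rewrite !mxE => h; rewrite -[RHS]h.
  by apply: eq_bigr => j _; rewrite mxE.
have Lunit : L \in unitmx by rewrite -row_free_unit.
pose c := (\row_l F (e l)) *m invmx L.
exists (fun l => c 0 l) => u Uu; apply/eqP; rewrite -subr_eq0; apply/eqP.
apply: (additive_vanish (F := fun u => F u - \sum_l c 0 l * lnsig sigma l u) _ Ue ie) => //.
  move=> x y Ux Uy; rewrite FM // (eq_bigr (fun l => c 0 l * lnsig sigma l x + c 0 l * lnsig sigma l y)).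
    by rewrite big_split /=; ring.
  by move=> l _; rewrite lnsigM // mulrDr.
move=> i; have : c *m L = \row_l F (e l) by rewrite mulmxKV.
move=> /rowP/(_ i); rewrite !mxE => <-; apply/eqP; rewrite subr_eq0; apply/eqP.
by apply: eq_bigr => j _; rewrite !mxE.
Qed.

(** The logarithm of the squared modulus, that is, the joint contribution of a conjugate pair to the
    norm; [place_weight] halves its exponents accordingly. *)
Definition log_abs (i : 'I_t) (u : K) : R := 2 * ln (normc (emb sigma (rshift s i) u)).

Lemma log_absM i x y : U x -> U y -> log_abs i (x * y) = log_abs i x + log_abs i y.
Proof.
move=> Ux Uy; rewrite /log_abs {1}/emb rmorphM normcM lnM ?posrE ?normc_sigma_gt0 //.
by rewrite -mulrDr.
Qed.

Lemma complex_exponents : exists c : 'I_t -> 'I_s -> R,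
  forall i u, U u -> log_abs i u = - \sum_l c i l * lnsig sigma l u.
Proof.
have H i : exists c : 'I_s -> R, forall u, U u -> log_abs i u = - \sum_l c l * lnsig sigma l u.
  have [c Hc] := exponents_exist (log_absM i).
  exists (fun l => - c l) => u Uu; rewrite Hc // -sumrN.
  by apply: eq_bigr => l _; rewrite mulNr opprK.
have [c Hc] := choice H; by exists c.
Qed.

Definition place_weight (c : 'I_t -> 'I_s -> R) (j : 'I_n) (l : 'I_s) : R :=
  match fintype.split j with
  | inl j' => - (l == j')%:R
  | inr i => c i l / 2
  end.

Lemma place_weight_real c (j l : 'I_s) : place_weight c (lshift t j) l = - (l == j)%:R.
Proof. by rewrite /place_weight split_lshift. Qed.

Lemma place_weightP c : (forall i u, U u -> log_abs i u = - \sum_l c i l * lnsig sigma l u) ->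
  forall j u, U u ->
  normc (emb sigma j u) = expR (- \sum_l place_weight c j l * lnsig sigma l u).
Proof.
move=> Hc j u Uu; case: (fintype.splitP j) => i ij.
  have -> : j = lshift t i by apply: val_inj.
  rewrite (bigD1 i) //= big1 ?addr0 => [|l /negPf li]; last first.
    by rewrite place_weight_real li oppr0 mul0r.
  rewrite place_weight_real eqxx mulN1r opprK /lnsig lnK ?posrE ?(rsig_gt0 Hemb Hadm) //.
  rewrite (emb_rsig Hemb) /= expr0n addr0 sqrtr_sqr ger0_norm //.
  by apply: ltW; apply: rsig_gt0 Hemb Hadm _ _ _.
have -> : j = rshift s i by apply: val_inj.
rewrite (eq_bigr (fun l => 2^-1 * (c i l * lnsig sigma l u))); last first.
  by move=> l _; rewrite /place_weight split_rshift; ring.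
rewrite -mulr_sumr -mulrN -Hc // /log_abs mulKf // lnK // posrE.
exact: normc_sigma_gt0.
Qed.

End UnitLattice.

(** * Conjugates of algebraic numbers *)

Section ConjugatePolynomial.
Context {C : numClosedFieldType} {K : fieldExtType rat} {N : nat}.
Context (sigma : 'I_N -> {rmorphism K -> C}).
Context (sigma_inj : forall i j, sigma i =1 sigma j -> i = j).
Context (sigma_all : forall tau : {rmorphism K -> C}, exists i, tau =1 sigma i).
Local Notation toC := (map_poly (ratr : rat -> C)).
Local Notation toK := (map_poly (in_alg K)).

Lemma embedding_rat (tau : {rmorphism K -> C}) (q : rat) : tau (in_alg K q) = ratr q.
Proof.
pose f : {rmorphism rat -> C} := GRing.RMorphism.clone _ _ (tau \o in_alg K) _.
exact: (fmorph_eq_rat f q).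
Qed.

Lemma embedding_horner (tau : {rmorphism K -> C}) (q : {poly rat}) x :
  tau (toK q).[x] = (toC q).[tau x].
Proof.
rewrite -horner_map -map_poly_comp; congr (_.[_]).
by apply: eq_map_poly => y /=; exact: embedding_rat.
Qed.

Lemma primitive_element : exists theta : K, (forall x : K, exists q : {poly rat}, x = (toK q).[theta]) /\
  exists2 m : {poly rat}, m \is monic & toK m = minPoly 1 theta.
Proof.
pose theta := separable_generator 1 {:K}.
have e : fullv = <<1; theta>>%VS :> {vspace K}.
  apply: eq_adjoin_separable_generator; last exact: subvf.
  apply/separableP => y _; apply: pcharf0_separable => p.
  by rewrite (pchar_lalg K) pchar_num.
exists theta; split.
  move=> x; have : x \in <<1; theta>>%VS by rewrite -e memvf.
  move=> /Fadjoin_polyP[p /polyOver1P[q ->] ->]; by exists q.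
have /polyOver1P[m em] := minPolyOver 1 theta.
exists m => //; rewrite -(map_monic (in_alg K)) -em; exact: monic_minPoly.
Qed.

(** The polynomial is the characteristic polynomial of multiplication by [v] in the power basis of a
    primitive element [th]. Over C that matrix is conjugated by a Vandermonde matrix to the diagonal
    of the [sigma i v]. Completeness of the list of embeddings ensures that there are as many of
    them as basis elements. *)
Lemma conj_poly_exists (v : K) : exists chi : {poly rat}, toC chi = \prod_i ('X - (sigma i v)%:P).
Proof.
have [th [th_gen [m m_monic em]]] := primitive_element.
have ker q : (toK q).[th] = 0 -> m %| q.
  move=> q0; rewrite -(dvdp_map (in_alg K)) em; apply: minPoly_dvdp.
    exact: alg_polyOver.
  exact/rootP.
have mth : (toK m).[th] = 0 by rewrite em minPolyxx.
have emb_root z : root (toC m) z -> exists i, sigma i th = z.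
  move=> mz.
  (* The embedding sending [th] to [z] evaluates at [z] a polynomial representing the given element;
     this is well defined because two representatives differ by a multiple of [m], which vanishes at
     [z]. *)
  have kerz p q : (toK p).[th] = (toK q).[th] -> (toC p).[z] = (toC q).[z].
    move=> pq; apply/eqP; rewrite -subr_eq0 -hornerN -hornerD -rmorphN -rmorphD /=.
    have /ker mpq : (toK (p - q)).[th] = 0.
      by rewrite rmorphB hornerD hornerN pq subrr.
    by apply/eqP/rootP; apply: root_dvdp mz; rewrite dvdp_map.
  have [Q HQ] := choice th_gen.
  pose phi x := (toC (Q x)).[z].
  have phiE p : phi (toK p).[th] = (toC p).[z] by apply: kerz; rewrite -HQ.
  have phi_add : zmod_morphism phi.
    move=> x y; rewrite {1}(HQ x) {1}(HQ y) -hornerN -hornerD -rmorphB phiE.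
    by rewrite rmorphB hornerD hornerN.
  have phi_mul : monoid_morphism phi.
    split; last first.
      move=> x y; rewrite {1}(HQ x) {1}(HQ y) -hornerM -rmorphM phiE.
      by rewrite rmorphM hornerM.
    by rewrite -[1](hornerC 1 th) -[1%:P](rmorph1 toK) phiE rmorph1 hornerC.
  pose psi : {rmorphism K -> C} := HB.pack phi
    (GRing.isZmodMorphism.Build _ _ phi phi_add)
    (GRing.isMonoidMorphism.Build _ _ phi phi_mul).
  have [i Hi] := sigma_all psi; exists i; rewrite -Hi.
  rewrite [LHS](_ : _ = phi (toK 'X).[th]); last by rewrite map_polyX hornerX.
  by rewrite phiE map_polyX hornerX.
have th_inj i j : sigma i th = sigma j th -> i = j.
  move=> e; apply: sigma_inj => x; have [q ->] := th_gen x.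
  by rewrite !embedding_horner e.
pose rs := [seq sigma i th | i <- enum 'I_N].
have mC : toC m \is monic by rewrite map_monic.
have m_sep : separable_poly (toC m).
  rewrite separable_map -(separable_map (in_alg K)) em.
  apply: pcharf0_separable => p; by rewrite (pchar_lalg K) pchar_num.
have [r er] := closed_field_poly_normal (toC m).
rewrite (monicP mC) scale1r in er.
(* The roots of [m] are the images of [th], each simple and each attained once, so the degree of the
   field is [N]. *)
have size_m : size m = N.+1.
  have : perm_eq r rs.
    apply: uniq_perm.
    - by rewrite -separable_prod_XsubC -er.
    - by rewrite map_inj_uniq ?enum_uniq // => i j; exact: th_inj.
    move=> z; rewrite -root_prod_XsubC -er; apply/idP/mapP.
      by move=> /emb_root[i <-]; exists i; rewrite ?mem_enum.
    move=> [i _ ->]; apply/rootP; rewrite -embedding_horner mth rmorph0.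
    by [].
  move=> /perm_size; rewrite size_map size_enum_ord => <-.
  by rewrite -(size_map_poly (ratr : {rmorphism rat -> C})) er size_prod_XsubC.
have [g eg] := th_gen v.
(* The coefficients of [ra a] are the coordinates of [v * th ^+ a] in the power basis. *)
pose ra (a : nat) := (g * 'X^a) %% m.
have size_ra a : (size (ra a) <= N)%N.
  by rewrite -ltnS -size_m ltn_modp monic_neq0.
have raE a : (toK (ra a)).[th] = v * th ^+ a.
  have := divp_eq (g * 'X^a) m => /(congr1 (fun p => (toK p).[th])).
  rewrite rmorphD !rmorphM /= hornerD !hornerM mth mulr0 add0r map_polyXn hornerXn -eg.
  by move=> ->.
pose M : 'M[rat]_N := \matrix_(a, b) (ra a)`_b.
pose W : 'M[C]_N := \matrix_(b, i) sigma i th ^+ b.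
pose d : 'rV[C]_N := \row_i sigma i v.
have WE : W = Vandermonde N (\row_i sigma i th) by apply/matrixP => b i; rewrite !mxE.
have detW : \det W != 0.
  rewrite WE det_Vandermonde; apply/prodf_neq0 => i _; apply/prodf_neq0 => j ij.
  by rewrite !mxE subr_eq0; apply: contraTneq ij => /th_inj ->; rewrite ltnn.
have MW : map_mx ratr M *m W = W *m diag_mx d.
  rewrite mul_mx_diag; apply/matrixP => a i; rewrite !mxE.
  have -> : sigma i th ^+ a * sigma i v = (toC (ra a)).[sigma i th].
    by rewrite -embedding_horner raE rmorphM rmorphXn mulrC.
  rewrite (@horner_coef_wide _ N); last by rewrite size_map_poly.
  by apply: eq_bigr => b _; rewrite !mxE coef_map.
exists (char_poly M).
rewrite map_char_poly.
have detWP : \det (map_mx polyC W) != 0 by rewrite det_map_mx polyC_eq0.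
apply: (mulIf detWP); rewrite /char_poly -det_mulmx.
have -> : char_poly_mx (map_mx ratr M) *m map_mx polyC W =
    map_mx polyC W *m diag_mx (\row_i ('X - (sigma i v)%:P)).
  rewrite /char_poly_mx mulmxBl -map_mxM MW map_mxM -scalar_mxC -mulmxBr; congr (_ *m _).
  apply/matrixP => i j; rewrite !mxE.
  by case: eqVneq => [->|_]; rewrite ?mulr1n ?mulr0n ?mxE ?polyC0 ?subr0.
rewrite det_mulmx det_diag mulrC; congr (_ * _).
by apply: eq_bigr => i _; rewrite mxE.
Qed.

End ConjugatePolynomial.

(** The rational root argument: after clearing denominators the denominator divides a power of the
    numerator, to which it is coprime. *)
Lemma integral_rat (q : rat) : integralOver (intr : int -> rat) q -> q \is a Num.int.
Proof.
move=> [p p_monic /rootP pq].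
pose a := numq q; pose b := denq q; pose n := (size p).-1.
have b0 : b%:~R != 0 :> rat by rewrite intr_eq0 denq_neq0.
have qb : q * b%:~R = a%:~R by rewrite -{1}(divq_num_den q) divfK.
have sp : size p = n.+1 by rewrite prednK // lt0n size_poly_eq0 monic_neq0.
have lead : p`_n = 1 by move/monicP: p_monic; rewrite /lead_coef.
have main : a ^+ n = - (\sum_(i < n) p`_i * a ^+ i * b ^+ (n - i)).
  apply: (@intr_inj rat); apply/eqP; rewrite rmorphN -subr_eq0 opprK addrC.
  rewrite -[X in _ == X](mul0r (b%:~R ^+ n)) -pq horner_coef size_map_inj_poly //; last exact: intr_inj.
  rewrite sp big_ord_recr /= mulrDl coef_map lead /= mul1r -exprMn.
  rewrite qb rmorphXn; apply/eqP; congr (_ + _).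
  rewrite rmorph_sum mulr_suml; apply: eq_bigr => i _.
  rewrite coef_map !rmorphM !rmorphXn /= -!mulrA; congr (_ * _).
  by rewrite -qb exprMn -mulrA -exprD subnKC // ltnW.
have bdiv : (b %| a ^+ n)%Z.
  rewrite main rpredN; apply: rpred_sum => i _.
  rewrite -(subnSK (ltn_ord i)) exprS [b * _]mulrC mulrA; exact: dvdz_mull.
have b1 : (b %| 1)%Z.
  have cba : coprimez b (a ^+ n).
    by rewrite coprimezXr // coprimez_sym /coprimez; exact: coprime_num_den.
  by rewrite -(Gauss_dvdzr 1 cba) mulr1.
have bE : b = 1.
  have : (0 < b) by exact: denq_gt0.
  move: b1; rewrite dvdzE /= dvdn1 => /eqP; by case: (b) => // k /= ->.
by rewrite Qint_def -/b bE.
Qed.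

Section Conjugates.
Context {C : numClosedFieldType} {K : fieldExtType rat} {N : nat}.
Context (sigma : 'I_N -> {rmorphism K -> C}).
Context (sigma_inj : forall i j, sigma i =1 sigma j -> i = j).
Context (sigma_all : forall tau : {rmorphism K -> C}, exists i, tau =1 sigma i).
Local Notation toC := (map_poly (ratr : rat -> C)).
Local Notation toK := (map_poly (in_alg K)).

Lemma conj_poly_root (v : K) (chi : {poly rat}) z :
  toC chi = \prod_i ('X - (sigma i v)%:P) -> root (toC chi) z -> exists i, z = sigma i v.
Proof.
move=> ->; rewrite rootE horner_prod => /prodf_eq0[i _].
by rewrite hornerXsubC subr_eq0 => /eqP ->; exists i.
Qed.

Lemma toK_comp (i : 'I_N) (chi : {poly rat}) : map_poly (sigma i) (toK chi) = toC chi.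
Proof.
by rewrite -map_poly_comp; apply: eq_map_poly => y /=; exact: embedding_rat.
Qed.

Lemma conj_poly_root_iff (v : K) (chi : {poly rat}) i :
  toC chi = \prod_i ('X - (sigma i v)%:P) -> root (toC chi) (sigma i v).
Proof.
move=> ->; rewrite rootE horner_prod; apply/prodf_eq0; exists i => //.
by rewrite hornerXsubC subrr.
Qed.

(** The hypothesis says that [v^-1] is a root of the rational polynomial of the conjugates of [v].
    This is a statement inside K, so every embedding preserves it. *)
Lemma conjugates_inverse v : v != 0 -> (exists a b, sigma a v * sigma b v = 1) ->
  forall c, exists d, sigma c v * sigma d v = 1.
Proof.
move=> v0 [a [b ab]] c.
have [chi e] := conj_poly_exists sigma_inj sigma_all v.
have sv0 i : sigma i v != 0 by rewrite fmorph_eq0.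
have r1 : root (toK chi) v^-1.
  rewrite -(fmorph_root (sigma a)) toK_comp fmorphV.
  have -> : (sigma a v)^-1 = sigma b v by rewrite -[LHS]mulr1 -ab mulKf.
  exact: conj_poly_root_iff e.
have : root (toC chi) (sigma c v^-1) by rewrite -(toK_comp c) fmorph_root.
move=> /(conj_poly_root e)[d ed]; exists d.
by rewrite -ed fmorphV mulfV.
Qed.

(** The relation says that two polynomials have a common root: that of the conjugates of [w], and
    that of the conjugates of [w^-1] evaluated at [u] times the variable. Both have coefficients in
    K, and coprimality does not change under an embedding of K, so the relation passes from
    [sigma e] to [sigma l], at the price of losing control of [a] and [b]. *)
Lemma conjugates_relation u w : w != 0 ->
  (exists a b e, sigma a w * sigma b w * sigma e u = 1) ->
  forall l, exists a b, sigma a w * sigma b w * sigma l u = 1.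
Proof.
move=> w0 [a [b [e abe]]] l.
have [chi e1] := conj_poly_exists sigma_inj sigma_all w.
have [chi' e2] := conj_poly_exists sigma_inj sigma_all w^-1.
pose A := toK chi; pose B := toK chi' \Po (u *: 'X).
have mB i : map_poly (sigma i) B = toC chi' \Po (sigma i u *: 'X).
  by rewrite /B map_comp_poly toK_comp map_polyZ map_polyX.
have rB i z : root (map_poly (sigma i) B) z = root (toC chi') (sigma i u * z).
  by rewrite mB /root horner_comp hornerZ hornerX.
have sw0 i : sigma i w != 0 by rewrite fmorph_eq0.
have nc : ~~ coprimep A B.
  rewrite -(coprimep_map (sigma e)); apply/negP => cAB.
  have ra : root (map_poly (sigma e) A) (sigma a w).
    by rewrite toK_comp; exact: conj_poly_root_iff e1.
  have := coprimep_root cAB ra; apply/negP; rewrite negbK -rootE rB.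
  have -> : sigma e u * sigma a w = sigma b w^-1.
    rewrite fmorphV; apply: (mulIf (sw0 b)); rewrite mulVf // -abe; ring.
  exact: conj_poly_root_iff e2.
rewrite -(coprimep_map (sigma l)) /coprimep in nc.
have /closed_rootP[z] := nc; rewrite root_gcd => /andP[].
rewrite toK_comp => /(conj_poly_root e1)[a' ->]; rewrite rB => /(conj_poly_root e2)[b' eb].
exists a', b'; rewrite -mulrA mulrCA [_ * sigma l u]mulrC eb -rmorphM mulfV // rmorph1 //.
Qed.

Lemma conj_prod_rat v : exists q : rat, \prod_i sigma i v = ratr q.
Proof.
have [chi e] := conj_poly_exists sigma_inj sigma_all v.
exists ((-1) ^+ N * chi.[0]).
have -> : ratr ((-1) ^+ N * chi.[0]) = (-1) ^+ N * (toC chi).[0] :> C.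
  by rewrite rmorphM rmorphXn rmorphN1 -{1}(rmorph0 (ratr : {rmorphism rat -> C})) horner_map.
rewrite e horner_prod [X in _ * X](eq_bigr (fun i => - sigma i v)).
  by rewrite prodrN cardT size_enum_ord mulrA -expr2 sqrr_sign mul1r.
by move=> i _; rewrite hornerXsubC sub0r.
Qed.

Lemma integral_embedding (tau : {rmorphism K -> C}) v :
  integralOver (intr : int -> K) v -> integralOver (intr : int -> C) (tau v).
Proof.
move=> [p pm rp]; exists p => //.
have -> : map_poly intr p = map_poly tau (map_poly (intr : int -> K) p).
  by rewrite -map_poly_comp; apply: eq_map_poly => x /=; rewrite rmorph_int.
by rewrite fmorph_root.
Qed.

Lemma conj_prod_int v : integralOver (intr : int -> K) v ->
  exists z : int, \prod_i sigma i v = z%:~R.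
Proof.
move=> iv; have [q eq] := conj_prod_rat v.
have : integralOver (intr : int -> C) (ratr q).
  rewrite -eq; apply: big_ind => [|x y|i _].
  - exact: mxpoly.integral1.
  - exact: mxpoly.integral_mul.
  exact: integral_embedding.
move=> [p pm rp]; have : integralOver (intr : int -> rat) q.
  exists p => //; rewrite -(fmorph_root (ratr : {rmorphism rat -> C})) -map_poly_comp.
  rewrite (eq_map_poly (g := intr)) // => x /=; by rewrite rmorph_int.
move=> /integral_rat/intrP[z ez]; exists z; by rewrite eq ez ratr_int.
Qed.

Lemma norm_unit v : v != 0 -> integralOver (intr : int -> K) v ->
  integralOver (intr : int -> K) v^-1 -> `|\prod_i sigma i v| = 1.
Proof.
move=> v0 /conj_prod_int[z ez] /conj_prod_int[z' ez'].
have : (z * z')%:~R = 1 :> C.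
  rewrite rmorphM /= -ez -ez' -big_split /= big1 // => i _.
  by rewrite -rmorphM mulfV // rmorph1.
move=> /(intr_inj (x2 := 1)) /(congr1 absz); rewrite abszM => /eqP.
rewrite muln_eq1 => /andP[/eqP z1 _]; rewrite ez -intr_norm -abszE z1 //.
Qed.

End Conjugates.

(** * Subset sums *)

Section FiniteSubsets.
Import boot.fintype boot.finset.

Lemma subset_of_card (T : finType) (X : {set T}) m : (m <= #|X|)%N ->
  exists2 A : {set T}, A \subset X & #|A| = m.
Proof.
move=> mX; exists [set x in take m (enum X)].
  by apply/subsetP => x; rewrite inE => /mem_take; rewrite mem_enum.
rewrite cardsE; have /card_uniqP -> : uniq (take m (enum X)) by rewrite take_uniq ?enum_uniq.
by rewrite size_take -cardE; case: ltnP => // h; apply/eqP; rewrite eqn_leq mX h.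
Qed.

Lemma subset_between (T : finType) (X Y : {set T}) m : [disjoint X & Y] ->
  (#|X| <= m)%N -> (m + #|Y| <= #|T|)%N ->
  exists A : {set T}, [/\ X \subset A, [disjoint A & Y] & #|A| = m].
Proof.
move=> dXY Xm mY.
have [|A sA cA] := @subset_of_card T (~: (X :|: Y)) (m - #|X|).
  have := cardsC (X :|: Y); rewrite cardsU (disjoint_setI0 dXY) cards0; lia.
exists (X :|: A); split; first exact: subsetUl.
  rewrite disjoint_sym -setI_eq0 setIUr (disjoint_setI0 _) ?set0U; last by rewrite disjoint_sym.
  apply/eqP/setP => x; rewrite !inE; apply/negP => /andP[xY xA].
  by have := subsetP sA x xA; rewrite !inE xY orbT.
have dXA : X :&: A = set0.
  apply/setP => x; rewrite !inE; apply/negP => /andP[xX xA].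
  by have := subsetP sA x xA; rewrite !inE xX.
rewrite cardsU dXA cards0 cA; lia.
Qed.

End FiniteSubsets.

Section SubsetSums.
Import boot.fintype boot.finset.
Context {R : realFieldType} {t k : nat} (c : 'I_t -> R).
Context (k2 : (2 <= k)%N) (kt : (k < t)%N).
Context (total : \sum_i c i = 1).
Context (sums : forall I : {set 'I_t}, #|I| = k ->
  \sum_(i in I) c i = 0 \/ \sum_(i in I) c i = 1).

(** Exchange [i] for [j] in a set of [k] indices; room for the other [k - 1] is available since
    [k < t]. *)
Lemma subset_sums_diff i j : i != j -> [\/ c i - c j = -1, c i - c j = 0 | c i - c j = 1].
Proof.
move=> ij.
have [|||A [_ dA cA]] := @subset_between 'I_t set0 [set i; j] k.-1.
- by rewrite -setI_eq0 set0I.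
- by rewrite cards0.
- by rewrite cards2 ij card_ord; lia.
have iA : i \notin A.
  by apply/negP => iA; have := disjointFr dA iA; rewrite !inE eqxx.
have jA : j \notin A.
  by apply/negP => jA; have := disjointFr dA jA; rewrite !inE eqxx orbT.
have c1 : #|i |: A| = k by rewrite cardsU1 iA cA; lia.
have c2 : #|j |: A| = k by rewrite cardsU1 jA cA; lia.
have := sums c1; have := sums c2; rewrite !big_setU1 //=.
move: (\sum_(x in A) c x) => S.
move=> [h1|h1] [h2|h2].
- by constructor 2; lra.
- by constructor 3; lra.
- by constructor 1; lra.
- by constructor 2; lra.
Qed.

(** Comparison with the minimum [w] leaves only the values [w] and [w + 1]. With [p] indices of the
    larger value and [q] of the smaller one, all that remains is which numbers [x] of larger values
    a set of [k] indices may contain. *)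
Lemma subset_sums_classify : exists i0,
  (forall i, c i = (i == i0)%:R) \/
  (t = (2 * k)%N /\ forall i, c i = k%:R^-1 - (i == i0)%:R).
Proof.
have t0 : (0 < t)%N by lia.
pose im := [arg min_(i < Ordinal t0) c i]%O.
have [cmin Hmin] : exists im, forall i, c im <= c i.
  exists im; rewrite /im; case: arg_minP => // i _ h j; exact: h.
pose w := c cmin.
have [H two] : exists H : {set 'I_t}, forall i, c i = w + (i \in H)%:R.
  exists [set i | c i == w + 1] => i.
  rewrite inE; have [->|ne] := eqVneq i cmin.
    rewrite -/w; case: eqP => [|_]; rewrite ?addr0 // => h.
  have := Hmin i; rewrite -/w; case: eqP => [-> //|h].
  rewrite addr0; have := subset_sums_diff ne; rewrite -/w => -[] d; [lra|lra|by case: h; lra].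
have [p pE] : {p | p = #|H|} by exists #|H|.
have [q qE] : {q | q = #|~: H|} by exists #|~: H|.
have pq : (p + q)%N = t by rewrite pE qE cardsC card_ord.
have tot : t%:R * w + p%:R = 1.
  rewrite -[RHS]total (eq_bigr _ (fun i _ => two i)) big_split sumr_const card_ord mulr_natl.
  congr (_ + _); rewrite /= -natr_sum; congr (_%:R); rewrite pE -sum1_card big_mkcond.
  by apply: eq_bigr => i _; case: (i \in H).
have q0 : (0 < q)%N.
  rewrite qE card_gt0; apply/set0Pn; exists cmin; rewrite inE; apply/negP => h.
  have := two cmin; rewrite h -/w => /eqP.
  by rewrite eq_sym -subr_eq0 addrAC subrr add0r oner_eq0.
(* Take [x] indices in [H] and the other [k - x] outside it. *)
have feas x : (x <= p)%N -> (x <= k)%N -> (k <= x + q)%N ->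
    k%:R * w + x%:R = 0 \/ k%:R * w + x%:R = 1.
  move=> xp xk kxq.
  have [A sA cA] : exists2 A : {set 'I_t}, A \subset H & #|A| = x.
    by apply: subset_of_card; rewrite -pE.
  have [|B sB cB] := @subset_of_card _ (~: H) (k - x); first by rewrite -qE; lia.
  have dAB : A :&: B = set0.
    apply/setP => y; rewrite !inE; apply/negP => /andP[/(subsetP sA) yH /(subsetP sB)].
    by rewrite inE yH.
  have cAB : #|A :|: B| = k by rewrite cardsU dAB cards0 cA cB; lia.
  have <- : \sum_(i in A :|: B) c i = k%:R * w + x%:R; last exact: sums.
  rewrite (eq_bigr _ (fun i _ => two i)) big_split sumr_const cAB mulr_natl; congr (_ + _).
  rewrite (big_setID A) /= (eq_bigr (fun=> 1)); last first.
    by move=> i; rewrite !inE => /andP[_ iA]; rewrite (subsetP sA).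
  rewrite sumr_const [X in _ + X]big1 ?addr0; last first.
    move=> i; rewrite !inE => /andP[iA /orP[|/(subsetP sB)]]; first by rewrite (negPf iA).
    by rewrite inE => /negPf ->.
  by rewrite -cA; congr (_ %:R); apply: eq_card => i; rewrite !inE; case: (i \in A) => //=; rewrite andbF.
have kr : 0 < k%:R :> R by rewrite ltr0n; lia.
have tr : t%:R = p%:R + q%:R :> R by rewrite -natrD pq.
have [qk|kq] := ltnP q k; last first.
  have f0 := feas 0%N isT isT (ltac:(lia)).
  (* If all values were equal they would be 1/t, and k/t lies strictly between 0 and 1. *)
  have p0 : (0 < p)%N.
    rewrite lt0n; apply/eqP => p0; move: tot f0; rewrite p0 !addr0 => tw.
    have tk : k%:R < t%:R :> R by rewrite ltr_nat.
    have -> : k%:R * w = k%:R / t%:R by rewrite -[w](mulKf (x := t%:R)) ?tw ?mulr1 // pnatr_eq0; lia.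
    have h : 0 < k%:R / t%:R :> R by rewrite divr_gt0 // ltr0n; lia.
    have h1 : k%:R / t%:R < 1 :> R by rewrite ltr_pdivrMr ?mul1r // ltr0n; lia.
    lra.
  have f1 := feas 1%N p0 (ltac:(lia)) (ltac:(lia)).
  have w0 : w = 0.
    have kw : k%:R * w = 0 by lra.
    by move/eqP: kw; rewrite mulf_eq0 gt_eqF //= => /eqP.
  have p1 : p = 1%N by apply/eqP; rewrite -(eqr_nat R); apply/eqP; move: tot; rewrite w0; lra.
  have /cards1P[i0 Hi0] : #|H| == 1%N by rewrite -pE p1.
  by exists i0; left => i; rewrite two w0 add0r Hi0 inE.
have x0p : (k - q < p)%N by lia.
have f0 := feas (k - q)%N (ltnW x0p) (leq_subr _ _) (ltac:(lia)).
have f1 := feas (k - q).+1 x0p (ltac:(lia)) (ltac:(lia)).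
(* Consecutive values of [x] give consecutive sums, both in {0, 1}; so the first sum is 0. *)
have kw : k%:R * w = q%:R - k%:R.
  by move: f0 f1; rewrite -natr1 natrB ?(ltnW qk) //; lra.
have [q1|q1] := eqVneq q 1%N.
  have /cards1P[i0 Hi0] : #|~: H| == 1%N by rewrite -qE q1.
  have wE : w = k%:R^-1 - 1.
    by apply: (mulfI (lt0r_neq0 kr)); rewrite kw q1 mulrBr mulr1 divff // gt_eqF.
  (* Here w = 1/k - 1 and p = t - 1, so the total t w + p = 1 forces t = 2k. *)
  exists i0; right; split.
    apply/eqP; rewrite -(eqr_nat R) natrM; apply/eqP.
    have := congr1 ( *%R k%:R) tot; rewrite mulrDr mulrCA kw tr q1 mulr1; move=> h; nra.
  move=> i; rewrite two wE.
  have -> : (i \in H) = ~~ (i == i0) by rewrite -[i == i0]in_set1 -Hi0 inE negbK.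
  by case: (i == i0) => /=; lra.
(* A third consecutive [x] would produce the sum 2. Hence p = k - q + 1 and t = k + 1, and then the
   total gives q = k, against q < k. *)
have f2 : (p <= (k - q).+1)%N.
  rewrite leqNgt; apply/negP => pk.
  have := feas (k - q).+2 pk (ltac:(lia)) (ltac:(lia)).
  by move: f0 f1; rewrite -!natr1; lra.
have := congr1 ( *%R k%:R) tot; rewrite mulrDr mulrCA kw tr.
have -> : p%:R = k%:R - q%:R + 1 :> R by rewrite -natrB ?(ltnW qk) // natr1; congr (_%:R); lia.
have : q%:R < k%:R :> R by rewrite ltr_nat.
move=> h1 h2; exfalso.
have h3 : q%:R - k%:R = (k%:R - q%:R + 1 + q%:R) * (q%:R - k%:R) + k%:R * (k%:R - q%:R + 1) - k%:R * 1 :> R.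
  by ring.
by rewrite h2 subrr in h3; move/eqP: h3; rewrite subr_eq0 => /eqP h3; rewrite h3 ltxx in h1.
Qed.

End SubsetSums.

(** * The linear relations on the exponents *)

Section MixedSets.
Import boot.finset.
Context {R : realType} {s t : nat}.
Local Notation n := (s + t)%N.
Context (c : 'I_t -> 'I_s -> R).

Definition cplx_exponent (P : {set 'I_t}) (l : 'I_s) : R := \sum_(i in P) c i l.

Lemma sum_place_weight A P l : \sum_(x in join_set A P) place_weight c x l =
  cplx_exponent P l / 2 - (l \in A)%:R.
Proof.
rewrite sum_join_set addrC; congr (_ + _).
  rewrite /cplx_exponent mulr_suml; apply: eq_bigr => i _.
  by rewrite /place_weight split_rshift.
rewrite (eq_bigr (fun a => - (l == a)%:R)); last by move=> a _; rewrite place_weight_real.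
rewrite sumrN; congr (- _); case: (boolP (l \in A)) => lA.
  rewrite (big_setD1 l lA) eqxx /= big1 ?addr0 // => a.
  by rewrite in_setD1 eq_sym => /andP[/negPf ->].
by apply: big1 => a aA; case: eqP lA aA => // -> /negPf ->.
Qed.

Lemma set_weight_mixed A B P l :
  set_weight (place_weight c) (join_set (join_set A P) (join_set B P)) l =
  cplx_exponent P l - (l \in A)%:R - (l \in B)%:R.
Proof.
rewrite /set_weight.
have -> : \sum_(a in join_set (join_set A P) (join_set B P)) place_weight c (place a) l =
   \sum_(x in join_set A P) place_weight c x l + \sum_(x in join_set B P) place_weight c x l.
  rewrite big_split_ord /=; congr (_ + _).
    by apply: eq_big => x; rewrite ?in_join_setL // placeL.
  by apply: eq_big => x; rewrite ?in_join_setR // placeR.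
rewrite !sum_place_weight; by field.
Qed.

(** The factor [kappa] once [a] and [b] are removed from the index sets. For [a == b] the
    antiholomorphic derivative lowers the exponent by one before the holomorphic one acts; for
    distinct places a correction remains only if the place also occurs on the other side. *)
Definition kap (A B : {set 'I_s}) P (a b : 'I_s) : R :=
  if a == b then (cplx_exponent P a - 1) * cplx_exponent P a
  else (cplx_exponent P a - (a \in B)%:R) * (cplx_exponent P b - (b \in A)%:R).

Lemma kappa_mixed (A B : {set 'I_s}) (P : {set 'I_t}) a b : a \in A -> b \in B ->
  kappa (place_weight c) (join_set A P) (join_set B P) (lshift t a) (lshift t b) = kap A B P a b.
Proof.
move=> aA bB; rewrite /kappa !join_setD1L /expo !split_lshift /shift_weight.
rewrite place_weight_real !set_weight_mixed !in_setD1 !eqxx /= !subr0 /kap.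
have [->|ab] := eqVneq a b; first by rewrite /=; ring.
by rewrite /= !subr0.
Qed.

Lemma kappa_mixedR A B P x y i :
  x = rshift s i \/ y = rshift s i ->
  kappa (place_weight c) (join_set A P) (join_set B P) x y = 0.
Proof.
by rewrite /kappa /expo => -[] ->; rewrite split_rshift ?mul0r ?mulr0.
Qed.

End MixedSets.

Section Tests.
Import boot.finset.
Context {R : realType} {s t : nat} {K : fieldExtType rat}.
Context (sigma : 'I_(s + t + t) -> {rmorphism K -> R[i]}) (U : set K).
Context (Hemb : labelled_embeddings sigma) (Hadm : admissible sigma U).
Context (s_gt0 : (0 < s)%N).
Context (k : nat) (Hg : exists g, hermitian_metric sigma U g /\ ddbar_pow_closed sigma U g k).
Context (c : 'I_t -> 'I_s -> R).
Context (Hc : forall i u, U u -> log_abs sigma i u = - \sum_l c i l * lnsig sigma l u).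
Local Notation beta := (cplx_exponent c).
Local Notation kap := (kap c).

(** [ddbar_test] for index sets sharing the complex places [P]. Only pairs of real places have to be
    examined, since a derivative at a complex place has factor 0. *)
Lemma ddbar_test_mixed (A B : {set 'I_s}) (P : {set 'I_t}) a0 b0 : a0 \in A -> b0 \in B ->
  A :\ a0 = B :\ b0 -> (#|A :\ a0| + #|P|)%N = k ->
  (forall a b, a \in A -> b \in B -> (a, b) <> (a0, b0) -> kap A B P a b = 0) ->
  kap A B P a0 b0 = 0.
Proof.
move=> aA bB eAB cA H0; have [g [gm gd]] := Hg.
rewrite -(kappa_mixed c P aA bB).
apply: (ddbar_test Hemb Hadm (place_weight_real c) (place_weightP Hemb Hadm Hc)
  (global_metric_smooth Hemb Hadm s_gt0 gm) (global_metric_herm Hemb Hadm s_gt0 gm)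
  (global_metric_act Hemb Hadm s_gt0 gm) (global_metric_ddbar Hemb Hadm s_gt0 gm gd)).
- by rewrite in_join_setL.
- by rewrite in_join_setL.
- by rewrite !join_setD1L eAB.
- by rewrite join_setD1L card_join_set.
move=> x y xI yJ xy.
case: (fintype.splitP x) (fintype.splitP y) => a xa [] b yb.
- have ex : x = lshift t a by apply: val_inj.
  have ey : y = lshift t b by apply: val_inj.
  rewrite ex ey in xI yJ xy *; rewrite in_join_setL in xI; rewrite in_join_setL in yJ.
  by rewrite kappa_mixed // H0 // => -[ea eb]; apply: xy; rewrite ea eb.
- by have ey : y = rshift s b by [apply: val_inj]; apply: kappa_mixedR; right; exact: ey.
- by have ex : x = rshift s a by [apply: val_inj]; apply: kappa_mixedR; left; exact: ex.
- by have ey : y = rshift s b by [apply: val_inj]; apply: kappa_mixedR; right; exact: ey.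
Qed.

(** With a single real place on each side there is a single relevant pair, and its factor is
    quadratic. *)
Lemma beta_01 (P : {set 'I_t}) j : #|P| = k -> beta P j = 0 \/ beta P j = 1.
Proof.
move=> cP; have := @ddbar_test_mixed [set j] [set j] P j j.
rewrite !in_set1 eqxx setDv cards0 cP => /(_ isT isT erefl erefl).
rewrite /kap eqxx => h.
have /eqP : (beta P j - 1) * beta P j = 0.
  by apply: h => a b; rewrite !in_set1 => /eqP -> /eqP ->.
by rewrite mulf_eq0 subr_eq0 => /orP[]/eqP ->; [right|left].
Qed.

Lemma beta_mul0 (P : {set 'I_t}) j l : #|P| = k -> j != l -> beta P j * beta P l = 0.
Proof.
move=> cP jl; have := @ddbar_test_mixed [set j] [set l] P j l.
rewrite !in_set1 !eqxx !setDv cards0 cP => /(_ isT isT erefl erefl).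
rewrite /kap (negPf jl) !in_set1 (negPf jl) [l == j]eq_sym (negPf jl) !subr0.
by apply => a b; rewrite !in_set1 => /eqP -> /eqP ->.
Qed.

(** All pairs involving [j] contain the factor [beta P j - 1], so only the pair (l, l) is left. *)
Lemma beta_pair (P : {set 'I_t}) j l : (#|P|.+1)%N = k -> j != l -> beta P j = 1 ->
  (beta P l - 1) * beta P l = 0.
Proof.
move=> cP jl bj; have := @ddbar_test_mixed [set j; l] [set j; l] P l l.
rewrite !in_set2 eqxx orbT => /(_ isT isT erefl).
have -> : [set j; l] :\ l = [set j].
  apply/setP => x; rewrite !inE; have [->|] := eqVneq x l; last by rewrite orbF.
  by rewrite eq_sym (negPf jl).
rewrite cards1 add1n => /(_ cP).
rewrite /kap eqxx; apply => a b.
rewrite !in_set2 => /orP[] /eqP -> /orP[] /eqP ->; rewrite ?eqxx ?(negPf jl) ?orbT /=.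
- by rewrite bj subrr mul0r.
- by rewrite bj subrr mul0r.
- by rewrite eq_sym (negPf jl) bj subrr mulr0.
- by case.
Qed.

(** With all complex places in the index every [beta] is 1. The pair (j1, j2) has factor 1, whereas
    every other pair has a factor 1 - 1, since it is diagonal or one of its members lies in [C],
    hence in both sets. *)
Lemma beta_all (total : forall l, \sum_i c i l = 1) :
  (2 <= k)%N -> (t <= k)%N -> (k <= s + t - 2)%N -> False.
Proof.
move=> k2 tk ks.
have s2 : (2 <= s)%N by lia.
pose j1 : 'I_s := Ordinal (ltnW s2); pose j2 : 'I_s := Ordinal s2.
have j12 : j1 != j2 by [].
(* [C] has k - t real places besides [j1] and [j2]; this is where k <= s + t - 2 is used. *)
have [|||C [_ dC cC]] := @subset_between 'I_s finset.set0 [set j1; j2] (k - t).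
- by rewrite -setI_eq0 set0I.
- by rewrite cards0.
- by rewrite cards2 j12 card_ord; lia.
have b1 l : beta [set: 'I_t] l = 1.
  by rewrite -[RHS](total l) /cplx_exponent; apply: eq_bigl => i; rewrite in_setT.
have j1C : j1 \notin C.
  by apply/negP => h; have := disjointFr dC h; rewrite !inE eqxx.
have j2C : j2 \notin C.
  by apply/negP => h; have := disjointFr dC h; rewrite !inE eqxx orbT.
have := @ddbar_test_mixed (j1 |: C) (j2 |: C) [set: 'I_t] j1 j2.
rewrite !setU11 !setU1K // cC cardsT card_ord subnK // => /(_ isT isT erefl erefl).
rewrite /kap (negPf j12) !in_setU1 (negPf j12) [j2 == j1]eq_sym (negPf j12) (negPf j1C) (negPf j2C).
rewrite !b1 !subr0 mulr1 => h.
have /eqP : (1 : R) = 0; last by rewrite oner_eq0.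
apply: h => a b aA bB ab; rewrite !b1.
case: ifP => [_|ab']; first by rewrite subrr mul0r.
move: aA bB; rewrite !in_setU1 => /orP[/eqP ea|aC] /orP[/eqP eb|bC].
- by case: ab; rewrite ea eb.
- by rewrite bC orbT subrr mulr0.
- by rewrite aC orbT subrr mul0r.
- by rewrite bC orbT subrr mulr0.
Qed.

(** Each real place has one of the two exponent patterns of [subset_sums_classify]. For any two
    patterns some [P] contradicts [beta_mul0] or [beta_pair]. *)
Lemma no_metric_many_real (total : forall l, \sum_i c i l = 1) :
  (2 <= k)%N -> (k < t)%N -> (2 <= s)%N -> False.
Proof.
move=> k2 kt s2.
have cls j := subset_sums_classify k2 kt (total j) (fun P cP => beta_01 j cP).
pose j1 : 'I_s := Ordinal (ltnW s2); pose j2 : 'I_s := Ordinal s2.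
have j12 : j1 != j2 by [].
have kr : k%:R != 0 :> R by rewrite pnatr_eq0; lia.
have bD (P : {set 'I_t}) j i0 : (forall i, c i j = (i == i0)%:R) -> beta P j = (i0 \in P)%:R.
  move=> H; rewrite /cplx_exponent (eq_bigr _ (fun i _ => H i)).
  case: (boolP (i0 \in P)) => iP.
    rewrite (big_setD1 i0 iP) eqxx /= big1 ?addr0 // => i.
    by rewrite in_setD1 => /andP[/negPf ->].
  by apply: big1 => i; case: eqP => // -> h; rewrite h in iP.
have bE (P : {set 'I_t}) j i0 : (forall i, c i j = k%:R^-1 - (i == i0)%:R) ->
    beta P j = #|P|%:R / k%:R - (i0 \in P)%:R.
  move=> H; rewrite /cplx_exponent (eq_bigr _ (fun i _ => H i)) sumrB sumr_const mulr_natl; congr (_ - _).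
  case: (boolP (i0 \in P)) => iP.
    rewrite (big_setD1 i0 iP) eqxx /= big1 ?addr0 // => i.
    by rewrite in_setD1 => /andP[/negPf ->].
  by apply: big1 => i; case: eqP => // -> h; rewrite h in iP.
have sub (X Y : {set 'I_t}) m : [disjoint X & Y] -> (#|X| <= m)%N -> (m + #|Y| <= t)%N ->
    exists A : {set 'I_t}, [/\ X \subset A, [disjoint A & Y] & #|A| = m].
  by move=> *; apply: subset_between; rewrite ?card_ord.
have c2 (x y : 'I_t) : (#|[set x; y]| <= 2)%N by rewrite cards2; case: (x == y).
have mixed j l i0 i1 : j != l -> (forall i, c i j = (i == i0)%:R) -> t = (2 * k)%N ->
    (forall i, c i l = k%:R^-1 - (i == i1)%:R) -> False.
  move=> jl Hj t2k Hl; have [e|ne] := eqVneq i0 i1.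
    (* With k - 1 elements in [P] the exponent is 1 at [j] and (k - 1)/k - 1 = -1/k at [l], which
       [beta_pair] forbids. *)
    have [|||P [sP _ cP]] := sub [set i0] finset.set0 k.-1.
    - by rewrite -setI_eq0 setI0.
    - by rewrite cards1; lia.
    - by rewrite cards0; lia.
    have iP : i0 \in P by apply: (fintype.subsetP sP); rewrite in_set1.
    have := @beta_pair P j l; rewrite cP prednK ?(ltnW k2) // => /(_ erefl jl).
    rewrite (bD _ _ _ Hj) iP => /(_ erefl); rewrite (bE _ _ _ Hl) -e iP cP.
    have kP : k.-1%:R = k%:R - 1 :> R by rewrite -subn1 natrB //; lia.
    have -> : k.-1%:R / k%:R = 1 - k%:R^-1 :> R by rewrite kP mulrBl divff // mul1r.
    move=> /eqP; rewrite mulf_eq0.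
    have : 0 < k%:R^-1 :> R by rewrite invr_gt0 ltr0n; lia.
    by move=> h /orP[] /eqP; rewrite /=; lra.
  (* Containing [i0] and avoiding [i1] makes both exponents 1. *)
  have [|||P [sP dP cP]] := sub [set i0] [set i1] k.
  - rewrite -setI_eq0; apply/eqP/setP => x; rewrite !inE; apply/negP => /andP[/eqP -> /eqP h].
    by rewrite h eqxx in ne.
  - by rewrite cards1; lia.
  - by rewrite cards1; lia.
  have iP : i0 \in P by apply: (fintype.subsetP sP); rewrite in_set1.
  have iP1 : i1 \notin P by apply/negP => h; have := disjointFr dP h; rewrite in_set1 eqxx.
  have /eqP := beta_mul0 cP jl; rewrite (bD _ _ _ Hj) (bE _ _ _ Hl) iP (negPf iP1) cP divff //.
  by rewrite subr0 mulr1 oner_eq0.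
have [i1 [H1|[e1 H1]]] := cls j1; have [i2 [H2|[e2 H2]]] := cls j2.
- have [|||P [sP _ cP]] := sub [set i1; i2] finset.set0 k.
  + by rewrite -setI_eq0 setI0.
  + by apply: leq_trans (c2 _ _) k2.
  + by rewrite cards0; lia.
  have iP1 : i1 \in P by apply: (fintype.subsetP sP); rewrite in_set2 eqxx.
  have iP2 : i2 \in P by apply: (fintype.subsetP sP); rewrite in_set2 eqxx orbT.
  have /eqP := beta_mul0 cP j12; rewrite (bD _ _ _ H1) (bD _ _ _ H2) iP1 iP2.
  by rewrite mulr1 oner_eq0.
- exact: mixed j12 H1 e2 H2.
- by apply: mixed H2 e1 H1; rewrite eq_sym.
(* Both exponents are 1 once [P] avoids the two exceptional places; there is room because k + 2 <=
   2k = t. *)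
have [|||P [_ dP cP]] := sub finset.set0 [set i1; i2] k.
- by rewrite -setI_eq0 set0I.
- by rewrite cards0.
- by apply: leq_trans (leq_add (leqnn k) (c2 i1 i2)) _; lia.
have iP1 : i1 \notin P by apply/negP => h; have := disjointFr dP h; rewrite in_set2 eqxx.
have iP2 : i2 \notin P by apply/negP => h; have := disjointFr dP h; rewrite in_set2 eqxx orbT.
have /eqP := beta_mul0 cP j12; rewrite (bE _ _ _ H1) (bE _ _ _ H2) (negPf iP1) (negPf iP2) cP divff //.
by rewrite !subr0 mulr1 oner_eq0.
Qed.

End Tests.

Lemma exists_neq_ord m (i0 : 'I_m) : (1 < m)%N -> exists i, i != i0.
Proof.
move=> m2; have [->|ne] := eqVneq i0 (Ordinal (ltnW m2)); first by exists (Ordinal m2).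
by exists (Ordinal (ltnW m2)); rewrite eq_sym.
Qed.

(** * Absolute values of conjugate units, and the case s = 1 *)

Section AbsoluteValues.
Import boot.finset.
Context {R : realType} {s t : nat} {K : fieldExtType rat}.
Context (sigma : 'I_(s + t + t) -> {rmorphism K -> R[i]}) (U : set K).
Context (Hemb : labelled_embeddings sigma) (Hadm : admissible sigma U).
Local Notation n := (s + t)%N.
Context (c : 'I_t -> 'I_s -> R).
Context (Hc : forall i u, U u -> log_abs sigma i u = - \sum_l c i l * lnsig sigma l u).

Definition ln_abs (x : 'I_(s + t + t)) (u : K) : R := ln (normc (sigma x u)).

Lemma ln_abs_real l u : U u -> ln_abs (lshift t (lshift t l)) u = lnsig sigma l u.
Proof.
move=> Uu; rewrite /ln_abs -[sigma _ u]/(emb sigma (lshift t l) u) (emb_rsig Hemb).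
by rewrite /= expr0n addr0 sqrtr_sqr gtr0_norm // (rsig_gt0 Hemb Hadm).
Qed.

Lemma ln_abs_cplx i u : ln_abs (lshift t (rshift s i)) u = log_abs sigma i u / 2.
Proof. by rewrite /log_abs /ln_abs /emb mulrC mulKf. Qed.

Lemma ln_abs_conj i u : ln_abs (rshift (s + t) i) u = log_abs sigma i u / 2.
Proof. by rewrite -ln_abs_cplx /ln_abs (emb_conj Hemb) normc_conj. Qed.

Lemma ln_prod (I : Type) (r : seq I) (F : I -> R) : (forall i, 0 < F i) ->
  ln (\prod_(i <- r) F i) = \sum_(i <- r) ln (F i).
Proof.
move=> F0; elim: r => [|i r IH]; first by rewrite !big_nil ln1.
by rewrite !big_cons lnM ?IH // posrE // prodr_gt0.
Qed.

(** The norm of a unit has absolute value 1. Taking logarithms gives a linear relation among the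
    [lnsig], whose coefficients vanish by [lnsig_span]. *)
Lemma exponents_total l : \sum_i c i l = 1.
Proof.
apply/esym/eqP; rewrite -subr_eq0; apply/eqP.
apply: (lnsig_span Hemb Hadm (d := fun l => 1 - \sum_i c i l)) => u Uu.
have [u0 iu iu' _] := adm_unit Hadm Uu.
have /eqP := norm_unit (emb_inj Hemb) (emb_all Hemb) u0 iu iu'.
rewrite -[`|_|]/((normc _)%:C%C) normc_prod eq_complex /= eqxx andbT => /eqP prod1.
have : \sum_x ln_abs x u = 0.
  by rewrite -ln_prod ?prod1 ?ln1 // => x; exact: normc_sigma_gt0 Hadm _ _ _.
rewrite big_split_ord /= big_split_ord /=.
rewrite (eq_bigr _ (fun l _ => ln_abs_real l Uu)) (eq_bigr _ (fun i _ => ln_abs_cplx i u)).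
rewrite [X in _ + X = _](eq_bigr _ (fun i _ => ln_abs_conj i u)).
rewrite -addrA -mulr_suml -splitr => h.
rewrite -[RHS]h (eq_bigr _ (fun i _ => Hc i Uu)) sumrN exchange_big -sumrB.
by apply: eq_bigr => j _; rewrite mulrBl mul1r mulr_suml.
Qed.

Context (j0 : 'I_s) (s1 : forall l : 'I_s, l = j0).

Lemma nontrivial_unit : exists2 u, U u & lnsig sigma j0 u != 0.
Proof.
apply: contrapT => H.
have := lnsig_span Hemb Hadm (d := fun=> 1) _ j0; move=> h.
have /eqP : (1 : R) = 0; last by rewrite oner_eq0.
apply: h => u Uu; apply: big1 => l _; rewrite mul1r (s1 l).
by apply/eqP; apply: contrapT => /negP nu; apply: H; exists u.
Qed.

Lemma log_abs1 i u : U u -> log_abs sigma i u = - c i j0 * lnsig sigma j0 u.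
Proof.
move=> Uu; rewrite Hc // (bigD1 j0) //= big1 ?addr0 ?mulNr // => l.
by rewrite (s1 l) eqxx.
Qed.

Lemma ln_abs_cases x u : U u -> ln_abs x u = lnsig sigma j0 u \/
  exists i, ln_abs x u = - (c i j0 / 2) * lnsig sigma j0 u.
Proof.
move=> Uu; case: (fintype.splitP x) => y xy.
  have -> : x = lshift t y by apply: val_inj.
  case: (fintype.splitP y) => z yz.
    have -> : y = lshift t z by apply: val_inj.
    by left; rewrite ln_abs_real // (s1 z).
  have -> : y = rshift s z by apply: val_inj.
  by right; exists z; rewrite ln_abs_cplx log_abs1 //; field.
have -> : x = rshift (s + t) y by apply: val_inj.
by right; exists y; rewrite ln_abs_conj log_abs1 //; field.
Qed.

(** At a complex place other than [i0] the unit has modulus 1, so its conjugate there is its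
    inverse. Transported to the real place, this gives a conjugate whose log modulus is the opposite
    of [lnsig]; but the only log moduli available are 1, 0 and -1/2 times [lnsig]. *)
Lemma no_delta_exponents i0 : (2 <= t)%N -> ~ forall i, c i j0 = (i == i0)%:R.
Proof.
move=> t2 H; have [u Uu nu] := nontrivial_unit.
have u0 := U_neq0 Hadm Uu.
have [i ii0] := exists_neq_ord i0 t2.
have [|d] := conjugates_inverse (emb_inj Hemb) (emb_all Hemb) u0 _ (lshift t (lshift t j0)).
  exists (lshift t (rshift s i)), (rshift (s + t) i).
  rewrite (emb_conj Hemb) mul_conj_normc.
  have : ln_abs (lshift t (rshift s i)) u = 0.
    by rewrite ln_abs_cplx log_abs1 // H (negPf ii0) oppr0 !mul0r.
  by move/eqP; rewrite /ln_abs ln_eq0 ?(normc_sigma_gt0 Hadm) // => /eqP ->; rewrite expr1n.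
move=> /(congr1 (@normc R)); rewrite normcM normc1 => /(congr1 (@ln R)).
rewrite lnM ?posrE ?(normc_sigma_gt0 Hadm) // ln1 -/(ln_abs _ u) -/(ln_abs d u) ln_abs_real //.
have [->|[l ->]] := ln_abs_cases d Uu; first by move=> /eqP; rewrite -mulr2n mulrn_eq0 (negPf nu).
rewrite H -[X in X + _]mul1r -mulrDl => /eqP; rewrite mulf_eq0 (negPf nu) orbF.
by case: (l == i0) => /eqP /=; lra.
Qed.

(** The [k]-th power [w] of [u] clears the denominator: |sigma_i w|^2 sigma_1 u = 1 for a complex
    place [i] other than [i0]. Transported so that [u] is read at the complex place [i], its
    logarithm acquires the coefficient -1/(2k), which the two conjugates of [w] cannot
    compensate. *)
Lemma no_fractional_exponents k i0 : (2 <= k)%N -> (2 <= t)%N ->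
  ~ forall i, c i j0 = k%:R^-1 - (i == i0)%:R.
Proof.
move=> k2 t2 H; have [u Uu nu] := nontrivial_unit.
have kr : k%:R != 0 :> R by rewrite pnatr_eq0; lia.
have u0 := U_neq0 Hadm Uu.
have Uw := U_exprn Hadm k Uu; have w0 := U_neq0 Hadm Uw.
have lnX x : ln_abs x (u ^+ k) = k%:R * ln_abs x u.
  rewrite /ln_abs rmorphXn.
  have -> : normc (sigma x u ^+ k) = normc (sigma x u) ^+ k.
    by elim: k {k2 H kr Uw w0} => [|k IH]; rewrite ?expr0 ?normc1 // !exprS normcM IH.
  by rewrite lnXn ?(normc_sigma_gt0 Hadm) // mulr_natl.
have [i ii0] := exists_neq_ord i0 t2.
have [|a [b]] := conjugates_relation (u := u) (emb_inj Hemb) (emb_all Hemb) w0 _ (lshift t (rshift s i)).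
  exists (lshift t (rshift s i)), (rshift (s + t) i), (lshift t (lshift t j0)).
  rewrite (emb_conj Hemb) mul_conj_normc -[sigma _ u]/(emb sigma (lshift t j0) u) (emb_rsig Hemb).
  rewrite -rmorphM -(rmorph1 (real_complex R)); congr (_%:C)%C.
  apply: (@ln_inj R); rewrite ?posrE ?ltr01 ?mulr_gt0 ?exprn_gt0 ?(normc_sigma_gt0 Hadm) ?(rsig_gt0 Hemb Hadm) //.
  rewrite lnM ?posrE ?exprn_gt0 ?(normc_sigma_gt0 Hadm) ?(rsig_gt0 Hemb Hadm) // lnXn ?(normc_sigma_gt0 Hadm) //.
  rewrite -/(ln_abs _ (u ^+ k)) lnX ln_abs_cplx log_abs1 // H (negPf ii0) subr0 ln1 -/(lnsig sigma j0 u).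
  by rewrite mulr2n; field.
move=> /(congr1 (@normc R)); rewrite !normcM normc1 => /(congr1 (@ln R)).
rewrite !lnM ?posrE ?mulr_gt0 ?(normc_sigma_gt0 Hadm) // ln1.
rewrite -/(ln_abs a (u ^+ k)) -/(ln_abs b (u ^+ k)) -/(ln_abs _ u) !lnX ln_abs_cplx log_abs1 // H (negPf ii0) subr0.
(* The integer is 2k at the real place, and at a complex place k - 1 for [i0] and -1 otherwise. *)
have half x : exists z : int, 2 * (k%:R * ln_abs x u) = z%:~R * lnsig sigma j0 u.
  have [->|[l ->]] := ln_abs_cases x Uu.
    by exists (2 * k%:Z); rewrite rmorphM /= -pmulrn mulrA.
  rewrite H; exists ((l == i0)%:Z * k%:Z - 1); rewrite rmorphB rmorphM /= -!pmulrn.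
  by rewrite rmorph1; field.
have [za ea] := half a; have [zb eb] := half b.
move=> h; have : (za + zb)%:~R * lnsig sigma j0 u = k%:R^-1 * lnsig sigma j0 u.
  rewrite rmorphD /= mulrDl -ea -eb; lra.
move=> /(mulIf nu) h'; have : ((za + zb) * k%:Z)%:~R = 1%:~R :> R.
  by rewrite rmorphM /= h' -pmulrn mulVf.
move=> /intr_inj /(congr1 absz); rewrite abszM => /eqP.
rewrite muln_eq1 => /andP[_]; rewrite /=; lia.
Qed.

End AbsoluteValues.

Theorem proposition4 (R : realType) (s t : nat) (K : fieldExtType rat)
    (sigma : 'I_(s + t + t) -> {rmorphism K -> R[i]}) (U : set K) (k : nat) :
  (1 <= s)%N -> (1 <= t)%N ->
  labelled_embeddings sigma ->
  admissible sigma U ->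
  (4 <= s + t)%N ->
  (2 <= k <= s + t - 2)%N ->
  ~ exists g, hermitian_metric sigma U g /\ ddbar_pow_closed sigma U g k.
Proof.
move=> s1 t1 Hemb Hadm st4 /andP[k2 kst] Hg.
have [c Hc] := complex_exponents Hemb Hadm.
have total := exponents_total Hemb Hadm Hc.
have [tk|kt] := leqP t k.
  by have := beta_all Hemb Hadm s1 Hg Hc total k2 tk kst.
have [s2|] := leqP 2 s.
  by have := no_metric_many_real Hemb Hadm s1 Hg Hc total k2 kt s2.
move=> s2; pose j0 : 'I_s := Ordinal s1.
have s1' l : l = j0 by apply: val_inj => /=; have := ltn_ord l; lia.
have [i0 [H|[_ H]]] := subset_sums_classify k2 kt (total j0)
  (fun P cP => beta_01 Hemb Hadm s1 Hg Hc j0 cP).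
  by apply: (no_delta_exponents Hemb Hadm Hc s1' _ H); lia.
by apply: (no_fractional_exponents Hemb Hadm Hc s1' k2 _ H); lia.
Qed.
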